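(* Let $\alpha\in(0,4)$ and $\beta\ge 0$. Let $\mathbf{Z}=\mathbf{Z}_n=(Z_{it})_{i=1,\ldots,p;\,t=1,\ldots,n}$ be $p\times n$ random matrices with iid real entries with generic element $Z$ such that: (i) there are constants $p_+,p_-\ge 0$ with $p_++p_-=1$ and a slowly varying function $L$ with $\mathbb{P}(Z>x)\sim p_+L(x)x^{-\alpha}$ and $\mathbb{P}(Z<-x)\sim p_-L(x)x^{-\alpha}$ as $x\to\infty$; (ii) $\mathbb{E}[Z]=0$ if $\alpha\ge 2$; (iii) $p=p_n=n^\beta\ell(n)$, $n\ge1$, is an integer sequence where $\ell$ is slowly varying, and if $\beta=0$ also $\ell(n)\to\infty$. Then, as $n\to\infty$, the following hold. (1) If $\beta\in[0,1]$, then $a_{np}^{-2}\max_{i=1,\ldots,p}\big|\lambda_{(i)}-D^{\rightarrow}_{(i)}\big|\to 0$ in probability. (2) If $\beta>1$, then $a_{np}^{-2}\max_{i=1,\ldots,n}\big|\lambda_{(i)}-D^{\downarrow}_{(i)}\big|\to 0$ in probability. (3) If $\min(\beta,\beta^{-1})\in\big((\alpha/2-1)_+,1\big]$, then $a_{np}^{-2}\max_{i=1,\ldots,p}\big|\lambda_{(i)}-Z^2_{(i),np}\big|\to 0$ in probability.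
   Context: $(a_k)_{k\ge1}$ is a sequence with $\mathbb{P}(|Z|>a_k)\sim k^{-1}$ as $k\to\infty$; $a_{np}$ is its term with index $np=n\,p_n$. $\lambda_{(1)}\ge\cdots\ge\lambda_{(p)}$ are the ordered eigenvalues of the sample covariance matrix $\mathbf{Z}\mathbf{Z}'$ (with $\lambda_{(i)}=0$ for $i>p\wedge n$). $D_i^{\rightarrow}=\sum_{t=1}^n Z_{it}^2$, $i=1,\ldots,p$, are the row-sums of squares, with order statistics $D_{(1)}^{\rightarrow}\ge\cdots\ge D_{(p)}^{\rightarrow}$. $D_t^{\downarrow}=\sum_{i=1}^p Z_{it}^2$, $t=1,\ldots,n$, are the column-sums of squares, with order statistics $D_{(1)}^{\downarrow}\ge\cdots\ge D_{(n)}^{\downarrow}$. $Z^2_{(1),np}\ge\cdots\ge Z^2_{(np),np}$ are the order statistics of the $np$ variables $(Z_{it}^2)$. $x_+=\max(x,0)$. A slowly varying $L$ satisfies $L(cx)/L(x)\to1$ as $x\to\infty$ for all $c>0$. *)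

(* Defs.v *)
From mathcomp Require Export all_boot all_order all_algebra.
From mathcomp Require Export all_classical all_reals all_analysis.
Export Order.TTheory GRing.Theory Num.Theory.
Export numFieldNormedType.Exports.

Set Implicit Arguments.
Unset Strict Implicit.
Unset Printing Implicit Defensive.

Local Open Scope classical_set_scope.
Local Open Scope ring_scope.

(* Positivity and measurability on a neighbourhood of infinity belong to the
   usual definition (Bingham-Goldie-Teugels). *)
Definition slowly_varying (R : realType) (L : R -> R) : Prop :=
  (exists x0 : R,
     measurable_fun `[x0, +oo[ L /\ forall x, x0 <= x -> 0 < L x) /\
  (forall c : R, 0 < c -> L (c * x) / L x @[x --> +oo] --> (1 : R)).

(* On measurable sets, [B i := setT] recovers the product rule for every
   subfamily. *)
Definition mutually_independent (R : realType) d (Omega : measurableType d)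
    (P : probability Omega R) (I : finType) (X : I -> {RV P >-> R}) : Prop :=
  forall B : I -> set R, (forall i, measurable (B i)) ->
    P (\bigcap_(i in [set: I]) X i @^-1` B i) =
    (\prod_(i : I) P (X i @^-1` B i))%E.

Definition identically_distributed (R : realType) d (Omega : measurableType d)
    (P : probability Omega R) (X Y : {RV P >-> R}) : Prop :=
  forall B : set R, measurable B -> distribution P X B = distribution P Y B.

Definition cvg_in_probability (R : realType) d (Omega : measurableType d)
    (P : probability Omega R) (X : nat -> Omega -> R) (l : R) : Prop :=
  forall eps : R, 0 < eps ->
    P [set w | eps < `|X n w - l|] @[n --> \oo] --> 0%E.

(* Descending order statistics of a finite family, indexed from 0: the largest
   value is [order_stat x 0]; the value is 0 from [#|I|] on. *)
Definition order_stat (R : realType) (I : finType) (x : I -> R) (k : nat) : R :=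
  nth 0 (sort >=%R [seq x i | i : I]) k.

(* The eigenvalues of A with algebraic multiplicity, in descending order.  Such
   a sequence is unique, and it exists when A is symmetric; the default [::] is
   only reached when the characteristic polynomial does not split over R. *)
Definition eigenvalues (R : realType) (m : nat) (A : 'M[R]_m) : seq R :=
  xget [::] [set s : seq R | sorted >=%R s /\
                             char_poly A = \prod_(x <- s) ('X - x%:P)].

Section DataMatrix.
Variables (R : realType) (p n : nat) (M : 'M[R]_(p, n)).

Definition sample_cov : 'M[R]_p := M *m M^T.

(* indexed from 0, and 0 for k >= p *)
Definition ordered_eigenvalue (k : nat) : R := nth 0 (eigenvalues sample_cov) k.

Definition row_sumsq (i : 'I_p) : R := \sum_(t < n) M i t ^+ 2.

Definition col_sumsq (t : 'I_n) : R := \sum_(i < p) M i t ^+ 2.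

Definition entry_sq (it : 'I_p * 'I_n) : R := M it.1 it.2 ^+ 2.

End DataMatrix.

(* max_(k < m) |u k - v k| *)
Definition max_dist (R : realType) (m : nat) (u v : nat -> R) : R :=
  \big[Num.max/0]_(k < m) `|u k - v k|.

Definition random_matrix (R : realType) d (Omega : measurableType d)
    (P : probability Omega R) (p n : nat) (Z : 'I_p -> 'I_n -> {RV P >-> R})
    (w : Omega) : 'M[R]_(p, n) :=
  \matrix_(i, t) Z i t w.

(* Main.v *)
Require Import Defs.
From mathcomp Require Import complex measurable_realfun ring lra.
(** Let N be the number of entries of the matrix M, let u = 1 / alpha and let G be
    the tail of |Z|.  Everything is measured in powers of N.  The norming satisfies
    a_N >= N^(u - o(1)) ([norming_lower]), so an error of order N^y is negligible as
    soon as y < 2 u; all estimates hold with such a gap in the exponent, which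
    absorbs constants and slowly varying factors ([slowly_varying_pow]).

    Eigenvalues and row sums.  The diagonal of M M' consists of the row sums of
    squares, so by Weyl's inequality ([weyl_diag]) it is enough to bound the
    quadratic form of the off-diagonal part of M M' by N^y |x|^2 with y < 2 u
    ([whp_offdiag_heavy]).  With high probability no entry exceeds a power of N
    slightly above u.  If alpha < 2, the Hilbert-Schmidt norm of the off-diagonal
    part of the truncated matrix is already small enough, by a computation of second
    moments.  If alpha >= 2, each entry is split as X + W, where X is truncated at a
    power of N slightly below u and centered.  The products involving W, which is
    rare and has a small mean because Z is centered, are again small in the
    Hilbert-Schmidt norm.  The off-diagonal part of X X' is a sum of independent
    centered matrices, one for each column, and its operator norm is bounded by a
    high even trace moment ([matrix_rosenthal]).  The moment is estimated
    recursively by taking out one column at a time, which rests on inequalities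
    between traces of products of noncommuting symmetric matrices
    ([trace_odd_exp_diff]).

    These bounds need that there are at most N^(1/2 + o(1)) rows.  That is the case for
    M if beta <= 1 and for its transpose if beta > 1; as the two have the same
    nonzero eigenvalues ([ordered_eigenvalue_trmx]), the second statement follows
    from the estimate for the transpose, whose row sums are the column sums.

    Eigenvalues and entries.  The hypothesis on min(beta, 1 / beta) says that the
    longer side of the matrix is at most N^kap with kap < 1 and kap < 2 u.  Then with
    high probability no row (of M, or of its transpose if beta > 1) contains two
    entries above a power of N slightly below u, and the squares of the smaller
    entries of each row add up to at most N^z with z < 2 u.  On this event the large
    row sums and the large squared entries correspond to each other up to N^z
    ([row_sumsq_single_entry]), and the eigenvalues follow the row sums. *)

Set Implicit Arguments.
Unset Strict Implicit.
Unset Printing Implicit Defensive.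
Local Open Scope ring_scope.

(** * Spectral theorem for real symmetric matrices *)

Section Spectral.
Variable R : rcfType.

Lemma sum_sqr_eq0 (n : nat) (v : 'rV[R]_n) :
  v *m v^T = 0 -> v = 0.
Proof.
move=> /(congr1 (fun M : 'M[R]_1 => M 0 0)); rewrite !mxE => /eqP.
rewrite psumr_eq0 => [/allP h|i _]; last by rewrite mxE -expr2 sqr_ge0.
apply/rowP => j; rewrite mxE; apply/eqP.
by have := h j (mem_index_enum _); rewrite mxE -expr2 sqrf_eq0.
Qed.

(** A real symmetric matrix is Hermitian over the complex extension of the base
    field, so it has an eigenvalue there which is real; being a root of the real
    characteristic polynomial, it has a real eigenvector. *)
Lemma symmetric_eigenvector (n : nat) (A : 'M[R]_n.+1) : A^T = A ->
  exists l (v : 'rV[R]_n.+1), v *m v^T = 1%:M /\ v *m A = l *: v.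
Proof.
move=> symA.
pose AC : 'M[complex R]_n.+1 := map_mx (real_complex R) A.
have hermA : AC \is hermsymmx.
  apply: realsym_hermsym.
    by apply/is_hermitianmxP; rewrite expr0 scale1r; apply/matrixP => i j; rewrite !mxE -[in LHS]symA mxE.
  by apply/mxOverP => i j; rewrite mxE complex_real.
have /hermitian_normalmx/orthomx_spectralP := hermA.
have /mxOverP := hermitian_spectral_diag_real hermA.
set P := spectralmx AC; set D := spectral_diag AC => realD eqA.
have unitP : P \in unitmx by exact: spectral_unit.
have PA : P *m AC = diag_mx D *m P by rewrite {1}eqA !mulmxA mulmxV // mul1mx.
pose l := Re (D 0 0).
have Dl : D 0 0 = (real_complex R) l.
  by have := realD 0 0; rewrite /l; case: (D 0 0) => x y; rewrite complex_real => /eqP->.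
have : root (char_poly AC) (real_complex R l).
  rewrite -eigenvalue_root_char; apply/eigenvalueP; exists (row 0 P).
    by rewrite -row_mul PA mul_diag_mx; apply/rowP => j; rewrite !mxE Dl.
  apply/eqP => r0; have := congr1 (row 0) (mulmxV unitP).
  by rewrite row_mul r0 mul0mx => /rowP/(_ 0)/eqP; rewrite !mxE eqxx eq_sym oner_eq0.
rewrite -map_char_poly fmorph_root -eigenvalue_root_char => /eigenvalueP[v vA v0].
have vv : v *m v^T = ((v *m v^T) 0 0)%:M by rewrite [LHS]mx11_scalar.
have vv_gt0 : 0 < (v *m v^T) 0 0.
  rewrite lt_def; apply/andP; split; last first.
    by rewrite mxE sumr_ge0 // => i _; rewrite mxE -expr2 sqr_ge0.
  by apply: contra v0 => /eqP e; apply/eqP/sum_sqr_eq0; rewrite vv e raddf0.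
set s := (v *m v^T) 0 0 in vv vv_gt0.
exists l, ((Num.sqrt s)^-1 *: v); split; last first.
  by rewrite -scalemxAl vA !scalerA mulrC.
rewrite linearZ /= -scalemxAl -scalemxAr vv scalerA -invfM -expr2 sqr_sqrtr ?ltW //.
by rewrite scale_scalar_mx mulVf ?gt_eqF.
Qed.

(** The reflection that exchanges the first basis vector and v. *)
Lemma orthogonal_completion (n : nat) (v : 'rV[R]_n.+1) : v *m v^T = 1%:M ->
  exists H : 'M[R]_n.+1, H *m H^T = 1%:M /\ row 0 H = v.
Proof.
move=> vv; pose e : 'rV[R]_n.+1 := delta_mx 0 0.
have [->|vNe] := eqVneq v e.
  exists 1%:M; rewrite trmx1 mulmx1; split => //.
  by apply/rowP => j; rewrite !mxE eqxx /= eq_sym.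
pose w := v - e; pose s := (w *m w^T) 0 0.
have ww : w *m w^T = s%:M by rewrite [LHS]mx11_scalar.
have s0 : s != 0.
  apply/eqP => s0; have := @sum_sqr_eq0 _ w; rewrite ww s0 raddf0 => /(_ erefl)/eqP.
  by rewrite subr_eq0 (negbTE vNe).
have ee : e *m e^T = 1%:M.
  apply/matrixP => i j; rewrite !ord1 !mxE (bigD1 0) //= big1 ?addr0 => [|k k0].
    by rewrite !mxE !eqxx mulr1.
  by rewrite !mxE (negbTE k0) andbF mul0r.
have ve : v *m e^T = e *m v^T.
  by apply: trmx_inj; rewrite trmx_mul trmxK; rewrite [LHS]mx11_scalar [RHS]mx11_scalar !mxE; congr (_%:M); apply: eq_bigr => k _; rewrite !mxE mulrC.
pose c := (e *m v^T) 0 0.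
have ev : e *m v^T = c%:M by rewrite [LHS]mx11_scalar.
have sE : s = 2 - 2 * c.
  have : w *m w^T = (2 - 2 * c)%:M.
    rewrite /w linearB /= mulmxBl !mulmxBr vv ve ee ev.
    by rewrite -!raddfB /=; congr (_%:M); ring.
  by rewrite ww => /matrixP/(_ 0 0); rewrite !mxE eqxx !mulr1n.
have ew : e *m w^T = (c - 1)%:M by rewrite /w linearB /= mulmxBr ev ee -raddfB.
have wE : w = v - e by [].
clearbody w.
pose H : 'M[R]_n.+1 := 1%:M - (2 / s) *: (w^T *m w).
have HT : H^T = H by rewrite /H linearB /= trmx1 linearZ /= trmx_mul trmxK.
exists H; split.
  rewrite HT /H mulmxBl !mulmxBr !mul1mx mulmx1 -!scalemxAl -!scalemxAr.
  rewrite mulmxA -[w^T *m w *m w^T]mulmxA ww mul_mx_scalar -scalemxAl !scalerA.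
  rewrite -[RHS]subr0 -addrA; congr (_ + _).
  rewrite -scaleNr -scalerBl -scalerBl.
  have -> : - (2 / s) - (2 / s - 2 / s * (2 / s * s)) = 0 by field.
  by rewrite scale0r oppr0.
have -> : row 0 H = e *m H by rewrite rowE.
rewrite /H mulmxBr mulmx1 -scalemxAr mulmxA ew mul_scalar_mx scalerA.
have -> : 2 / s * (c - 1) = -1 by rewrite sE; field; rewrite -sE.
by rewrite scaleN1r opprK wE addrC subrK.
Qed.

(** Deflation: conjugating by an orthogonal matrix whose first row is a unit
    eigenvector splits off a 1 x 1 block, and the rest is again symmetric. *)
Theorem symmetric_spectral (n : nat) (A : 'M[R]_n) : A^T = A ->
  exists (U : 'M[R]_n) (d : 'rV[R]_n),
    U *m U^T = 1%:M /\ A = U^T *m diag_mx d *m U.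
Proof.
elim: n A => [|n IH] A symA.
  by exists 1%:M, 0; rewrite trmx1 mulmx1; split => //; apply/matrixP => -[].
have [l [v [vv vA]]] := symmetric_eigenvector symA.
have [H [HH rH]] := orthogonal_completion vv.
have HTH : H^T *m H = 1%:M by exact: mulmx1C.
pose B : 'M[R]_(1 + n) := H *m A *m H^T.
have symB : B^T = B by rewrite /B !trmx_mul trmxK symA mulmxA.
have rB : row 0 B = l *: delta_mx 0 0.
  rewrite /B !row_mul rH vA -scalemxAl -rH -row_mul HH.
  by congr (_ *: _); apply/rowP => j; rewrite !mxE eqxx /= eq_sym.
have BdE : B = H *m A *m H^T by [].
clearbody B.
have Bur : ursubmx B = 0.
  apply/rowP => j; have := congr1 (fun r : 'rV[R]_(1+n) => r 0 (rshift 1 j)) rB.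
  rewrite !mxE /= mulr0 => <-; congr (B _ _); exact/val_inj.
have Bdl : dlsubmx B = 0 by rewrite -[B]symB -trmx_ursub Bur trmx0.
have Bul : ulsubmx B = l%:M.
  apply/matrixP => i j; rewrite !ord1; have := congr1 (fun r : 'rV[R]_(1+n) => r 0 (lshift n 0)) rB.
  rewrite !mxE /= mulr1 mulr1n => <-; congr (B _ _); exact/val_inj.
have symC : (drsubmx B)^T = drsubmx B by rewrite trmx_drsub symB.
have [U [d [UU dE]]] := IH _ symC.
pose V : 'M[R]_(1 + n) := block_mx 1%:M 0 0 U.
have VV : V *m V^T = 1%:M.
  rewrite /V tr_block_mx mulmx_block !trmx0 trmx1 !mulmx0 !mul0mx !mulmx1 !addr0 add0r UU.
  by rewrite -scalar_mx_block.
exists (V *m H), (row_mx l%:M d); split.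
  by rewrite trmx_mul mulmxA -[V *m H *m H^T]mulmxA HH mulmx1.
have BE : B = V^T *m diag_mx (row_mx l%:M d) *m V.
  rewrite diag_mx_row /V tr_block_mx !mulmx_block !trmx0 trmx1 !mulmx0 !mul0mx !mulmx1 !mul1mx !addr0 !add0r ?mul0mx -dE.
  by rewrite -{1}[B]submxK Bur Bdl Bul; congr block_mx; apply/matrixP => i j; rewrite !ord1 !mxE.
transitivity (H^T *m B *m H).
  by rewrite BdE !mulmxA HTH mul1mx -!mulmxA HTH mulmx1.
by rewrite BE trmx_mul !mulmxA.
Qed.

End Spectral.

(** * Trace inequalities *)

Section Traces.
Variable R : rcfType.
Variable n : nat.
Implicit Types A S T X : 'M[R]_n.

Lemma conj_diag_exp (U : 'M[R]_n) (d : 'rV[R]_n) (k : nat) : U *m U^T = 1%:M ->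
  (U^T *m diag_mx d *m U) ^+ k = U^T *m diag_mx (map_mx (fun x => x ^+ k) d) *m U.
Proof.
move=> UU; elim: k => [|k IH].
  rewrite expr0; have -> : map_mx (fun x : R => x ^+ 0) d = const_mx 1.
    by apply/rowP => j; rewrite !mxE.
  by rewrite diag_const_mx mulmx1 mulmx1C.
rewrite exprS IH -mulmxE !mulmxA -[_ *m U *m U^T]mulmxA UU mulmx1.
congr (_ *m _); rewrite -!mulmxA; congr (_ *m _); rewrite mulmx_diag.
by congr diag_mx; apply/rowP => j; rewrite !mxE exprS.
Qed.

(** In eigenbases of S and T, a trace of A S^j A T^l is a moment of a
    nonnegative weight on pairs of eigenvalues.  This reduces the trace
    inequalities below to inequalities between numbers, although the three
    matrices do not commute. *)
Lemma trace_weights A S T : A^T = A -> S^T = S -> T^T = T ->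
  exists (w : 'I_n -> 'I_n -> R) (d e : 'I_n -> R), (forall a b, 0 <= w a b) /\
  forall j l, \tr (A * S ^+ j * A * T ^+ l) = \sum_a \sum_b w a b * d a ^+ j * e b ^+ l.
Proof.
move=> sA sS sT.
have [U [d [UU ->]]] := symmetric_spectral sS.
have [V [e [VV ->]]] := symmetric_spectral sT.
pose B := U *m A *m V^T.
have BT : B^T = V *m A *m U^T by rewrite /B !trmx_mul trmxK sA mulmxA.
exists (fun a b => B a b ^+ 2), (d 0), (e 0); split=> [a b|j l]; first exact: sqr_ge0.
rewrite !conj_diag_exp // -!mulmxE.
set D := map_mx _ d; set E := map_mx _ e.
transitivity (\tr (B^T *m diag_mx D *m B *m diag_mx E)).
  by rewrite !mulmxA mxtrace_mulC BT /B !mulmxA.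
clearbody B; rewrite exchange_big /mxtrace; apply: eq_bigr => b _ /=.
rewrite mul_mx_diag mul_mx_diag !mxE mulr_suml; apply: eq_bigr => a _.
by rewrite !mxE; ring.
Qed.

Lemma mxtrace_mulrC X Y : \tr (X * Y) = \tr (Y * X).
Proof. by rewrite -!mulmxE mxtrace_mulC. Qed.

(** For numbers, |d|^j |e|^l is at most d^(2m) + e^(2m) when j + l = 2m, whichever
    of |d|, |e| is larger. *)
Lemma trace_interpolation A S T (j l m : nat) : A^T = A -> S^T = S -> T^T = T ->
  (j + l = m.*2)%N ->
  `|\tr (A * S ^+ j * A * T ^+ l)| <=
    \tr (A * S ^+ m.*2 * A) + \tr (A * A * T ^+ m.*2).
Proof.
move=> sA sS sT jl; have [w [d [e [w0 wE]]]] := trace_weights sA sS sT.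
have := wE m.*2 0; have := wE 0 m.*2; rewrite !expr0 !mulr1 => -> ->; rewrite wE.
rewrite -big_split /= (le_trans (ler_norm_sum _ _ _)) // ler_sum // => a _.
rewrite -big_split /= (le_trans (ler_norm_sum _ _ _)) // ler_sum // => b _.
rewrite !expr0 !mulr1 !normrM !normrX (ger0_norm (w0 a b)) -mulrDr -mulrA.
apply: ler_wpM2l => //.
have ev x : x ^+ m.*2 = `|x : R| ^+ m.*2.
  by rewrite -normrX ger0_norm // exprn_even_ge0 // odd_double.
rewrite (ev (d a)) (ev (e b)) -jl !exprD; have [de|/ltW ed] := leP `|d a| `|e b|.
  rewrite (le_trans (_ : _ <= `|e b| ^+ j * `|e b| ^+ l)) //.
    by rewrite ler_wpM2r ?exprn_ge0 // lerXn2r ?nnegrE.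
  by rewrite lerDr mulr_ge0 // exprn_ge0.
rewrite (le_trans (_ : _ <= `|d a| ^+ j * `|d a| ^+ l)) //.
  by rewrite ler_wpM2l ?exprn_ge0 // lerXn2r ?nnegrE.
by rewrite lerDl mulr_ge0 // exprn_ge0.
Qed.

(** The squared Hilbert-Schmidt norm. *)
Definition hs2 (X : 'M[R]_n) : R := \tr (X * X^T).

Lemma hs2E X : hs2 X = \sum_i \sum_j X i j ^+ 2.
Proof.
rewrite /hs2 /mxtrace; apply: eq_bigr => i _; rewrite -mulmxE mxE.
by apply: eq_bigr => j _; rewrite mxE expr2.
Qed.

Lemma hs2_ge0 X : 0 <= hs2 X.
Proof. by rewrite hs2E sumr_ge0 // => i _; rewrite sumr_ge0 // => j _; rewrite sqr_ge0. Qed.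

Lemma sum_sqr_le (m : nat) (f : 'I_m -> R) :
  (\sum_i f i) ^+ 2 <= m%:R * \sum_i f i ^+ 2.
Proof.
elim: m f => [|m IH] f; first by rewrite !big_ord0 expr0n /= mulr0.
have := IH (fun i => f (lift ord0 i)); rewrite !big_ord_recl /=.
set a := f ord0; set s := \sum_(i < m) _; set t := \sum_(i < m) _ => h.
have : 0 <= \sum_(i < m) (a - f (lift ord0 i)) ^+ 2 by rewrite sumr_ge0 // => i _; rewrite sqr_ge0.
have -> : \sum_(i < m) (a - f (lift ord0 i)) ^+ 2 = m%:R * a ^+ 2 - 2 * a * s + t.
  under eq_bigr do rewrite sqrrB.
  rewrite big_split /= sumrB sumr_const card_ord /s mulr_sumr mulr_natl.
  by congr (_ - _ + _); apply: eq_bigr => i _; rewrite -mulr_natl; ring.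
move=> h2; rewrite -natr1 sqrrD -subr_ge0.
have : 0 <= m%:R * t - s ^+ 2 by rewrite subr_ge0.
lra.
Qed.

Lemma hs2_sum (m : nat) (F : 'I_m -> 'M[R]_n) :
  hs2 (\sum_i F i) <= m%:R * \sum_i hs2 (F i).
Proof.
rewrite hs2E; under [X in _ <= _ * X]eq_bigr do rewrite hs2E.
rewrite [X in _ <= _ * X]exchange_big mulr_sumr ler_sum //= => a _.
rewrite [X in _ <= _ * X]exchange_big mulr_sumr ler_sum //= => b _.
by rewrite summxE sum_sqr_le.
Qed.

Lemma hs2D X Y : hs2 (X + Y) <= 2 * (hs2 X + hs2 Y).
Proof.
have := @hs2_sum 2 (fun i => if i == ord0 then X else Y).
by rewrite !big_ord_recl !big_ord0 !addr0.
Qed.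

(** Telescoping in the noncommutative ring of matrices. *)
Lemma sub_exp S T (m : nat) :
  S ^+ m - T ^+ m = \sum_(j < m) T ^+ j * (S - T) * S ^+ (m - j.+1).
Proof.
elim: m => [|m IH]; first by rewrite !expr0 subrr big_ord0.
rewrite big_ord_recl /= expr0 mul1r subSS subn0.
under eq_bigr do rewrite /bump /= add1n subSS exprS -!mulrA.
rewrite -mulr_sumr; under eq_bigr do rewrite mulrA.
by rewrite -IH !exprS mulrBl mulrBr addrA subrK.
Qed.

Lemma trmx_exp S k : S^T = S -> (S ^+ k)^T = S ^+ k.
Proof.
move=> sS; elim: k => [|k IH]; first by rewrite expr0 trmx1.
by rewrite exprS -mulmxE trmx_mul IH sS mulmxE -exprSr exprS.
Qed.

(** Any constant that depends on r alone serves; this one follows the induction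
    in [hs2_mul_exp]. *)
Fixpoint word_cst (r : nat) : nat :=
  if r is r'.+1 then (r'.+2 ^ 2 * (word_cst r').+1)%N else 1%N.

(** Powers of T + A are traded for powers of T: expand by [sub_exp], so that each
    term but A T^(r + 1) contains a second factor A, then lower the exponent by
    [trace_interpolation] and pay l for the extra A. *)
Lemma hs2_mul_exp A T (l : R) (r : nat) : A^T = A -> T^T = T -> 0 <= l ->
  (forall X, hs2 (A * X) <= l ^+ 2 * hs2 X) ->
  hs2 (A * (T + A) ^+ r) <=
    (word_cst r)%:R * \sum_(k < r.+1) (l ^+ 2) ^+ (r - k) * hs2 (A * T ^+ k).
Proof.
move=> sA sT l0 Al; set S := T + A.
have sS : S^T = S by rewrite /S linearD /= sA sT.
elim: r => [|r IH].
  by rewrite big_ord_recl big_ord0 /= !expr0 !mulr1 !mul1r addr0.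
set Q := \sum_(k < r.+2) _.
have nn k m : 0 <= (l ^+ 2) ^+ m * hs2 (A * T ^+ k).
  by rewrite mulr_ge0 ?hs2_ge0 // exprn_ge0 // exprn_ge0.
have QE : Q = l ^+ 2 * (\sum_(k < r.+1) (l ^+ 2) ^+ (r - k) * hs2 (A * T ^+ k))
    + hs2 (A * T ^+ r.+1).
  rewrite /Q big_ord_recr /= subnn expr0 mul1r; congr (_ + _).
  rewrite mulr_sumr; apply: eq_bigr => k _; rewrite mulrA -exprS subSn //.
  by rewrite -ltnS ltn_ord.
set q := \sum_(k < r.+1) _ in IH QE.
have q0 : 0 <= q by rewrite sumr_ge0.
have qr : hs2 (A * T ^+ r) <= q.
  by rewrite /q big_ord_recr /= subnn expr0 mul1r lerDr sumr_ge0.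
(* The term without a second factor A sits at index 0, the telescoping terms after it. *)
pose F (i : 'I_r.+2) : 'M[R]_n := if unlift ord0 i is Some j then
   A * (T ^+ j * (S - T) * S ^+ (r.+1 - j.+1)) else A * T ^+ r.+1.
have -> : A * S ^+ r.+1 = \sum_i F i.
  rewrite big_ord_recl /F unlift_none.
  under eq_bigr do rewrite liftK.
  by rewrite -mulr_sumr -sub_exp -mulrDr addrC subrK.
apply: le_trans (hs2_sum F) _.
have Fj (j : 'I_r.+1) : hs2 (F (lift ord0 j)) <= l ^+ 2 * (hs2 (A * S ^+ r) + hs2 (A * T ^+ r)).
  rewrite /F liftK -mulrA (le_trans (Al _)) // ler_wpM2l ?exprn_ge0 //.
  have -> : S - T = A by rewrite /S addrC addKr.
  rewrite subSS; have jr : (j <= r)%N by rewrite -ltnS.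
  rewrite [X in X <= _]/hs2.
  have trE : \tr (T ^+ j * (A * S ^+ (r - j)) * (T ^+ j * (A * S ^+ (r - j)))^T) =
    \tr (A * S ^+ (r - j).*2 * A * T ^+ j.*2).
    rewrite -!mulmxE !trmx_mul sA !trmx_exp // !mulmxE -addnn -(addnn j) !exprD.
    set t := T ^+ j; set u := S ^+ (r - j).
    transitivity (\tr (A * (u * u) * A * t * t)); last by rewrite !mulrA.
    by rewrite -!mulrA mxtrace_mulrC -!mulrA.
  rewrite trE (le_trans (ler_norm _)) //.
  apply: le_trans (trace_interpolation (m := r) sA sS sT _) _.
    by rewrite -doubleD subnK.
  rewrite /hs2 -!mulmxE !trmx_mul sA !trmx_exp // !mulmxE; apply: lerD; last first.
    by rewrite -addnn exprD -!mulrA mxtrace_mulrC -!mulrA (mxtrace_mulrC A) -!mulrA.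
  by rewrite -addnn exprD !mulrA.
have sumF : \sum_i hs2 (F i) <= hs2 (A * T ^+ r.+1) +
     r.+1%:R * (l ^+ 2 * (hs2 (A * S ^+ r) + hs2 (A * T ^+ r))).
  rewrite big_ord_recl {1}/F unlift_none lerD2l.
  apply: le_trans (ler_sum _ (fun j _ => Fj j)) _.
  by rewrite sumr_const card_ord mulr_natl.
have l20 : 0 <= l ^+ 2 by rewrite exprn_ge0.
apply: le_trans (ler_wpM2l _ sumF) _ => //.
have h1 : l ^+ 2 * (hs2 (A * S ^+ r) + hs2 (A * T ^+ r)) <= (word_cst r).+1%:R * (l ^+ 2 * q).
  rewrite mulrCA ler_wpM2l // -natr1 mulrDl mul1r lerD //.
have h2 : 0 <= l ^+ 2 * q by rewrite mulr_ge0.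
have h3 := hs2_ge0 (A * T ^+ r.+1).
rewrite QE [word_cst _]/= natrM natrX.
move: h1 h2 h3; set a := l ^+ 2 * _; set b := l ^+ 2 * q; set h := hs2 _.
set c := (word_cst r).+1%:R => h1 h2 h3.
have c1 : 1 <= c by rewrite /c -natr1 lerDr.
have -> : r.+1%:R = r.+2%:R - 1 :> R by rewrite -[r.+2%:R]natr1 addrK.
have : 1 <= r.+2%:R :> R by rewrite ler1n.
move: (r.+2%:R) => x x1.
have x0 : 0 <= x by rewrite (le_trans _ x1).
rewrite expr2 -mulrA -mulrA ler_wpM2l //.
have x10 : 0 <= x - 1 by rewrite subr_ge0.
have c0 : 0 <= c by rewrite (le_trans _ c1).
have : (x - 1) * a <= (x - 1) * (c * b) by rewrite ler_wpM2l.
have : (x - 1) * (c * b) <= x * (c * b).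
  by rewrite ler_wpM2r ?mulr_ge0 // gerBl.
have : h <= x * (c * h).
  rewrite (le_trans (_ : h <= c * h)) ?ler_peMl // mulr_ge0 //.
lra.
Qed.

(** When one summand A is removed from a sum T + A, the trace of A against an odd
    power changes only by terms of second order in A, because the first order
    term is what is subtracted.  After taking expectations with A centered and
    independent of T, this gives a recursion between even trace moments. *)
Lemma trace_odd_exp_diff A T (l : R) (r : nat) : A^T = A -> T^T = T -> 0 <= l ->
  (forall X, hs2 (A * X) <= l ^+ 2 * hs2 X) ->
  \tr (A * (T + A) ^+ r.*2.+1) - \tr (A * T ^+ r.*2.+1) <=
    (r.*2.+1 * (word_cst r).+1)%:R *
    \sum_(k < r.+1) (l ^+ 2) ^+ (r - k) * hs2 (A * T ^+ k).
Proof.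
move=> sA sT l0 Al; set S := T + A.
have sS : S^T = S by rewrite /S linearD /= sA sT.
have nn k m : 0 <= (l ^+ 2) ^+ m * hs2 (A * T ^+ k).
  by rewrite mulr_ge0 ?hs2_ge0 // exprn_ge0 // exprn_ge0.
have := hs2_mul_exp r sA sT l0 Al; rewrite -/S.
set q := \sum_(k < r.+1) _ => hS.
have hT : hs2 (A * T ^+ r) <= q.
  by rewrite /q big_ord_recr /= subnn expr0 mul1r lerDr sumr_ge0.
rewrite -raddfB -mulrBr sub_exp mulr_sumr raddf_sum /=.
have ST : S - T = A by rewrite /S addrC addKr.
have step (j : 'I_r.*2.+1) : \tr (A * (T ^+ j * (S - T) * S ^+ (r.*2.+1 - j.+1))) <=
    (word_cst r).+1%:R * q.
  rewrite ST (le_trans (ler_norm _)) // !mulrA.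
  apply: le_trans (trace_interpolation (m := r) sA sT sS _) _.
    by rewrite subSS subnKC // -ltnS.
  rewrite -natr1 mulrDl mul1r addrC lerD //.
    apply: le_trans hS; rewrite /hs2 -!mulmxE !trmx_mul sA !trmx_exp // !mulmxE.
    by rewrite -addnn exprD -!mulrA mxtrace_mulrC -!mulrA (mxtrace_mulrC A) -!mulrA.
  apply: le_trans hT; rewrite /hs2 -!mulmxE !trmx_mul sA !trmx_exp // !mulmxE.
  by rewrite -addnn exprD !mulrA.
apply: le_trans (ler_sum _ (fun j _ => step j)) _.
by rewrite sumr_const card_ord natrM -mulrA [X in _ <= X]mulr_natl.
Qed.

(** An even power of an eigenvalue is at most the trace of that power. *)
Lemma qform_le_trace S (q : nat) (e : R) : S^T = S -> 0 <= e ->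
  \tr (S ^+ q.*2) <= e ^+ q.*2 -> (0 < q)%N ->
  forall x : 'rV[R]_n, `|(x *m S *m x^T) 0 0| <= e * (x *m x^T) 0 0.
Proof.
move=> sS e0; have [U [d [UU SE]]] := symmetric_spectral sS.
rewrite SE conj_diag_exp // => tre q0 x.
have {}tre : \sum_i d 0 i ^+ q.*2 <= e ^+ q.*2.
  apply: le_trans tre; rewrite mxtrace_mulC mulmxA UU mul1mx mxtrace_diag.
  by apply: ler_sum => i _; rewrite mxE.
have de i : `|d 0 i| <= e.
  have : `|d 0 i| ^+ q.*2 <= e ^+ q.*2.
    apply: le_trans tre; rewrite -normrX ger0_norm ?exprn_even_ge0 ?odd_double //.
    by rewrite (bigD1 i) //= lerDl sumr_ge0 // => j _; rewrite exprn_even_ge0 ?odd_double.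
  by rewrite ler_pXn2r ?nnegrE // double_gt0.
pose y := x *m U^T.
have -> : x *m (U^T *m diag_mx d *m U) *m x^T = y *m diag_mx d *m y^T.
  by rewrite /y trmx_mul trmxK !mulmxA.
have -> : x *m x^T = y *m y^T.
  by rewrite /y trmx_mul trmxK !mulmxA -[x *m _ *m _]mulmxA mulmx1C // mulmx1.
rewrite mul_mx_diag !mxE mulr_sumr (le_trans (ler_norm_sum _ _ _)) // ler_sum // => i _.
rewrite !mxE !normrM mulrAC -expr2 -normrX (ger0_norm (sqr_ge0 _)) mulrC -expr2.
by rewrite ler_wpM2r // sqr_ge0.
Qed.

End Traces.

(** * Quadratic forms and off-diagonal parts *)

Section QuadraticForms.
Variable R : rcfType.

Lemma cauchy_schwarz (I : finType) (a b : I -> R) :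
  (\sum_i a i * b i) ^+ 2 <= (\sum_i a i ^+ 2) * (\sum_i b i ^+ 2).
Proof.
have : 0 <= \sum_i \sum_j (a i * b j - a j * b i) ^+ 2.
  by rewrite sumr_ge0 // => i _; rewrite sumr_ge0 // => j _; rewrite sqr_ge0.
have -> : \sum_i \sum_j (a i * b j - a j * b i) ^+ 2 =
   (\sum_i a i ^+ 2) * (\sum_i b i ^+ 2) + (\sum_i a i ^+ 2) * (\sum_i b i ^+ 2)
   - (\sum_i a i * b i) ^+ 2 *+ 2.
  rewrite [X in _ + X - _]mulrC expr2 !mulr_suml -sumrMnl -!big_split -sumrB /=.
  apply: eq_bigr => i _; rewrite !mulr_sumr -sumrMnl -!big_split -sumrB /=.
  by apply: eq_bigr => j _; rewrite -mulr_natl; ring.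
by rewrite -mulr2n -mulrnBl pmulrn_lge0 // subr_ge0.
Qed.

Lemma normv2E (n : nat) (x : 'rV[R]_n) : (x *m x^T) 0 0 = \sum_i x 0 i ^+ 2.
Proof. by rewrite mxE; apply: eq_bigr => i _; rewrite mxE expr2. Qed.

Lemma normv2_ge0 (n : nat) (x : 'rV[R]_n) : 0 <= (x *m x^T) 0 0.
Proof. by rewrite normv2E sumr_ge0 // => i _; rewrite sqr_ge0. Qed.

(** The operator norm is at most the Hilbert-Schmidt norm; stated for quadratic
    forms because F may fail to be symmetric. *)
Lemma qform_le_hs2 (n : nat) (F : 'M[R]_n) (e : R) : 0 <= e -> hs2 F <= e ^+ 2 ->
  forall x : 'rV[R]_n, `|(x *m F *m x^T) 0 0| <= e * (x *m x^T) 0 0.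
Proof.
move=> e0 Fe x.
have -> : (x *m F *m x^T) 0 0 = \sum_(p : 'I_n * 'I_n) F p.1 p.2 * (x 0 p.1 * x 0 p.2).
  rewrite -(pair_bigA _ (fun i j => F i j * (x 0 i * x 0 j))) exchange_big mxE /=.
  apply: eq_bigr => j _; rewrite !mxE mulr_suml; apply: eq_bigr => i _; ring.
rewrite -(@ler_pXn2r _ 2) ?nnegrE ?mulr_ge0 ?normv2_ge0 // -normrX ger0_norm ?sqr_ge0 //.
apply: le_trans (cauchy_schwarz _ _) _.
rewrite exprMn; apply: ler_pM.
- by rewrite sumr_ge0 // => i _; rewrite sqr_ge0.
- by rewrite sumr_ge0 // => i _; rewrite sqr_ge0.
- by rewrite -(pair_bigA _ (fun i j => F i j ^+ 2)) /= -hs2E.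
rewrite normv2E -(pair_bigA _ (fun i j => (x 0 i * x 0 j) ^+ 2)) /= expr2 mulr_suml.
apply: ler_sum => i _; rewrite mulr_sumr; apply: ler_sum => j _.
by rewrite exprMn.
Qed.

Definition offdiag (n : nat) (A : 'M[R]_n) : 'M[R]_n :=
  \matrix_(i, j) (if i == j then 0 else A i j).

Lemma offdiag_sym (n : nat) (A : 'M[R]_n) : A^T = A -> (offdiag A)^T = offdiag A.
Proof.
by move=> sA; apply/matrixP => i j; rewrite !mxE eq_sym -[in LHS]sA mxE.
Qed.

(** The operator norm of the off-diagonal part of v' v is at most 2 |v|^2: the
    rank one matrix and its diagonal have norm at most |v|^2 each. *)
Lemma hs2_offdiag_rank1 (n : nat) (v : 'rV[R]_n) (X : 'M[R]_n) :
  hs2 (offdiag (v^T *m v) * X) <= (2 * \sum_i v 0 i ^+ 2) ^+ 2 * hs2 X.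
Proof.
set s := \sum_i v 0 i ^+ 2.
have s0 : 0 <= s by rewrite sumr_ge0 // => i _; rewrite sqr_ge0.
have vs i : v 0 i ^+ 2 <= s.
  by rewrite /s (bigD1 i) //= lerDl sumr_ge0 // => j _; rewrite sqr_ge0.
have offE : offdiag (v^T *m v) = v^T *m v - diag_mx (\row_i v 0 i ^+ 2).
  apply/matrixP => i j; rewrite !mxE big_ord1 !mxE; case: eqP => [->|_].
    by rewrite mulr1n expr2 subrr.
  by rewrite mulr0n subr0.
rewrite offE mulrBl (le_trans (hs2D _ _)) //.
have h1 : hs2 (v^T *m v * X) <= s ^+ 2 * hs2 X.
  rewrite -mulmxE -mulmxA !hs2E expr2 -mulrA {1}/s mulr_suml ler_sum // => i _.
  under eq_bigr do rewrite !mxE big_ord1 mxE exprMn.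
  rewrite -mulr_sumr ler_wpM2l ?sqr_ge0 //.
  rewrite [X in _ <= s * X]exchange_big mulr_sumr ler_sum //= => j _.
  by rewrite mxE cauchy_schwarz.
have h2 : hs2 (- (diag_mx (\row_i v 0 i ^+ 2) * X)) <= s ^+ 2 * hs2 X.
  rewrite !hs2E mulr_sumr ler_sum // => i _; rewrite mulr_sumr ler_sum // => j _.
  rewrite -mulmxE mul_diag_mx !mxE sqrrN exprMn ler_wpM2r ?sqr_ge0 //.
  by rewrite lerXn2r ?nnegrE ?sqr_ge0.
rewrite exprMn; lra.
Qed.

End QuadraticForms.

(** * Order statistics *)

Section OrderStatistics.
Variable R : realType.

Lemma nth_sorted_count (s : seq R) (k : nat) (v : R) : sorted >=%R s -> (k < size s)%N ->
  (v <= nth 0 s k) = (k < count (fun x => v <= x)%R s)%N.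
Proof.
elim: s k => [//|x s IH] k /= sxs ks.
have ss := path_sorted sxs.
have xs : all (fun y => y <= x) s.
  by apply: order_path_min sxs => y z t zy yt; exact: le_trans yt zy.
case: k ks => [|k] /= ks.
  have [vx|] := boolP (v <= x); first by [].
  move=> nvx; rewrite add0n; apply/esym/negbTE; rewrite -leqNgt leqn0 eqn0Ngt -has_count; apply/hasPn => y ys; apply: contra nvx => vy.
  exact: le_trans vy (allP xs _ ys).
rewrite IH //; have [vx|nvx] := boolP (v <= x); first by rewrite add1n ltnS.
rewrite add0n.
have -> : count (fun y => v <= y) s = 0%N.
  apply/eqP; rewrite eqn0Ngt -has_count; apply/hasPn => y ys; apply: contra nvx => vy.
  exact: le_trans vy (allP xs _ ys).
by rewrite !ltn0.
Qed.

Lemma sort_ge_sorted (s : seq R) : sorted >=%R (sort >=%R s).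
Proof. by apply: sort_sorted => x y; exact: le_total. Qed.

(** Order statistics are inverse to counting functions.  All comparisons of order
    statistics below go through counts, which need no matching of indices. *)
Lemma order_stat_ge (I : finType) (f : I -> R) (k : nat) (v : R) : (k < #|I|)%N ->
  (v <= order_stat f k) = (k < #|[pred i | (v <= f i)%R]|)%N.
Proof.
move=> kI; rewrite /order_stat nth_sorted_count ?sort_ge_sorted //; last first.
  by rewrite size_sort size_map -cardE.
congr (_ < _)%N; rewrite (permP (permEl (perm_sort _ _))) count_map -size_filter.
by rewrite cardE /enum_mem; congr size; rewrite -filter_predI; apply: eq_filter => i /=; rewrite !inE andbT.
Qed.

Lemma order_stat_default (I : finType) (f : I -> R) (k : nat) : (#|I| <= k)%N ->
  order_stat f k = 0.
Proof. by move=> Ik; rewrite /order_stat nth_default // size_sort size_map -cardE. Qed.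

Lemma order_stat_ge0 (I : finType) (f : I -> R) (k : nat) : (forall i, 0 <= f i) ->
  0 <= order_stat f k.
Proof.
move=> f0; have [kI|kI] := ltnP k #|I|; last by rewrite order_stat_default.
rewrite order_stat_ge // (_ : #|_| = #|I|) //; apply: eq_card => i.
by rewrite !inE f0.
Qed.

(** The index sets may have different sizes, so that rows can be compared with
    entries; beyond either size the order statistic is the default 0, which is
    why g is nonnegative and only positive levels are compared. *)
Lemma order_stat_le (I J : finType) (f : I -> R) (g : J -> R) (e : R) :
  0 <= e -> (forall j, 0 <= g j) ->
  (forall v, 0 < v -> (#|[pred i | (v + e <= f i)%R]| <= #|[pred j | (v <= g j)%R]|)%N) ->
  forall k, order_stat f k <= order_stat g k + e.
Proof.
move=> e0 g0 fg k; rewrite leNgt; apply/negP => lt.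
have gk0 := order_stat_ge0 k g0.
have kI : (k < #|I|)%N.
  rewrite ltnNge; apply/negP => Ik; move: lt.
  by rewrite (order_stat_default f) // ltNge addr_ge0.
have := order_stat_ge f (order_stat f k) kI; rewrite lexx => /esym hk.
have v0 : 0 < order_stat f k - e by rewrite subr_gt0 (le_lt_trans _ lt) // lerDr.
have := leq_trans hk (_ : _ <= _)%N.
have := fg _ v0; rewrite subrK => h /(_ _ h) kg.
have kJ : (k < #|J|)%N by rewrite (leq_trans kg) // max_card.
by have := order_stat_ge g (order_stat f k - e) kJ; rewrite kg lerBlDr leNgt lt.
Qed.

End OrderStatistics.

(** * Eigenvalue counting and Weyl's inequality *)

Section EigenvalueCounting.
Variable R : realType.

Lemma spectral_rows (n : nat) (A U : 'M[R]_n) (d : 'rV[R]_n) :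
  U *m U^T = 1%:M -> A = U^T *m diag_mx d *m U -> U *m A = diag_mx d *m U.
Proof. by move=> UU ->; rewrite !mulmxA UU mul1mx. Qed.

(** The sorted roots of the characteristic polynomial are determined by unique
    factorization, whatever spectral decomposition they are read from. *)
Lemma eigenvaluesE (n : nat) (A U : 'M[R]_n) (d : 'rV[R]_n) :
  U *m U^T = 1%:M -> A = U^T *m diag_mx d *m U ->
  eigenvalues A = sort >=%R [seq d 0 i | i : 'I_n].
Proof.
move=> UU AE; pose s := sort >=%R [seq d 0 i | i : 'I_n].
have ss : sorted >=%R s by exact: sort_ge_sorted.
have cs : char_poly A = \prod_(x <- s) ('X - x%:P).
  rewrite (perm_big _ (permEl (perm_sort _ _))) big_map big_enum /=.
  pose UP : 'M[{poly R}]_n := map_mx polyC U.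
  have UUP : UP *m UP^T = 1%:M by rewrite /UP map_trmx -map_mxM UU map_mx1.
  have -> : char_poly A = \det (UP^T *m char_poly_mx (diag_mx d) *m UP).
    congr (\det _); rewrite /char_poly_mx mulmxBr mulmxBl mul_mx_scalar -scalemxAl mulmx1C //.
    by rewrite scalemx1 AE !map_mxM -map_trmx map_diag_mx.
  rewrite !det_mulmx mulrAC -det_mulmx mulmx1C // det1 mul1r.
  rewrite -/(char_poly _) char_poly_trig ?diag_mx_is_trig //.
  by apply: eq_bigr => i _; rewrite mxE eqxx mulr1n.
rewrite /eigenvalues; case: xgetP => [t -> [st ct]|/(_ s)/=]; last by case; split.
apply: (@sorted_eq _ >=%R) => //.
- by move=> y x z xy yz; exact: le_trans yz xy.
- by move=> x y /andP[xy yx]; exact: le_anti (introT andP (conj yx xy)).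
by apply: prod_XsubC_eq; rewrite -ct cs.
Qed.

Lemma symmetric_eigenvalues (n : nat) (A : 'M[R]_n) : A^T = A ->
  exists (U : 'M[R]_n) (d : 'rV[R]_n), [/\ U *m U^T = 1%:M,
    A = U^T *m diag_mx d *m U & forall k, nth 0 (eigenvalues A) k = order_stat (d 0) k].
Proof.
move=> sA; have [U [d [UU AE]]] := symmetric_spectral sA.
by exists U, d; split => // k; rewrite (eigenvaluesE UU AE).
Qed.

Lemma diag_qform (n : nat) (z e : 'rV[R]_n) :
  (z *m diag_mx e *m z^T) 0 0 = \sum_j e 0 j * z 0 j ^+ 2.
Proof. by rewrite mul_mx_diag mxE; apply: eq_bigr => j _; rewrite !mxE; ring. Qed.

(** One direction of the min-max principle in counting form: if the quadratic
    form of B is at least v |x|^2 on a k-dimensional space (the row space of Y),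
    then B has at least k eigenvalues at least equal to v.  Otherwise some nonzero vector of
    that space would be orthogonal to all eigenvectors of eigenvalue at least v. *)
Lemma subspace_count (m k : nat) (B V : 'M[R]_m) (e : 'rV[R]_m) (Y : 'M[R]_(k, m))
    (v : R) : V *m V^T = 1%:M -> B = V^T *m diag_mx e *m V ->
  (forall y : 'rV[R]_k, y *m Y = 0 -> y = 0) ->
  (forall y : 'rV[R]_k, v * ((y *m Y) *m (y *m Y)^T) 0 0 <= ((y *m Y) *m B *m (y *m Y)^T) 0 0) ->
  (k <= #|[pred j | (v <= e 0 j)%R]|)%N.
Proof.
move=> VV BE Y0 hq; set S := [pred j | _]; rewrite leqNgt; apply/negP => Sk.
pose K : 'M[R]_(k, #|S|) := \matrix_(a, b) (Y *m V^T) a (enum_val b).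
(* K has fewer columns than rows, hence a nonzero left kernel vector: an element
   of the row space of Y orthogonal to the eigenvectors counted by S. *)
have : kermx K != 0.
  rewrite kermx_eq0 /row_free; apply/negP => /eqP rK.
  by have := rank_leq_col K; rewrite rK leqNgt Sk.
case/rowV0Pn => y yK /negP; apply; apply/eqP; apply: Y0.
have {}yK : y *m K = 0 by apply/eqP; rewrite -sub_kermx.
pose z := y *m Y *m V^T.
have zS j : j \in S -> z 0 j = 0.
  move=> jS; have := congr1 (fun M : 'rV[R]__ => M 0 (enum_rank_in jS j)) yK.
  rewrite [LHS]mxE [RHS]mxE => h; rewrite -[RHS]h /z -mulmxA [LHS]mxE; apply: eq_bigr => a _.
  by rewrite [K _ _]mxE enum_rankK_in.
have xE : y *m Y = z *m V by rewrite /z -mulmxA mulmx1C // mulmx1.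
have := hq y; rewrite BE xE trmx_mul.
have -> : z *m V *m (V^T *m z^T) = z *m z^T by rewrite !mulmxA -[z *m _ *m _]mulmxA VV mulmx1.
have -> : z *m V *m (V^T *m diag_mx e *m V) *m (V^T *m z^T) = z *m diag_mx e *m z^T.
  by rewrite !mulmxA -[z *m _ *m _]mulmxA VV mulmx1 -!mulmxA (mulmxA V) VV mul1mx.
rewrite normv2E diag_qform mulr_sumr -subr_le0 -sumrB => h.
suff -> : z = 0 by rewrite mul0mx.
apply/rowP => j; rewrite [RHS]mxE; have [jS|jS] := boolP (j \in S); first exact: zS.
have t0 i : 0 <= v * z 0 i ^+ 2 - e 0 i * z 0 i ^+ 2.
  have [iS|] := boolP (i \in S); first by rewrite zS // expr0n !mulr0 subrr.
  by rewrite inE /= -ltNge -mulrBl => /ltW ve; rewrite mulr_ge0 ?sqr_ge0 // subr_ge0.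
have /eqP : \sum_i (v * z 0 i ^+ 2 - e 0 i * z 0 i ^+ 2) = 0.
  by apply/eqP; rewrite eq_le h sumr_ge0.
rewrite psumr_eq0 // => /allP/(_ j (mem_index_enum _)); rewrite -mulrBl mulf_eq0 subr_eq0.
move: jS; rewrite inE /= -ltNge => ve; rewrite gt_eqF //= sqrf_eq0.
by move/eqP.
Qed.

Section EigenRows.
Variables (n : nat) (A U : 'M[R]_n) (d : 'rV[R]_n) (S : {pred 'I_n}).
Hypotheses (UU : U *m U^T = 1%:M) (AE : A = U^T *m diag_mx d *m U).
Let W : 'M[R]_(#|S|, n) := \matrix_(a, j) U (enum_val a) j.
Let dS : 'rV[R]_#|S| := \row_a d 0 (enum_val a).

Lemma eigenrows_orth : W *m W^T = 1%:M.
Proof.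
apply/matrixP => a b; rewrite !mxE.
have := congr1 (fun M : 'M[R]_n => M (enum_val a) (enum_val b)) UU; rewrite !mxE.
rewrite (inj_eq enum_val_inj) => <-; apply: eq_bigr => j _; by rewrite !mxE.
Qed.

Lemma eigenrows_mul : W *m A = diag_mx dS *m W.
Proof.
apply/matrixP => a j; rewrite mul_diag_mx !mxE.
have := congr1 (fun M : 'M[R]_n => M (enum_val a) j) (spectral_rows UU AE).
rewrite mul_diag_mx !mxE => <-; apply: eq_bigr => i _; by rewrite mxE.
Qed.
End EigenRows.

(** Apply [subspace_count] to the span of the eigenvectors of A whose eigenvalue
    is at least v + eps. *)
Lemma weyl_count (n : nat) (A U B V : 'M[R]_n) (d e : 'rV[R]_n) (v eps : R) :
  U *m U^T = 1%:M -> A = U^T *m diag_mx d *m U ->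
  V *m V^T = 1%:M -> B = V^T *m diag_mx e *m V ->
  (forall x : 'rV[R]_n, (x *m A *m x^T) 0 0 <= (x *m B *m x^T) 0 0 + eps * (x *m x^T) 0 0) ->
  (#|[pred i | (v + eps <= d 0 i)%R]| <= #|[pred j | (v <= e 0 j)%R]|)%N.
Proof.
move=> UU AE VV BE AB; set S := [pred i | _].
have WW := eigenrows_orth S UU; have WA := eigenrows_mul S UU AE.
set W := (X in X *m _ = diag_mx _ *m _) in WW WA; set dS := (X in diag_mx X) in WA.
apply: (subspace_count (Y := W) VV BE) => y.
  by move=> yW; rewrite -[y]mulmx1 -WW mulmxA yW mul0mx.
rewrite trmx_mul !mulmxA.
have := AB (y *m W); rewrite trmx_mul !mulmxA -!(mulmxA y W) WA !mulmxA.
rewrite -!(mulmxA _ W W^T) WW !mulmx1 -lerBlDr; apply: le_trans.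
rewrite diag_qform normv2E !mulr_sumr -sumrB ler_sum // => a _.
rewrite -mulrBl ler_wpM2r ?sqr_ge0 // lerBrDr mxE.
exact: (enum_valP a).
Qed.

Lemma sample_cov_sym (p n : nat) (M : 'M[R]_(p, n)) : (sample_cov M)^T = sample_cov M.
Proof. by rewrite /sample_cov trmx_mul trmxK. Qed.

Lemma sample_cov_spectral (p n : nat) (M : 'M[R]_(p, n)) :
  exists (U : 'M[R]_p) (d : 'rV[R]_p), [/\ U *m U^T = 1%:M,
    sample_cov M = U^T *m diag_mx d *m U, forall i, 0 <= d 0 i &
    forall k, ordered_eigenvalue M k = order_stat (d 0) k].
Proof.
have [U [d [UU AE dE]]] := symmetric_eigenvalues (sample_cov_sym M).
exists U, d; split => // i.
have h : U *m sample_cov M *m U^T = diag_mx d by rewrite (spectral_rows UU AE) -mulmxA UU mulmx1.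
have -> : d 0 i = ((U *m M) *m (U *m M)^T) i i.
  by rewrite trmx_mul mulmxA -(mulmxA U) h mxE eqxx mulr1n.
by rewrite mxE sumr_ge0 // => j _; rewrite [X in _ * X]mxE -expr2 sqr_ge0.
Qed.

(** If x is an eigenvector of M M' for a positive eigenvalue, then x M is one of
    M' M; here on the level of quadratic forms, so that multiplicities are
    taken care of by [subspace_count]. *)
Lemma sample_cov_trmx_count (p n : nat) (M : 'M[R]_(p, n)) (U : 'M[R]_p) (V : 'M[R]_n)
   (d : 'rV[R]_p) (e : 'rV[R]_n) (v : R) : 0 < v ->
  U *m U^T = 1%:M -> sample_cov M = U^T *m diag_mx d *m U ->
  V *m V^T = 1%:M -> sample_cov M^T = V^T *m diag_mx e *m V ->
  (#|[pred i | (v <= d 0 i)%R]| <= #|[pred j | (v <= e 0 j)%R]|)%N.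
Proof.
move=> v0 UU AE VV BE; set S := [pred i | _].
have WW := eigenrows_orth S UU; have WA := eigenrows_mul S UU AE.
set W := (X in X *m _ = diag_mx _ *m _) in WW WA; set dS := (X in diag_mx X) in WA.
have Sv a : v <= dS 0 a by rewrite mxE; exact: (enum_valP a).
have key (y : 'rV[R]__) : y *m (W *m M) *m (y *m (W *m M))^T = y *m diag_mx dS *m y^T.
  rewrite !trmx_mul !mulmxA -(mulmxA _ M M^T) -/(sample_cov M) -(mulmxA y W) WA.
  by rewrite !mulmxA -!(mulmxA _ W W^T) WW !mulmx1.
apply: (subspace_count (Y := W *m M) VV BE) => y.
  move=> yW; apply: sum_sqr_eq0; have := key y; rewrite yW mul0mx => /esym/(congr1 (fun M : 'M[R]_1 => M 0 0)).
  rewrite diag_qform mxE => h; apply/matrixP => i j; rewrite !ord1 [RHS]mxE normv2E.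
  apply/eqP; rewrite eq_le sumr_ge0 ?andbT => [|a _]; last exact: sqr_ge0.
  rewrite -(pmulr_rle0 _ v0) -[X in _ <= X]h big_distrr /= ler_sum // => a _.
  by rewrite ler_wpM2r ?sqr_ge0.
rewrite key /sample_cov trmxK.
have -> : y *m (W *m M) *m (M^T *m M) *m (y *m (W *m M))^T =
   (y *m diag_mx dS) *m diag_mx dS *m y^T.
  rewrite !trmx_mul !mulmxA -(mulmxA _ M M^T) -/(sample_cov M) -(mulmxA y W) WA.
  rewrite !mulmxA -(mulmxA _ M M^T) -/(sample_cov M) -(mulmxA _ W) WA.
  by rewrite !mulmxA -!(mulmxA _ W W^T) WW !mulmx1.
rewrite diag_qform -(mulmxA y) mulmx_diag diag_qform mulr_sumr ler_sum // => a _.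
rewrite mulrA ler_wpM2r ?sqr_ge0 // [X in _ <= X]mxE ler_wpM2r // (le_trans (ltW v0)) //.
Qed.

Lemma ordered_eigenvalue_trmx_le (p n : nat) (M : 'M[R]_(p, n)) (k : nat) :
  ordered_eigenvalue M k <= ordered_eigenvalue M^T k.
Proof.
have [U [d [UU AE d0 ->]]] := sample_cov_spectral M.
have [V [e [VV BE e0 ->]]] := sample_cov_spectral M^T.
rewrite -[X in _ <= X]addr0; apply: order_stat_le => // v v0; rewrite addr0.
exact: (sample_cov_trmx_count v0 UU AE VV BE).
Qed.

(** The sizes of the two sample covariance matrices differ, but the extra
    eigenvalues are 0, like the default value beyond the size. *)
Lemma ordered_eigenvalue_trmx (p n : nat) (M : 'M[R]_(p, n)) (k : nat) :
  ordered_eigenvalue M^T k = ordered_eigenvalue M k.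
Proof.
apply/eqP; rewrite eq_le ordered_eigenvalue_trmx_le andbT.
by rewrite -[X in _ <= ordered_eigenvalue X _]trmxK ordered_eigenvalue_trmx_le.
Qed.

Lemma weyl (p n n' : nat) (M : 'M[R]_(p, n)) (M' : 'M[R]_(p, n')) (eps : R) : 0 <= eps ->
  (forall x : 'rV[R]_p, (x *m sample_cov M *m x^T) 0 0 <=
      (x *m sample_cov M' *m x^T) 0 0 + eps * (x *m x^T) 0 0) ->
  forall k, ordered_eigenvalue M k <= ordered_eigenvalue M' k + eps.
Proof.
move=> eps0 h k.
have [U [d [UU AE d0 ->]]] := sample_cov_spectral M.
have [V [e [VV BE e0 ->]]] := sample_cov_spectral M'.
apply: order_stat_le => // v v0; exact: (weyl_count _ UU AE VV BE).
Qed.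

(** The diagonal of M M' consists of the row sums of squares, whose order
    statistics are the eigenvalues of the diagonal matrix. *)
Lemma weyl_diag (p n : nat) (M : 'M[R]_(p, n)) (eps : R) : 0 <= eps ->
  (forall x : 'rV[R]_p,
     `|(x *m offdiag (sample_cov M) *m x^T) 0 0| <= eps * (x *m x^T) 0 0) ->
  forall k, `|ordered_eigenvalue M k - order_stat (row_sumsq M) k| <= eps.
Proof.
move=> eps0 h k.
have [U [d [UU AE d0 ->]]] := sample_cov_spectral M.
pose e : 'rV[R]_p := \row_i row_sumsq M i.
have eE : order_stat (row_sumsq M) k = order_stat (e 0) k.
  by congr nth; congr sort; apply: eq_map => i; rewrite mxE.
have e0 i : 0 <= e 0 i by rewrite mxE sumr_ge0 // => t _; rewrite sqr_ge0.
have II : (1%:M : 'M[R]_p) *m 1%:M^T = 1%:M by rewrite trmx1 mulmx1.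
pose B := diag_mx e; have BE : B = 1%:M^T *m diag_mx e *m 1%:M by rewrite trmx1 mulmx1 mul1mx.
have AB : sample_cov M = B + offdiag (sample_cov M).
  apply/matrixP => i j; rewrite /B !mxE /sample_cov; case: eqP => [->|_].
    by rewrite mulr1n addr0 /row_sumsq; apply: eq_bigr => t _; rewrite mxE expr2.
  by rewrite mulr0n add0r.
have qE x : (x *m sample_cov M *m x^T) 0 0 =
   (x *m B *m x^T) 0 0 + (x *m offdiag (sample_cov M) *m x^T) 0 0.
  by rewrite {1}AB mulmxDr mulmxDl mxE.
rewrite eE ler_distlC; apply/andP; split; [rewrite lerBlDr|];
  apply: order_stat_le => // v v0.
  apply: (weyl_count _ UU AE II BE) => x; rewrite qE lerD2l.
  by have /ler_normlP[] := h x.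
apply: (weyl_count _ II BE UU AE) => x; rewrite qE -addrA lerDl.
by rewrite -lerBlDl sub0r; have /ler_normlP[] := h x; rewrite lerNl.
Qed.

End EigenvalueCounting.

Local Open Scope classical_set_scope.

(** * Expectation of bounded random variables *)

Section BoundedExpectation.
Context {R : realType} {d : measure_display} {T : measurableType d} (P : probability T R).
Implicit Types X Y : T -> R.

(** Apart from the mean of Z itself, only bounded variables are integrated, after
    truncation; they are integrable and stable under products. *)
Definition bounded_rv d' (T' : measurableType d') (X : T' -> R) :=
  measurable_fun setT X /\ exists B : R, forall w, `|X w| <= B.

Definition Ex X : R := \int[P]_w X w.

Lemma bounded_rv_cst d' (T' : measurableType d') (c : R) : bounded_rv (fun _ : T' => c).
Proof. by split; [exact: measurable_cst | exists `|c|]. Qed.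

Lemma bounded_rvD d' (T' : measurableType d') (X Y : T' -> R) : bounded_rv X -> bounded_rv Y ->
  bounded_rv (fun w => X w + Y w).
Proof.
move=> [mX [A XA]] [mY [B YB]]; split; first exact: measurable_funD.
by exists (A + B) => w; rewrite (le_trans (ler_normD _ _)) // lerD.
Qed.

Lemma bounded_rvM d' (T' : measurableType d') (X Y : T' -> R) : bounded_rv X -> bounded_rv Y ->
  bounded_rv (fun w => X w * Y w).
Proof.
move=> [mX [A XA]] [mY [B YB]]; split; first exact: measurable_funM.
by exists (A * B) => w; rewrite normrM ler_pM.
Qed.

Lemma bounded_rvZ d' (T' : measurableType d') (c : R) (X : T' -> R) : bounded_rv X ->
  bounded_rv (fun w => c * X w).
Proof. by move=> bX; apply: bounded_rvM => //; exact: bounded_rv_cst. Qed.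

Lemma bounded_rvB d' (T' : measurableType d') (X Y : T' -> R) : bounded_rv X -> bounded_rv Y ->
  bounded_rv (fun w => X w - Y w).
Proof.
move=> bX bY; have -> : (fun w => X w - Y w) = (fun w => X w + -1 * Y w).
  by apply/funext => w; rewrite mulN1r.
by apply: bounded_rvD => //; exact: bounded_rvZ.
Qed.

Lemma bounded_rv_sum d' (T' : measurableType d') I (r : seq I) (Q : pred I) (F : I -> T' -> R) :
  (forall i, bounded_rv (F i)) -> bounded_rv (fun w => \sum_(i <- r | Q i) F i w).
Proof.
move=> bF; elim: r => [|i r IH].
  by under eq_fun do rewrite big_nil; exact: bounded_rv_cst.
under eq_fun do rewrite big_cons; case: (Q i) => //; exact: bounded_rvD.
Qed.

Lemma bounded_rv_prod d' (T' : measurableType d') I (r : seq I) (Q : pred I) (F : I -> T' -> R) :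
  (forall i, bounded_rv (F i)) -> bounded_rv (fun w => \prod_(i <- r | Q i) F i w).
Proof.
move=> bF; elim: r => [|i r IH].
  by under eq_fun do rewrite big_nil; exact: bounded_rv_cst.
under eq_fun do rewrite big_cons; case: (Q i) => //; exact: bounded_rvM.
Qed.

Lemma bounded_rvX d' (T' : measurableType d') (X : T' -> R) k : bounded_rv X ->
  bounded_rv (fun w => X w ^+ k).
Proof.
move=> bX; elim: k => [|k IH].
  by under eq_fun do rewrite expr0; exact: bounded_rv_cst.
by under eq_fun do rewrite exprS; exact: bounded_rvM.
Qed.

Lemma bounded_rv_indic d' (T' : measurableType d') (A : set T') : measurable A ->
  bounded_rv (\1_A : T' -> R).
Proof.
move=> mA; split; first exact: measurable_indic.
by exists 1 => w; rewrite indicE; case: (_ \in _); rewrite ?normr1 ?normr0.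
Qed.

Lemma bounded_rv_comp d' (T' : measurableType d') d'' (T'' : measurableType d'')
    (V : T' -> T'') (h : T'' -> R) :
  measurable_fun setT V -> bounded_rv h -> bounded_rv (fun w => h (V w)).
Proof.
move=> mV [mh [B hB]]; split; last by exists B.
exact: (measurableT_comp mh mV).
Qed.

Lemma bounded_rv_integrable X : bounded_rv X -> P.-integrable setT (EFin \o X).
Proof.
move=> [mX [B XB]]; apply: measurable_bounded_integrable => //.
  by rewrite (le_lt_trans (probability_le1 _ _)) // ltry.
exists B; split; first exact: num_real.
by move=> x Bx w _; exact: le_trans (XB w) (ltW Bx).
Qed.
Local Hint Resolve bounded_rv_integrable : core.

Lemma Ex_cst (c : R) : Ex (fun=> c) = c.
Proof.
rewrite /Ex Rintegral_cst // -[RHS]mulr1; congr (_ * _).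
exact: (congr1 fine (probability_setT P)).
Qed.

Lemma ExD X Y : bounded_rv X -> bounded_rv Y ->
  Ex (fun w => X w + Y w) = Ex X + Ex Y.
Proof. by move=> bX bY; rewrite /Ex RintegralD //; exact: bounded_rv_integrable. Qed.

Lemma ExZ (c : R) X : bounded_rv X -> Ex (fun w => c * X w) = c * Ex X.
Proof. by move=> bX; rewrite /Ex RintegralZl //; exact: bounded_rv_integrable. Qed.

Lemma ExB X Y : bounded_rv X -> bounded_rv Y ->
  Ex (fun w => X w - Y w) = Ex X - Ex Y.
Proof. by move=> bX bY; rewrite /Ex RintegralB //; exact: bounded_rv_integrable. Qed.

Lemma Ex_sum I (r : seq I) (Q : pred I) (F : I -> T -> R) : (forall i, bounded_rv (F i)) ->
  Ex (fun w => \sum_(i <- r | Q i) F i w) = \sum_(i <- r | Q i) Ex (F i).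
Proof.
move=> bF; elim: r => [|i r IH].
  by under eq_fun do rewrite big_nil; rewrite big_nil Ex_cst.
rewrite big_cons -IH; under eq_fun do rewrite big_cons; case: (Q i) => //.
by rewrite ExD //; exact: bounded_rv_sum.
Qed.

Lemma Ex_le X Y : bounded_rv X -> bounded_rv Y -> (forall w, X w <= Y w) -> Ex X <= Ex Y.
Proof. by move=> bX bY XY; apply: le_Rintegral => //; exact: bounded_rv_integrable. Qed.

Lemma Ex_ge0 X : (forall w, 0 <= X w) -> 0 <= Ex X.
Proof. by move=> X0; apply: Rintegral_ge0. Qed.

Lemma Ex_norm X : bounded_rv X -> `|Ex X| <= Ex (fun w => `|X w|).
Proof. by move=> bX; apply: le_normr_Rintegral => //; exact: bounded_rv_integrable. Qed.

Lemma Ex_norm_le X (B : R) : bounded_rv X -> (forall w, `|X w| <= B) -> `|Ex X| <= B.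
Proof.
move=> bX XB; rewrite ler_norml -[- B]Ex_cst -[B in _ && (_ <= B)]Ex_cst.
by apply/andP; split; apply: Ex_le => //; try exact: bounded_rv_cst;
   move=> w; have := XB w; rewrite ler_norml => /andP[].
Qed.

Lemma Ex_indic (A : set T) : measurable A -> Ex (\1_A) = fine (P A).
Proof. by move=> mA; rewrite /Ex /Rintegral integral_indic // setIT. Qed.

Lemma markov_bounded X (c : R) : bounded_rv X -> (forall w, 0 <= X w) -> 0 < c ->
  (P [set w | (c <= X w)%R] <= (Ex X / c)%:E)%E.
Proof.
move=> bX X0 c0; set A := [set w | _].
have mA : measurable A.
  rewrite (_ : A = X @^-1` `[c, +oo[); first by rewrite -[X in measurable X]setTI; exact: bX.1.
  by apply/seteqP; split => w /=; rewrite in_itv /= andbT.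
have PA : P A \is a fin_num by rewrite fin_num_measure.
rewrite -(fineK PA) lee_fin -Ex_indic // ler_pdivlMr // mulrC -ExZ; last exact: bounded_rv_indic.
apply: Ex_le => //; first by apply: bounded_rvZ; exact: bounded_rv_indic.
move=> w; rewrite indicE; have [wA|wA] := boolP (w \in A); last by rewrite mulr0.
by rewrite mulr1; move: wA; rewrite inE.
Qed.

Lemma threshold_sum (e y : R) (n : nat) : 0 < e -> 0 <= y ->
  let s := \sum_(i < n) (i.+1%:R * e <= y)%R%:R in
  [/\ e * s <= y, y <= n.+1%:R * e -> y - e <= e * s & n%:R * e <= y -> s = n%:R].
Proof.
move=> e0 y0 /=; elim: n => [|n [IH1 IH2 IH3]].
  by rewrite big_ord0 mulr0 mul1r; split => // h; rewrite subr_le0.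
rewrite big_ord_recr /=; have [h|h] := leP (n.+1%:R * e) y.
  have ny : n%:R * e <= y by rewrite (le_trans _ h) // ler_wpM2r ?ler_nat // ltW.
  rewrite (IH3 ny) natr1 mulrC; split => // h2.
  by rewrite lerBlDr (le_trans h2) // -[n.+2%:R]natr1 mulrDl mul1r.
rewrite addr0; split => // h2; first by apply: IH2; exact: ltW.
Qed.

(** Uniform approximation by simple functions: round h down to multiples of e. *)
Lemma simple_approx d' (T' : measurableType d') (h : T' -> R) (e : R) : bounded_rv h -> 0 < e ->
  exists (n : nat) (c : 'I_n -> R) (B : 'I_n -> set T'),
   (forall i, measurable (B i)) /\
   forall x, `|h x - \sum_i c i * \1_(B i) x| <= e.
Proof.
(* h + B ranges over [0, 2 B], which n steps of length e cover. *)
move=> [mh [B hB]] e0; pose n := (Num.bound (2 * B / e)).+1.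
pose A (i : nat) := [set x | i%:R * e <= h x + B].
have mA i : measurable (A i).
  rewrite (_ : A i = h @^-1` `[i%:R * e - B, +oo[).
    by rewrite -[X in measurable X]setTI; exact: mh.
  by apply/seteqP; split => w /=; rewrite in_itv /= andbT lerBlDr.
(* Index 0 carries the constant -B, index j + 1 the step e on the set A (j + 1). *)
exists n.+1, (fun i => if unlift ord0 i is Some j then e else - B),
  (fun i => if unlift ord0 i is Some j then A j.+1 else setT); split.
  by move=> i; case: unlift.
move=> x; rewrite big_ord_recl unlift_none indicT mulr1.
have -> : \sum_(i < n) (if unlift ord0 (lift ord0 i) is Some j then e else - B) *
   \1_(if unlift ord0 (lift ord0 i) is Some j then A j.+1 else setT) x =
   e * \sum_(i < n) (i.+1%:R * e <= h x + B)%R%:R.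
  rewrite mulr_sumr; apply: eq_bigr => i _; rewrite liftK indicE; congr (_ * _%:R).
  by rewrite mem_setE.
have y0 : 0 <= h x + B by have := hB x; rewrite ler_norml => /andP[]; rewrite -subr_ge0 opprK.
have [h1 h2 _] := threshold_sum n e0 y0.
have yn : h x + B <= n.+1%:R * e.
  rewrite -ler_pdivrMr //.
  have B2 : h x + B <= 2 * B.
    by have := hB x; rewrite ler_norml => /andP[_]; rewrite mulrDl mul1r lerD2r.
  apply: (le_trans (y := 2 * B / e)); first by rewrite ler_wpM2r // invr_ge0 ltW.
  have B0 : 0 <= B by rewrite (le_trans _ (hB x)).
  apply: ltW; apply: lt_le_trans (archi_boundP _) _; first by rewrite divr_ge0 ?mulr_ge0 // ltW.
  by rewrite ler_nat /n (leq_trans (leqnSn _)).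
have := h2 yn; rewrite ler_norml; lra.
Qed.

(** An identity between expectations that is linear in h passes from indicators
    to bounded measurable functions, by [simple_approx]. *)
Lemma Ex_extend (W U U0 : T -> R) (c : R) (h : R -> R) :
  bounded_rv W -> measurable_fun setT U -> measurable_fun setT U0 -> bounded_rv h ->
  (forall B : set R, measurable B ->
    Ex (fun w => W w * \1_B (U w)) = c * Ex (fun w => \1_B (U0 w))) ->
  Ex (fun w => W w * h (U w)) = c * Ex (fun w => h (U0 w)).
Proof.
move=> bW mU mU0 bh H; have [_ [K WK]] := bW.
have K0 : 0 <= K by rewrite (le_trans _ (WK point)).
apply/eqP; rewrite -subr_eq0 -normr_le0; apply/ler_addgt0Pr => e e0; rewrite add0r.
(* The extra 1 keeps the denominator positive. *)
pose e' := e / (K + `|c| + 1).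
have Kc0 : 0 < K + `|c| + 1 by rewrite ltr_wpDl // addr_ge0.
have e'0 : 0 < e' by rewrite divr_gt0.
have [n [a [B [mB hB]]]] := simple_approx bh e'0.
pose g x := \sum_i a i * (\1_(B i) x : R).
have bg : bounded_rv g.
  by apply: bounded_rv_sum => i; apply: bounded_rvZ; exact: bounded_rv_indic.
have bhU := bounded_rv_comp mU bh; have bgU := bounded_rv_comp mU bg.
have bhU0 := bounded_rv_comp mU0 bh; have bgU0 := bounded_rv_comp mU0 bg.
have gE : Ex (fun w => W w * g (U w)) = c * Ex (fun w => g (U0 w)).
  have -> : (fun w => W w * g (U w)) = (fun w => \sum_i a i * (W w * \1_(B i) (U w))).
    by apply/funext => w; rewrite /g mulr_sumr; apply: eq_bigr => i _; rewrite mulrCA.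
  have b1 i : bounded_rv (fun w => W w * \1_(B i) (U w)).
    by apply: bounded_rvM => //; apply: bounded_rv_comp => //; exact: bounded_rv_indic.
  have b2 i : bounded_rv (fun w => \1_(B i) (U0 w) : R).
    by apply: bounded_rv_comp => //; exact: bounded_rv_indic.
  rewrite Ex_sum => [|i]; last exact: bounded_rvZ.
  rewrite /g Ex_sum => [|i]; last exact: bounded_rvZ.
  by rewrite mulr_sumr; apply: eq_bigr => i _; rewrite !ExZ // H // mulrCA.
have d1 : `|Ex (fun w => W w * h (U w)) - Ex (fun w => W w * g (U w))| <= K * e'.
  rewrite -ExB; try exact: bounded_rvM.
  apply: Ex_norm_le; first by apply: bounded_rvB; exact: bounded_rvM.
  by move=> w; rewrite -mulrBr normrM ler_pM // hB.
have d2 : `|Ex (fun w => h (U0 w)) - Ex (fun w => g (U0 w))| <= e'.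
  rewrite -ExB //; apply: Ex_norm_le; first exact: bounded_rvB.
  by move=> w; rewrite hB.
have -> : Ex (fun w => W w * h (U w)) - c * Ex (fun w => h (U0 w)) =
   (Ex (fun w => W w * h (U w)) - Ex (fun w => W w * g (U w)))
   - c * (Ex (fun w => h (U0 w)) - Ex (fun w => g (U0 w))) by rewrite gE; ring.
apply: le_trans (ler_normB _ _) _; rewrite normrM.
have : `|c| * `|Ex (fun w => h (U0 w)) - Ex (fun w => g (U0 w))| <= `|c| * e' by rewrite ler_wpM2l.
have : e = (K + `|c| + 1) * e' by rewrite /e' mulrC divfK // gt_eqF.
lra.
Qed.

End BoundedExpectation.

(** * Families of independent variables *)

(** The product rule together with the common law of V0, as an identity between real
    numbers. *)
Definition iid_family {R : realType} {d : measure_display} {T : measurableType d}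
    (P : probability T R) (E : finType) (V : E -> T -> R) (V0 : T -> R) :=
  forall B : E -> set R, (forall e, measurable (B e)) ->
  fine (P (\bigcap_(e in [set: E]) V e @^-1` B e)) = \prod_e fine (P (V0 @^-1` B e)).

Section IndependentFamily.
Context {R : realType} {d : measure_display} {T : measurableType d} (P : probability T R).
Variables (E : finType) (V : E -> T -> R) (V0 : T -> R).
Hypotheses (mV : forall e, measurable_fun setT (V e)) (mV0 : measurable_fun setT V0).
Hypothesis iidV : iid_family P V V0.
Local Notation Ex := (Ex P).

Lemma measurable_preimage (U : T -> R) (B : set R) :
  measurable_fun setT U -> measurable B -> measurable (U @^-1` B).
Proof. by move=> mU mB; rewrite -[X in measurable X]setTI; exact: mU. Qed.

Lemma indic_comp (U : T -> R) (B : set R) :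
  (fun w => \1_B (U w) : R) = \1_(U @^-1` B).
Proof. by apply/funext => w; rewrite !indicE. Qed.

(** The indicators are replaced by bounded functions one coordinate at a time
    ([Ex_extend]), the list s recording which coordinates are already general. *)
Theorem Ex_prod (h : E -> R -> R) : (forall e, bounded_rv (h e)) ->
  Ex (fun w => \prod_e h e (V e w)) = \prod_e Ex (fun w => h e (V0 w)).
Proof.
move=> bh.
suff H (s : seq E) : forall h : E -> R -> R, (forall e, bounded_rv (h e)) ->
    (forall e, e \notin s -> exists2 B, measurable B & h e = \1_B) ->
    Ex (fun w => \prod_e h e (V e w)) = \prod_e Ex (fun w => h e (V0 w)).
  by apply: (H (enum E)) => // e; rewrite mem_enum.
move: h bh => _ _; elim: s => [|e s IH] h bh hs.
  have /boolp.choice[B hB] : forall e, exists B, measurable B /\ h e = \1_B.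
    by move=> e; have [B mB hB] := hs e isT; exists B.
  transitivity (Ex (\1_(\bigcap_(e in [set: E]) V e @^-1` B e))).
    congr (Ex _); apply/funext => w; rewrite indicE.
    have [wB|wB] := boolP (w \in _).
      apply: big1 => e _; rewrite (hB e).2 indicE mem_set //.
      by move: wB; rewrite inE => /(_ e I).
    have [e eB] : exists e, ~ B e (V e w).
      by apply/existsNP => all; move/negP: wB; apply; rewrite inE => e _; exact: all.
    by rewrite (bigD1 e) //= (hB e).2 indicE memNset // mul0r.
  rewrite Ex_indic; last first.
    apply: fin_bigcap_measurable => // e _; apply: measurable_preimage => //; exact: (hB e).1.
  rewrite iidV => [|e]; last exact: (hB e).1.
  apply: eq_bigr => e _; rewrite (hB e).2 indic_comp Ex_indic //.
  by apply: measurable_preimage => //; exact: (hB e).1.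
rewrite [RHS](bigD1 e) //= mulrC.
under eq_fun do rewrite (bigD1 e) //= mulrC.
apply: Ex_extend => //.
  by apply: bounded_rv_prod => i; exact: bounded_rv_comp.
move=> B mB; pose h' j := if j == e then \1_B else h j.
transitivity (Ex (fun w => \prod_j h' j (V j w))).
  congr (Ex _); apply/funext => w; rewrite [RHS](bigD1 e) //= mulrC {1}/h' eqxx.
  by congr (_ * _); apply: eq_bigr => j je; rewrite /h' (negbTE je).
rewrite IH => [|j|j js].
- rewrite (bigD1 e) //= mulrC {2}/h' eqxx; congr (_ * _); apply: eq_bigr => j je.
  by rewrite /h' (negbTE je).
- by rewrite /h'; case: eqP => _ //; exact: bounded_rv_indic.
rewrite /h'; case: eqP => [_|/eqP je]; first by exists B.
by apply: hs; rewrite inE negb_or je.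
Qed.

(** The algebra generated by bounded functions of the variables V e with e in J.
    It plays the role of bounded variables measurable for these coordinates: the
    functionals of the matrix that occur are polynomials, and for them
    independence follows from [Ex_prod] alone. *)
Inductive pspan (J : {set E}) : (T -> R) -> Prop :=
| pspan_prod (h : E -> R -> R) : (forall e, bounded_rv (h e)) ->
    (forall e, e \notin J -> h e = fun=> 1) -> pspan J (fun w => \prod_e h e (V e w))
| pspan_lin (c : R) F G : pspan J F -> pspan J G -> pspan J (fun w => c * F w + G w).

Lemma pspan_bounded J F : pspan J F -> bounded_rv F.
Proof.
elim=> [h bh _|c {}F G _ bF _ bG].
  by apply: bounded_rv_prod => e; exact: bounded_rv_comp.
by apply: bounded_rvD => //; exact: bounded_rvZ.
Qed.

Lemma pspan1 J : pspan J (fun=> 1).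
Proof.
have -> : (fun _ : T => 1 : R) = (fun w => \prod_e (fun _ _ => 1) e (V e w)).
  by apply/funext => w; rewrite big1.
by apply: (@pspan_prod J (fun _ _ => 1)) => // e; exact: bounded_rv_cst.
Qed.

Lemma pspan_cst J c : pspan J (fun=> c).
Proof.
have -> : (fun _ : T => c) = (fun w => (c - 1) * 1 + 1).
  by apply/funext => w; rewrite mulr1 subrK.
by apply: pspan_lin; exact: pspan1.
Qed.

Lemma pspanZ J c F : pspan J F -> pspan J (fun w => c * F w).
Proof.
move=> sF; have -> : (fun w => c * F w) = (fun w => c * F w + 0).
  by apply/funext => w; rewrite addr0.
by apply: pspan_lin => //; exact: pspan_cst.
Qed.

Lemma pspanD J F G : pspan J F -> pspan J G -> pspan J (fun w => F w + G w).
Proof.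
move=> sF sG; have -> : (fun w => F w + G w) = (fun w => 1 * F w + G w).
  by apply/funext => w; rewrite mul1r.
exact: pspan_lin.
Qed.

Lemma pspanM J F G : pspan J F -> pspan J G -> pspan J (fun w => F w * G w).
Proof.
move=> sF; elim: sF G => [h bh hJ G|c {}F1 F2 _ IH1 _ IH2 G sG]; last first.
  have -> : (fun w => (c * F1 w + F2 w) * G w) = (fun w => c * (F1 w * G w) + F2 w * G w).
    by apply/funext => w; rewrite mulrDl mulrA.
  by apply: pspan_lin; [exact: IH1|exact: IH2].
elim=> [g bg gJ|c G1 G2 _ IH1 _ IH2]; last first.
  have -> : (fun w => (\prod_e h e (V e w)) * (c * G1 w + G2 w)) =
     (fun w => c * ((\prod_e h e (V e w)) * G1 w) + (\prod_e h e (V e w)) * G2 w).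
    by apply/funext => w; rewrite mulrDr mulrCA.
  exact: pspan_lin.
have -> : (fun w => (\prod_e h e (V e w)) * \prod_e g e (V e w)) =
  (fun w => \prod_e (fun x => h e x * g e x) (V e w)).
  by apply/funext => w; rewrite -big_split.
apply: (@pspan_prod J (fun e x => h e x * g e x)) => [e|e eJ]; first exact: bounded_rvM.
by rewrite hJ // gJ //; apply/funext => x; rewrite mulr1.
Qed.

Lemma pspan_sum J I (r : seq I) (Q : pred I) (F : I -> T -> R) :
  (forall i, Q i -> pspan J (F i)) -> pspan J (fun w => \sum_(i <- r | Q i) F i w).
Proof.
move=> sF; elim: r => [|i r IH].
  by under eq_fun do rewrite big_nil; exact: pspan_cst.
under eq_fun do rewrite big_cons; have [Qi|//] := boolP (Q i).
by apply: pspanD => //; exact: sF.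
Qed.

Lemma pspanX J F k : pspan J F -> pspan J (fun w => F w ^+ k).
Proof.
move=> sF; elim: k => [|k IH].
  by under eq_fun do rewrite expr0; exact: pspan_cst.
by under eq_fun do rewrite exprS; exact: pspanM.
Qed.

Lemma pspan_sub (J K : {set E}) F : J \subset K -> pspan J F -> pspan K F.
Proof.
move=> JK; elim=> [h bh hJ|c {}F G _ sF _ sG]; last exact: pspan_lin.
by apply: pspan_prod => // e eK; apply: hJ; apply: contra eK; exact: (fintype.subsetP JK).
Qed.

Lemma pspan_coord (J : {set E}) e (h : R -> R) : e \in J -> bounded_rv h ->
  pspan J (fun w => h (V e w)).
Proof.
move=> eJ bh.
have -> : (fun w => h (V e w)) = (fun w => \prod_j (if j == e then h else fun=> 1) (V j w)).
  apply/funext => w; rewrite (bigD1 e) //= eqxx big1 ?mulr1 // => j je.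
  by rewrite (negbTE je).
apply: (@pspan_prod J (fun j => if j == e then h else fun=> 1)) => [j|j jJ].
  by case: eqP => // _; exact: bounded_rv_cst.
by case: eqP => // je; rewrite -je (negbTE jJ) in eJ.
Qed.

Theorem Ex_indep (J K : {set E}) F G : {in J, forall e, e \notin K} -> pspan J F -> pspan K G ->
  Ex (fun w => F w * G w) = Ex F * Ex G.
Proof.
move=> JK sF; elim: sF G => [h bh hJ G|c F1 F2 s1 IH1 s2 IH2 G sG]; last first.
  have bG := pspan_bounded sG; have b1 := pspan_bounded s1; have b2 := pspan_bounded s2.
  have -> : (fun w => (c * F1 w + F2 w) * G w) = (fun w => c * (F1 w * G w) + F2 w * G w).
    by apply/funext => w; rewrite mulrDl mulrA.
  rewrite !ExD ?ExZ ?IH1 ?IH2 //; try (by rewrite mulrDl mulrA);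
    rewrite -/(bounded_rv _); try (by apply: bounded_rvM); try (by apply: bounded_rvZ => //; apply: bounded_rvM).
have bH : bounded_rv (fun w => \prod_e h e (V e w)).
  by apply: bounded_rv_prod => e; exact: bounded_rv_comp.
elim=> [g bg gK|c G1 G2 s1 IH1 s2 IH2]; last first.
  have b1 := pspan_bounded s1; have b2 := pspan_bounded s2.
  have -> : (fun w => (\prod_e h e (V e w)) * (c * G1 w + G2 w)) =
     (fun w => c * ((\prod_e h e (V e w)) * G1 w) + (\prod_e h e (V e w)) * G2 w).
    by apply/funext => w; rewrite mulrDr mulrCA.
  rewrite !ExD ?ExZ ?IH1 ?IH2 //; try (by rewrite mulrDr mulrCA);
    rewrite -/(bounded_rv _); try (by apply: bounded_rvM); try (by apply: bounded_rvZ => //; apply: bounded_rvM).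
have -> : (fun w => (\prod_e h e (V e w)) * \prod_e g e (V e w)) =
  (fun w => \prod_e (fun x => h e x * g e x) (V e w)).
  by apply/funext => w; rewrite -big_split.
rewrite (@Ex_prod (fun e x => h e x * g e x)) => [|e]; last exact: bounded_rvM.
rewrite (Ex_prod bh) (Ex_prod bg) -big_split.
apply: eq_bigr => e _ /=; have [eJ|eJ] := boolP (e \in J).
  rewrite gK; last exact: JK.
  by rewrite Ex_cst mulr1; under eq_fun do rewrite mulr1.
by rewrite hJ // Ex_cst mul1r; under eq_fun do rewrite mul1r.
Qed.

Lemma Ex_coord e (h : R -> R) : bounded_rv h -> Ex (fun w => h (V e w)) = Ex (fun w => h (V0 w)).
Proof.
move=> bh; have := @Ex_prod (fun j => if j == e then h else fun=> 1).
have -> : (fun w => \prod_j (if j == e then h else fun=> 1) (V j w)) = (fun w => h (V e w)).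
  apply/funext => w; rewrite (bigD1 e) //= eqxx big1 ?mulr1 // => j je.
  by rewrite (negbTE je).
move=> ->; last by move=> j; case: eqP => // _; exact: bounded_rv_cst.
rewrite (bigD1 e) //= eqxx big1 ?mulr1 // => j je.
by rewrite (negbTE je) Ex_cst.
Qed.

End IndependentFamily.

(** * Moments of sums of nonnegative variables *)

Section SumMoments.
Context {R : realType} {d : measure_display} {T : measurableType d} (P : probability T R).
Variables (E : finType) (V : E -> T -> R) (V0 : T -> R).
Hypotheses (mV : forall e, measurable_fun setT (V e)) (mV0 : measurable_fun setT V0).
Hypothesis iidV : iid_family P V V0.
Local Notation Ex := (Ex P).

Fixpoint moment_cst (m : nat) : nat :=
  if m is m'.+1 then (2 ^ m' * (moment_cst m').+1)%N else 1%N.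

Lemma exprD_le (a b : R) (m : nat) : 0 <= a -> 0 <= b ->
  (a + b) ^+ m <= 2 ^+ m * (a ^+ m + b ^+ m).
Proof.
move=> a0 b0; wlog ab : a b a0 b0 / a <= b.
  move=> H; have [|/ltW] := leP a b; first exact: H.
  by move=> ba; rewrite addrC [a ^+ m + _]addrC; exact: H.
apply: (le_trans (y := (2 * b) ^+ m)).
  by rewrite lerXn2r ?nnegrE ?addr_ge0 ?mulr_ge0 // mulrDl mul1r lerD2r.
by rewrite exprMn ler_wpM2l ?exprn_ge0 // lerDr exprn_ge0.
Qed.

(** Rosenthal's inequality for nonnegative summands.  Write one factor of the
    power as a sum over e and separate the summand of e in the other factors: it
    is bounded by B, and the rest is independent of it. *)
Lemma sum_moment_le (g : R -> R) (B m1 : R) (m : nat) (J : {set E}) :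
  bounded_rv g -> (forall x, 0 <= g x <= B) -> Ex (fun w => g (V0 w)) <= m1 ->
  Ex (fun w => (\sum_(e in J) g (V e w)) ^+ m) <=
    (moment_cst m)%:R * (#|J|%:R * m1 + B) ^+ m.
Proof.
move=> bg gB gm; have g0 x : 0 <= g x by case/andP: (gB x).
have gleB x : g x <= B by case/andP: (gB x).
have B0 : 0 <= B by rewrite (le_trans _ (gleB 0)).
have m10 : 0 <= m1 by rewrite (le_trans _ gm) // Ex_ge0.
elim: m J => [|m IH] J; first by under eq_fun do rewrite expr0; rewrite Ex_cst !expr0 mulr1.
have bge e : bounded_rv (fun w => g (V e w)) by exact: bounded_rv_comp.
have bS (K : {set E}) k : bounded_rv (fun w => (\sum_(e in K) g (V e w)) ^+ k).
  by apply: bounded_rvX; exact: bounded_rv_sum.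
pose D := #|J|%:R * m1 + B.
have D0 : 0 <= D by rewrite addr_ge0 // mulr_ge0.
have bterm e : bounded_rv (fun w => 2 ^+ m * (B ^+ m * g (V e w) +
     g (V e w) * (\sum_(j in (J :\ e)%SET) g (V j w)) ^+ m)).
  by apply: bounded_rvZ; apply: bounded_rvD; [exact: bounded_rvZ|exact: bounded_rvM].
apply: (le_trans (y := Ex (fun w => \sum_(e in J) 2 ^+ m * (B ^+ m * g (V e w) +
     g (V e w) * (\sum_(j in (J :\ e)%SET) g (V j w)) ^+ m)))).
  apply: Ex_le => //; first exact: bounded_rv_sum.
  move=> w; rewrite exprS mulr_suml; apply: ler_sum => e eJ.
  rewrite (big_setD1 e) //= -/(_ :\ _)%SET.
  set y := \sum_(_ in _) _; have y0 : 0 <= y by exact: sumr_ge0.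
  apply: le_trans (ler_wpM2l (g0 _) (exprD_le m (g0 _) y0)) _.
  rewrite mulrCA ler_wpM2l ?exprn_ge0 // mulrDr lerD2r mulrC ler_wpM2r //.
  by rewrite lerXn2r ?nnegrE.
rewrite Ex_sum //.
have term e : e \in J -> Ex (fun w => 2 ^+ m * (B ^+ m * g (V e w) +
     g (V e w) * (\sum_(j in (J :\ e)%SET) g (V j w)) ^+ m)) <=
     2 ^+ m * ((moment_cst m).+1%:R * m1 * D ^+ m).
  move=> eJ; rewrite ExZ; last by apply: bounded_rvD; [exact: bounded_rvZ|exact: bounded_rvM].
  rewrite ler_wpM2l ?exprn_ge0 // ExD; [|exact: bounded_rvZ|exact: bounded_rvM].
  rewrite ExZ // (Ex_coord mV mV0 iidV e bg).
  rewrite (@Ex_indep _ _ _ P E V V0 mV mV0 iidV [set e]%SET (J :\ e)%SET); first last.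
  - by apply: pspanX; apply: pspan_sum => j jJ; exact: pspan_coord.
  - by apply: pspan_coord => //; rewrite inE.
  - by move=> j; rewrite !inE => /eqP->; rewrite eqxx.
  rewrite (Ex_coord mV mV0 iidV e bg).
  have h1 : B ^+ m <= D ^+ m by rewrite lerXn2r ?nnegrE // lerDr mulr_ge0.
  have h2 : Ex (fun w => (\sum_(j in (J :\ e)%SET) g (V j w)) ^+ m) <= (moment_cst m)%:R * D ^+ m.
    apply: le_trans (IH _) _; rewrite ler_wpM2l // lerXn2r ?nnegrE ?addr_ge0 ?mulr_ge0 //.
    by rewrite lerD2r ler_wpM2r // ler_nat subset_leq_card // subD1set.
  rewrite -natr1 mulrDl mulrDl mul1r addrC; apply: lerD.
    rewrite -[X in _ <= X]mulrA mulrCA; apply: ler_pM => //; first exact: Ex_ge0.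
    by apply: Ex_ge0 => w; rewrite exprn_ge0 // sumr_ge0.
  by rewrite mulrC ler_pM ?exprn_ge0 // Ex_ge0.
apply: le_trans (ler_sum _ term) _.
rewrite sumr_const -[X in X <= _]mulr_natl [moment_cst _]/= natrM natrX exprS -/D.
rewrite mulrCA -!mulrA ler_wpM2l ?exprn_ge0 // mulrCA ler_wpM2l // mulrA ler_wpM2r ?exprn_ge0 //.
by rewrite lerDl.
Qed.

End SumMoments.

(** * Second moments of products of rows *)

Section MatrixMoments.
Context {R : realType} {d : measure_display} {T : measurableType d} (P : probability T R).
Variables (r c : nat) (V : 'I_r * 'I_c -> T -> R) (V0 : T -> R).
Hypotheses (mV : forall e, measurable_fun setT (V e)) (mV0 : measurable_fun setT V0).
Hypothesis iidV : iid_family P V V0.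
Local Notation Ex := (Ex P).
Local Notation E0 h := (Ex (fun w => h (V0 w))).

Definition map_entries (f : R -> R) (w : T) : 'M[R]_(r, c) :=
  \matrix_(i, t) f (V (i, t) w).

(** Expand the square over pairs of columns: equal columns give second moments,
    distinct ones give products of means. *)
Lemma cross_moment_le (f g : R -> R) (i j : 'I_r) : bounded_rv f -> bounded_rv g -> i != j ->
  Ex (fun w => (\sum_t f (V (i, t) w) * g (V (j, t) w)) ^+ 2) <=
    c%:R * (E0 (fun x => f x ^+ 2) * E0 (fun x => g x ^+ 2)) +
    c%:R ^+ 2 * (E0 f ^+ 2 * E0 g ^+ 2).
Proof.
move=> bf bg ij.
have bfV e : bounded_rv (fun w => f (V e w)) by exact: bounded_rv_comp.
have bgV e : bounded_rv (fun w => g (V e w)) by exact: bounded_rv_comp.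
have two (h : R -> R) (k : 'I_r) t s : bounded_rv h ->
   Ex (fun w => h (V (k, t) w) * h (V (k, s) w)) =
   if t == s then E0 (fun x => h x ^+ 2) else E0 h ^+ 2.
  move=> bh; case: eqP => [->|/eqP ts].
    rewrite -(Ex_coord mV mV0 iidV (k, s) (h := fun x => h x ^+ 2)); last exact: bounded_rvX.
    by congr (Ex _); apply/funext => w; rewrite expr2.
  rewrite (@Ex_indep _ _ _ P _ V V0 mV mV0 iidV [set (k, t)]%SET [set (k, s)]%SET
      (fun w => h (V (k, t) w)) (fun w => h (V (k, s) w))).
  - by rewrite !(Ex_coord mV mV0 iidV).
  - by move=> e; rewrite !inE => /eqP->; rewrite xpair_eqE eqxx.
  - by apply: pspan_coord => //; rewrite inE.
  - by apply: pspan_coord => //; rewrite inE.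
have b2 (h : R -> R) (k : 'I_r) t s : bounded_rv h -> bounded_rv (fun w => h (V (k, t) w) * h (V (k, s) w)).
  by move=> bh; apply: bounded_rvM; exact: bounded_rv_comp.
have bts t s : bounded_rv (fun w => f (V (i, t) w) * f (V (i, s) w) * (g (V (j, t) w) * g (V (j, s) w))).
  by apply: bounded_rvM; exact: b2.
have -> : (fun w => (\sum_t f (V (i, t) w) * g (V (j, t) w)) ^+ 2) =
   (fun w => \sum_t \sum_s f (V (i, t) w) * f (V (i, s) w) * (g (V (j, t) w) * g (V (j, s) w))).
  apply/funext => w; rewrite expr2 mulr_suml; apply: eq_bigr => t _.
  by rewrite mulr_sumr; apply: eq_bigr => s _; rewrite mulrACA.
rewrite Ex_sum => [|t]; last exact: bounded_rv_sum.
set f2 := E0 (fun x => f x ^+ 2); set g2 := E0 (fun x => g x ^+ 2).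
have f20 : 0 <= f2 by apply: Ex_ge0 => w; rewrite sqr_ge0.
have g20 : 0 <= g2 by apply: Ex_ge0 => w; rewrite sqr_ge0.
have term t s : Ex (fun w => f (V (i, t) w) * f (V (i, s) w) * (g (V (j, t) w) * g (V (j, s) w)))
   <= (if t == s then f2 * g2 else 0) + E0 f ^+ 2 * E0 g ^+ 2.
  rewrite (@Ex_indep _ _ _ P _ V V0 mV mV0 iidV [set (i, t); (i, s)]%SET [set (j, t); (j, s)]%SET
     (fun w => f (V (i, t) w) * f (V (i, s) w)) (fun w => g (V (j, t) w) * g (V (j, s) w))).
  - rewrite !two //; case: eqP => _; rewrite ?add0r // lerDl.
    by rewrite mulr_ge0 ?sqr_ge0.
  - by move=> e; rewrite !inE => /orP[] /eqP->; rewrite !xpair_eqE (negbTE ij).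
  - by apply: pspanM; apply: pspan_coord => //; rewrite !inE eqxx ?orbT.
  - by apply: pspanM; apply: pspan_coord => //; rewrite !inE eqxx ?orbT.
apply: (le_trans (y := \sum_(t < c) \sum_(s < c) ((if t == s then f2 * g2 else 0) + E0 f ^+ 2 * E0 g ^+ 2))).
  by apply: ler_sum => t _; rewrite Ex_sum //; apply: ler_sum => s _; exact: term.
rewrite (eq_bigr (fun=> f2 * g2 + c%:R * (E0 f ^+ 2 * E0 g ^+ 2))) => [|t _].
  rewrite sumr_const card_ord -[X in X <= _]mulr_natl le_eqVlt; apply/orP; left; apply/eqP; ring.
rewrite big_split /= sumr_const card_ord -[_ *+ c]mulr_natl; congr (_ + _).
by rewrite -big_mkcond /= (big_pred1 t) // => s; rewrite eq_sym.
Qed.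

Lemma Ex_hs2_offdiag_le (f g : R -> R) : bounded_rv f -> bounded_rv g ->
  Ex (fun w => hs2 (offdiag (map_entries f w *m (map_entries g w)^T))) <=
  r%:R ^+ 2 * (c%:R * (E0 (fun x => f x ^+ 2) * E0 (fun x => g x ^+ 2)) +
    c%:R ^+ 2 * (E0 f ^+ 2 * E0 g ^+ 2)).
Proof.
move=> bf bg; set Q := c%:R * _ + _.
have Q0 : 0 <= Q.
  have E20 (h : R -> R) : 0 <= E0 (fun x => h x ^+ 2) by apply: Ex_ge0 => w; rewrite sqr_ge0.
  by apply: addr_ge0; apply: mulr_ge0; rewrite ?exprn_ge0 //; apply: mulr_ge0; rewrite ?sqr_ge0.
have bij i j : bounded_rv (fun w => (\sum_t f (V (i, t) w) * g (V (j, t) w)) ^+ 2).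
  by apply: bounded_rvX; apply: bounded_rv_sum => t; apply: bounded_rvM; exact: bounded_rv_comp.
have -> : (fun w => hs2 (offdiag (map_entries f w *m (map_entries g w)^T))) =
  (fun w => \sum_i \sum_(j | j != i) (\sum_t f (V (i, t) w) * g (V (j, t) w)) ^+ 2).
  apply/funext => w; rewrite hs2E; apply: eq_bigr => i _.
  rewrite (bigID (fun j => j == i)) /= big_pred1_eq !mxE eqxx expr0n add0r.
  apply: eq_bigr => j ji; rewrite !mxE eq_sym (negbTE ji); congr (_ ^+ 2).
  by apply: eq_bigr => t _; rewrite !mxE.
rewrite Ex_sum => [|i]; last exact: bounded_rv_sum.
apply: (le_trans (y := \sum_(i < r) \sum_(j < r) Q)).
  apply: ler_sum => i _; rewrite Ex_sum // big_mkcond /=; apply: ler_sum => j _.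
  by case: ifP => // ji; apply: cross_moment_le => //; rewrite eq_sym ji.
by rewrite !sumr_const !card_ord -mulrnA -[X in X <= _]mulr_natl natrM expr2.
Qed.

End MatrixMoments.

(** * Trace moments of sums of independent matrices *)

Section MatrixRosenthal.
Context {R : realType} {d : measure_display} {T : measurableType d} (P : probability T R).
Variables (r c : nat) (V : 'I_r * 'I_c -> T -> R) (V0 : T -> R).
Hypotheses (mV : forall e, measurable_fun setT (V e)) (mV0 : measurable_fun setT V0).
Hypothesis iidV : iid_family P V V0.
Local Notation Ex := (Ex P).
Local Notation E0 h := (Ex (fun w => h (V0 w))).
Variable f : R -> R.
Hypotheses (bf : bounded_rv f) (f_mean0 : E0 f = 0).
Local Notation f2 := (E0 (fun x => f x ^+ 2)).

Definition col_vec (t : 'I_c) (w : T) : 'rV[R]_r := \row_i f (V (i, t) w).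
(** The contribution of one column to the off-diagonal part of the Gram matrix of
    the rows. *)
Definition col_mx_off (t : 'I_c) (w : T) : 'M[R]_r := offdiag ((col_vec t w)^T *m col_vec t w).
Definition col_sum (J : {set 'I_c}) (w : T) : 'M[R]_r := \sum_(t in J) col_mx_off t w.
(** Bounds the operator norm of [col_mx_off], see [hs2_offdiag_rank1]. *)
Definition col_len (t : 'I_c) (w : T) : R := 2 * \sum_i f (V (i, t) w) ^+ 2.
Definition in_cols (J : {set 'I_c}) : {set 'I_r * 'I_c} := [set e : 'I_r * 'I_c | e.2 \in J]%SET.
Definition mspan (J : {set 'I_c}) (F : T -> 'M[R]_r) :=
  forall a b, pspan V (in_cols J) (fun w => F w a b).

Lemma col_mx_offE t w a b : col_mx_off t w a b =
  if a == b then 0 else f (V (a, t) w) * f (V (b, t) w).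
Proof. by rewrite !mxE; case: eqP => // _; rewrite big_ord1 !mxE. Qed.

Lemma col_mx_off_sym t w : (col_mx_off t w)^T = col_mx_off t w.
Proof. by apply: offdiag_sym; rewrite trmx_mul trmxK. Qed.

Lemma col_sum_sym J w : (col_sum J w)^T = col_sum J w.
Proof. by rewrite /col_sum raddf_sum /=; apply: eq_bigr => t _; rewrite col_mx_off_sym. Qed.

Lemma col_len_ge0 t w : 0 <= col_len t w.
Proof. by rewrite mulr_ge0 // sumr_ge0 // => i _; rewrite sqr_ge0. Qed.

Lemma hs2_col_mx_off t w (X : 'M[R]_r) :
  hs2 (col_mx_off t w * X) <= col_len t w ^+ 2 * hs2 X.
Proof.
have := hs2_offdiag_rank1 (col_vec t w) X.
by rewrite /col_len; under eq_bigr do rewrite mxE.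
Qed.

Lemma pspan_entry t i (J : {set 'I_c}) : t \in J -> pspan V (in_cols J) (fun w => f (V (i, t) w)).
Proof. by move=> tJ; apply: pspan_coord => //; rewrite inE. Qed.

Lemma mspan_col t (J : {set 'I_c}) : t \in J -> mspan J (col_mx_off t).
Proof.
move=> tJ a b; under eq_fun do rewrite col_mx_offE.
by case: eqP => _; [exact: pspan_cst | apply: pspanM; exact: pspan_entry].
Qed.

Lemma mspan_sum J : mspan J (col_sum J).
Proof.
move=> a b; under eq_fun do rewrite /col_sum summxE.
by apply: pspan_sum => t tJ; exact: mspan_col.
Qed.

Lemma mspanM J F G : mspan J F -> mspan J G -> mspan J (fun w => F w * G w).
Proof.
move=> sF sG a b; under eq_fun do rewrite -mulmxE mxE.
by apply: pspan_sum => k _; apply: pspanM.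
Qed.

Lemma mspanX J F k : mspan J F -> mspan J (fun w => F w ^+ k).
Proof.
move=> sF; elim: k => [|k IH].
  by move=> a b; under eq_fun do rewrite expr0; exact: pspan_cst.
by under eq_fun do rewrite exprS; exact: mspanM.
Qed.

Lemma mspan_bounded J F a b : mspan J F -> bounded_rv (fun w => F w a b).
Proof. by move=> sF; exact: (pspan_bounded mV (sF a b)). Qed.

Lemma mspan_hs2 J F : mspan J F -> pspan V (in_cols J) (fun w => hs2 (F w)).
Proof.
move=> sF; under eq_fun do rewrite hs2E.
by apply: pspan_sum => a _; apply: pspan_sum => b _; exact: pspanX.
Qed.

Lemma mspan_tr J F : mspan J F -> pspan V (in_cols J) (fun w => \tr (F w)).
Proof. by move=> sF; apply: pspan_sum => a _; exact: sF. Qed.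

Lemma pspan_len t (J : {set 'I_c}) : t \in J -> pspan V (in_cols J) (col_len t).
Proof.
move=> tJ; apply: pspanZ; apply: pspan_sum => i _; apply: pspanX; exact: pspan_entry.
Qed.

Lemma in_cols_notin t (J : {set 'I_c}) : t \notin J ->
  {in in_cols [set t]%SET, forall e, e \notin in_cols J}.
Proof. by move=> tJ e; rewrite !inE => /eqP->. Qed.

Lemma Ex_indep_col t (J : {set 'I_c}) F G : t \notin J -> pspan V (in_cols [set t]%SET) F ->
  pspan V (in_cols J) G -> Ex (fun w => F w * G w) = Ex F * Ex G.
Proof. by move=> tJ; apply: (Ex_indep mV mV0 iidV); exact: in_cols_notin. Qed.

Lemma Ex_entry2 t a b : a != b -> Ex (fun w => f (V (a, t) w) * f (V (b, t) w)) = 0.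
Proof.
move=> ab; rewrite (@Ex_indep _ _ _ P _ V V0 mV mV0 iidV [set (a, t)]%SET [set (b, t)]%SET
      (fun w => f (V (a, t) w)) (fun w => f (V (b, t) w))).
- by rewrite (Ex_coord mV mV0 iidV _ bf) f_mean0 mul0r.
- by move=> e; rewrite !inE => /eqP->; rewrite xpair_eqE (negbTE ab).
- by apply: pspan_coord => //; rewrite inE.
- by apply: pspan_coord => //; rewrite inE.
Qed.

(** An off-diagonal entry is a product of two independent centered variables. *)
Lemma Ex_col_centered t (J : {set 'I_c}) F : t \notin J -> mspan J F ->
  Ex (fun w => \tr (col_mx_off t w * F w)) = 0.
Proof.
move=> tJ sF.
have st := @mspan_col t [set t]%SET (set11 t).
have b2 a k : bounded_rv (fun w => col_mx_off t w a k * F w k a).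
  by apply: bounded_rvM; [exact: (mspan_bounded _ _ st)|exact: (mspan_bounded _ _ sF)].
under eq_fun do rewrite /mxtrace.
under eq_fun do (under eq_bigr do rewrite -mulmxE mxE).
rewrite Ex_sum => [|a]; last exact: bounded_rv_sum.
apply: big1 => a _; rewrite Ex_sum //; apply: big1 => k _.
rewrite (Ex_indep_col tJ) //; under eq_fun do rewrite col_mx_offE.
by case: eqP => [_|/eqP ak]; rewrite ?Ex_cst ?Ex_entry2 // mul0r.
Qed.

(** Summed over a, this says that the mean of the square of [col_mx_off] is
    (r - 1) f2^2 times the identity. *)
Lemma Ex_col_second t a k l : Ex (fun w => col_mx_off t w a k * col_mx_off t w a l) =
  if (k == l) && (a != k) then f2 ^+ 2 else 0.
Proof.
under eq_fun do rewrite !col_mx_offE.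
have [ak|ak] := eqVneq a k; first by rewrite andbF; under eq_fun do rewrite mul0r; rewrite Ex_cst.
have [al|al] := eqVneq a l.
  by rewrite -al eq_sym (negbTE ak) /=; under eq_fun do rewrite mulr0; rewrite Ex_cst.
rewrite andbT.
have -> : (fun w => f (V (a, t) w) * f (V (k, t) w) * (f (V (a, t) w) * f (V (l, t) w))) =
  (fun w => (fun x => f x ^+ 2) (V (a, t) w) * (f (V (k, t) w) * f (V (l, t) w))).
  by apply/funext => w; ring.
have bf2 : bounded_rv (fun x => f x ^+ 2) by exact: bounded_rvX.
rewrite (@Ex_indep _ _ _ P _ V V0 mV mV0 iidV [set (a, t)]%SET [set (k, t); (l, t)]%SET
     (fun w => (fun x => f x ^+ 2) (V (a, t) w)) (fun w => f (V (k, t) w) * f (V (l, t) w))).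
- rewrite (Ex_coord mV mV0 iidV _ bf2); case: eqP => [->|/eqP kl].
    rewrite expr2; congr (_ * _); rewrite -(Ex_coord mV mV0 iidV (l, t) bf2).
    by congr (Ex _); apply/funext => w; rewrite expr2.
  by rewrite Ex_entry2 // mulr0.
- by move=> e; rewrite !inE => /eqP->; rewrite !xpair_eqE (negbTE ak) (negbTE al).
- exact: (pspan_coord V (set11 (a, t)) bf2).
- by apply: pspanM; apply: pspan_coord => //; rewrite !inE eqxx ?orbT.
Qed.

Lemma Ex_hs2_col t (J : {set 'I_c}) F : t \notin J -> mspan J F ->
  Ex (fun w => hs2 (col_mx_off t w * F w)) <= r%:R * f2 ^+ 2 * Ex (fun w => hs2 (F w)).
Proof.
move=> tJ sF.
have st := @mspan_col t [set t]%SET (set11 t).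
pose A := col_mx_off t.
have sA2 a k l : pspan V (in_cols [set t]%SET) (fun w => A w a k * A w a l) by apply: pspanM.
have sF2 b k l : pspan V (in_cols J) (fun w => F w k b * F w l b) by apply: pspanM.
have bA2 a k l := pspan_bounded mV (sA2 a k l); have bF2 b k l := pspan_bounded mV (sF2 b k l).
have bAF a b k l : bounded_rv (fun w => A w a k * A w a l * (F w k b * F w l b)).
  exact: bounded_rvM.
have -> : (fun w => hs2 (A w * F w)) = (fun w => \sum_a \sum_b \sum_k \sum_l
    A w a k * A w a l * (F w k b * F w l b)).
  apply/funext => w; rewrite hs2E; apply: eq_bigr => a _; apply: eq_bigr => b _.
  rewrite -mulmxE mxE expr2 mulr_suml; apply: eq_bigr => k _; rewrite mulr_sumr.
  by apply: eq_bigr => l _; rewrite mulrACA.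
have -> : (fun w => hs2 (F w)) = (fun w => \sum_k \sum_b F w k b * F w k b).
  by apply/funext => w; rewrite hs2E; apply: eq_bigr => a _; apply: eq_bigr => b _; rewrite expr2.
have bs3 a b k : bounded_rv (fun w => \sum_l A w a k * A w a l * (F w k b * F w l b)).
  exact: bounded_rv_sum.
have bs2 a b : bounded_rv (fun w => \sum_k \sum_l A w a k * A w a l * (F w k b * F w l b)).
  exact: bounded_rv_sum.
rewrite Ex_sum => [|a]; last exact: bounded_rv_sum.
set Q := Ex (fun w => \sum_k \sum_b F w k b * F w k b); rewrite -mulrA.
apply: (le_trans (y := \sum_(a < r) f2 ^+ 2 * Q)); last first.
  by rewrite sumr_const card_ord -[X in X <= _]mulr_natl.
apply: ler_sum => a _; rewrite Ex_sum // /Q Ex_sum => [|k]; last by exact: bounded_rv_sum.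
rewrite mulr_sumr.
under [X in _ <= X]eq_bigr do rewrite Ex_sum // mulr_sumr.
rewrite [X in _ <= X]exchange_big; apply: ler_sum => b _; rewrite Ex_sum //.
apply: ler_sum => k _; rewrite Ex_sum // (bigD1 k) //= big1 => [|l lk].
  rewrite addr0 (Ex_indep_col tJ) // Ex_col_second eqxx /=.
  case: ifP => // _; rewrite mul0r mulr_ge0 ?sqr_ge0 // Ex_ge0 // => w.
  by rewrite -expr2 sqr_ge0.
by rewrite (Ex_indep_col tJ) // Ex_col_second eq_sym (negbTE lk) mul0r.
Qed.

(** Where col_len is at most L, its power is bounded by L and the second moment of
    the column is used; elsewhere the column is bounded by its length, and the
    excess over L is absorbed by a higher moment of the length. *)
Lemma Ex_len_hs2_col t (J : {set 'I_c}) F (j m : nat) (L nu : R) : t \notin J -> mspan J F ->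
  0 < L -> Ex (fun w => col_len t w ^+ (j.*2 + m + 2)) <= L ^+ (j.*2 + m) * nu ->
  Ex (fun w => col_len t w ^+ j.*2 * hs2 (col_mx_off t w * F w)) <=
   L ^+ j.*2 * (r%:R * f2 ^+ 2 + nu) * Ex (fun w => hs2 (F w)).
Proof.
move=> tJ sF L0 hnu.
have st := @mspan_col t [set t]%SET (set11 t).
have sl := @pspan_len t [set t]%SET (set11 t).
have bl := pspan_bounded mV sl.
have bF := pspan_bounded mV (mspan_hs2 sF).
have sAF : mspan (t |: J)%SET (fun w => col_mx_off t w * F w).
  apply: mspanM; first by apply: mspan_col; rewrite !inE eqxx.
  move=> a b; apply: pspan_sub (sF a b); apply/fintype.subsetP => e.
  by rewrite !inE => ->; rewrite orbT.
have bAF := pspan_bounded mV (mspan_hs2 sAF).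
have blX k := bounded_rvX k bl.
apply: (le_trans (y := Ex (fun w => L ^+ j.*2 * hs2 (col_mx_off t w * F w) +
   (L ^+ m)^-1 * (col_len t w ^+ (j.*2 + m + 2) * hs2 (F w))))).
  apply: Ex_le; first exact: bounded_rvM.
    by apply: bounded_rvD; apply: bounded_rvZ => //; exact: bounded_rvM.
  move=> w; have h0 := hs2_ge0 (col_mx_off t w * F w).
  move: (col_len t w) (col_len_ge0 t w) (hs2_col_mx_off t w (F w)) => l l0 h1.
  have h2 : 0 <= (L ^+ m)^-1 * (l ^+ (j.*2 + m + 2) * hs2 (F w)).
    by rewrite !mulr_ge0 ?invr_ge0 ?exprn_ge0 ?hs2_ge0 // ltW.
  have [lL|/ltW Ll] := leP l L.
    apply: (le_trans (y := L ^+ j.*2 * hs2 (col_mx_off t w * F w))); last by rewrite lerDl.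
    by rewrite ler_wpM2r // lerXn2r ?nnegrE // ltW.
  apply: (le_trans (y := (L ^+ m)^-1 * (l ^+ (j.*2 + m + 2) * hs2 (F w)))); last first.
    by rewrite lerDr mulr_ge0 // exprn_ge0 // ltW.
  rewrite ler_pdivlMl ?exprn_gt0 // mulrCA exprD exprD -mulrA -mulrA.
  rewrite ler_wpM2l ?exprn_ge0 //.
  apply: ler_pM; rewrite ?exprn_ge0 //; first exact: ltW.
  by rewrite lerXn2r ?nnegrE // ltW.
have b2 : bounded_rv (fun w => col_len t w ^+ (j.*2 + m + 2) * hs2 (F w)) by exact: bounded_rvM.
rewrite ExD ?ExZ //; last 2 first.
- exact: bounded_rvZ.
- exact: bounded_rvZ.
have hF0 : 0 <= Ex (fun w => hs2 (F w)) by apply: Ex_ge0 => w; exact: hs2_ge0.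
rewrite mulrDr mulrDl; apply: lerD.
  rewrite -[X in _ <= X]mulrA; apply: ler_wpM2l; first by rewrite exprn_ge0 // ltW.
  exact: (Ex_hs2_col tJ sF).
rewrite (Ex_indep_col tJ); [|exact: pspanX|exact: mspan_hs2].
rewrite mulrA; apply: ler_wpM2r => //; rewrite ler_pdivrMl ?exprn_gt0 //.
by rewrite mulrA -exprD [(m + _)%N]addnC.
Qed.

(** The constant produced by the recursion in [matrix_rosenthal]. *)
Fixpoint rosenthal_cst (q : nat) : nat :=
  if q is k.+1 then
    (((k.*2.+1 * (word_cst k).+1) * k.+1).+1 * rosenthal_cst k)%N
  else 1%N.

Lemma rosenthal_cst_le i k : (i <= k)%N -> (rosenthal_cst i <= rosenthal_cst k)%N.
Proof.
move=> /subnKC <-; elim: (k - i)%N => [|j IH]; first by rewrite addn0.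
by rewrite addnS (leq_trans IH) //= leq_pmull.
Qed.

(** A matrix version of Rosenthal's inequality for the even trace moments of a sum
    S of independent centered matrices.  In tr S^(2k + 2) one factor S is written
    as the sum of the columns A_t, and S - A_t, which is independent of A_t,
    replaces S in the other factors: the first order term vanishes by
    [Ex_col_centered], and by [trace_odd_exp_diff] the remaining ones are of
    second order in A_t, hence bounded through lower trace moments of S - A_t. *)
Theorem matrix_rosenthal (q m : nat) (L nu Lam : R) : 0 < L -> 0 <= nu ->
  (forall t j, (j < q)%N ->
     Ex (fun w => col_len t w ^+ (j.*2 + m + 2)) <= L ^+ (j.*2 + m) * nu) ->
  L ^+ 2 <= Lam -> c%:R * (r%:R * f2 ^+ 2 + nu) <= Lam ->
  forall k J, (k <= q)%N ->
  Ex (fun w => \tr (col_sum J w ^+ k.*2)) <= (rosenthal_cst k)%:R * r%:R * Lam ^+ k.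
Proof.
move=> L0 nu0 hnu LLam vLam k; elim/ltn_ind: k => -[|k] IH J kq.
  under eq_fun do rewrite double0 expr0.
  by rewrite Ex_cst expr0 mulr1 mul1r mxtrace1.
have Lam0 : 0 <= Lam by rewrite (le_trans _ LLam) // sqr_ge0.
pose D : R := (k.*2.+1 * (word_cst k).+1)%:R.
pose S' t := col_sum (J :\ t)%SET.
have tJ' t : t \notin (J :\ t)%SET by rewrite !inE eqxx.
have SE t w : t \in J -> col_sum J w = S' t w + col_mx_off t w.
  by move=> tJ; rewrite /S' /col_sum (big_setD1 t) //= addrC.
(* The term of column t after removing it from the other factors: first order
   part plus the second order bound of trace_odd_exp_diff. *)
pose bnd t w := \tr (col_mx_off t w * S' t w ^+ k.*2.+1) +
  D * \sum_(i < k.+1) col_len t w ^+ (k - i).*2 * hs2 (col_mx_off t w * S' t w ^+ i).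
have sA t : mspan [set: _]%SET (col_mx_off t) by apply: mspan_col; rewrite inE.
have sS t : mspan [set: _]%SET (S' t).
  by move=> a b; apply: pspan_sub (mspan_sum (J :\ t)%SET a b); apply/fintype.subsetP => e; rewrite !inE.
have bT t : bounded_rv (fun w => \tr (col_mx_off t w * S' t w ^+ k.*2.+1)).
  by apply: (pspan_bounded mV); apply: mspan_tr; apply: mspanM => //; exact: mspanX.
have bH t i : bounded_rv (fun w => col_len t w ^+ (k - i).*2 * hs2 (col_mx_off t w * S' t w ^+ i)).
  apply: bounded_rvM.
    by apply: bounded_rvX; apply: (pspan_bounded mV (pspan_len (set11 t))).
  by apply: (pspan_bounded mV); apply: mspan_hs2; apply: mspanM => //; exact: mspanX.
have bSum t : bounded_rv (fun w => D * \sum_(i < k.+1) col_len t w ^+ (k - i).*2 *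
     hs2 (col_mx_off t w * S' t w ^+ i)).
  by apply: bounded_rvZ; exact: bounded_rv_sum.
have bb t : bounded_rv (bnd t) by exact: bounded_rvD.
apply: (le_trans (y := Ex (fun w => \sum_(t in J) bnd t w))).
  apply: Ex_le; first by apply: (pspan_bounded mV); apply: mspan_tr; apply: mspanX; exact: mspan_sum.
    exact: bounded_rv_sum.
  move=> w; rewrite doubleS exprS {1}/col_sum mulr_suml raddf_sum /=.
  apply: ler_sum => t tJ; rewrite (SE t w tJ) /bnd -lerBlDl.
  have := trace_odd_exp_diff k (col_mx_off_sym t w) (col_sum_sym (J :\ t)%SET w)
     (col_len_ge0 t w) (hs2_col_mx_off t w).
  rewrite -/(S' t w) => /le_trans; apply; rewrite /D ler_wpM2l //.
  by apply: ler_sum => i _; rewrite -exprM mul2n.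
rewrite Ex_sum //.
pose Q : R := (rosenthal_cst k)%:R * r%:R.
have Q0 : 0 <= Q by rewrite mulr_ge0.
have V0' : 0 <= r%:R * f2 ^+ 2 + nu by rewrite addr_ge0 // mulr_ge0 ?sqr_ge0.
have term t : t \in J -> Ex (bnd t) <= D * (k.+1%:R * (Lam ^+ k * (r%:R * f2 ^+ 2 + nu) * Q)).
  move=> tJ; rewrite /bnd ExD // (Ex_col_centered (tJ' t)); last by apply: mspanX; exact: mspan_sum.
  rewrite add0r ExZ; last exact: bounded_rv_sum.
  rewrite ler_wpM2l // Ex_sum //.
  rewrite -[k.+1 in X in _ <= X]card_ord mulr_natl -sumr_const; apply: ler_sum => i _.
  have ik : (i <= k)%N by rewrite -ltnS.
  have kiq : (k - i < q)%N by rewrite (leq_ltn_trans (leq_subr _ _)).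
  apply: le_trans (Ex_len_hs2_col (tJ' t) _ L0 (hnu t _ kiq)) _.
    by apply: mspanX; exact: mspan_sum.
  have -> : (fun w => hs2 (S' t w ^+ i)) = (fun w => \tr (S' t w ^+ i.*2)).
    apply/funext => w; rewrite /hs2 trmx_exp; last exact: col_sum_sym.
    by rewrite -exprD addnn.
  have h1 : Ex (fun w => \tr (S' t w ^+ i.*2)) <= Q * Lam ^+ i.
    apply: le_trans (IH i _ (J :\ t)%SET _) _; first by rewrite ltnS.
      by rewrite (leq_trans ik) // ltnW.
    rewrite ler_wpM2r ?exprn_ge0 // /Q ler_wpM2r // ler_nat.
    exact: rosenthal_cst_le.
  have h2 : L ^+ (k - i).*2 <= Lam ^+ (k - i).
    by rewrite -mul2n exprM lerXn2r ?nnegrE // sqr_ge0.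
  apply: (le_trans (y := L ^+ (k - i).*2 * (r%:R * f2 ^+ 2 + nu) * (Q * Lam ^+ i))).
    by rewrite ler_wpM2l // mulr_ge0 // exprn_ge0 // ltW.
  apply: (le_trans (y := Lam ^+ (k - i) * (r%:R * f2 ^+ 2 + nu) * (Q * Lam ^+ i))).
    by rewrite ler_wpM2r ?mulr_ge0 ?exprn_ge0 // ler_wpM2r.
  rewrite le_eqVlt; apply/orP; left; apply/eqP.
  have -> : Lam ^+ k = Lam ^+ (k - i) * Lam ^+ i by rewrite -exprD subnK.
  ring.
apply: le_trans (ler_sum _ term) _.
rewrite sumr_const -[X in X <= _]mulr_natl.
have Jc : #|J|%:R <= c%:R :> R by rewrite ler_nat -[c in (_ <= c)%N]card_ord max_card.
set B := D * _; have B0 : 0 <= B by rewrite !mulr_ge0 ?exprn_ge0.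
apply: (le_trans (ler_wpM2r B0 Jc)).
have -> : c%:R * B = D * k.+1%:R * Q * Lam ^+ k * (c%:R * (r%:R * f2 ^+ 2 + nu)).
  by rewrite /B; ring.
apply: (le_trans (y := D * k.+1%:R * Q * Lam ^+ k * Lam)).
  by rewrite ler_wpM2l // !mulr_ge0 ?exprn_ge0.
rewrite -mulrA -exprSr ler_wpM2r ?exprn_ge0 // [rosenthal_cst _]/= natrM -[X in _ <= X]mulrA -/Q.
by rewrite ler_wpM2r // /D -natrM ler_nat.
Qed.

End MatrixRosenthal.

(** * Orders of magnitude as powers of the number of entries *)

Section PowerBounds.
Variable R : realType.
Variable N : nat -> R.
Hypothesis Noo : N n @[n --> \oo] --> +oo.

Lemma near_ge (A : R) : \forall n \near \oo, A <= N n.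
Proof. by move/cvgryPge : Noo; apply. Qed.

Lemma near_all_lt (q : nat) (Q : nat -> nat -> Prop) :
  (forall j, (j < q)%N -> \forall n \near \oo, Q j n) ->
  \forall n \near \oo, forall j, (j < q)%N -> Q j n.
Proof.
elim: q => [|q IH] H; first by near=> n.
have H1 := IH (fun j jq => H j (leqW jq)); have H2 := H q (ltnSn q).
near=> n => j; rewrite ltnS leq_eqVlt => /orP[/eqP->|jq]; last by move: j jq; near: n.
by near: n.
Unshelve. all: by end_near. Qed.

(** Orders of magnitude relative to N.  Since all exponents leave room, constants
    and slowly varying factors need not be tracked. *)
Definition polyO (x : R) (u : nat -> R) :=
  exists2 C, 0 <= C & \forall n \near \oo, `|u n| <= C * N n `^ x.

Lemma powRX (a x : R) (k : nat) : (a `^ x) ^+ k = a `^ (x * k%:R).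
Proof. by rewrite powRrM powR_mulrn // powR_ge0. Qed.

Lemma powR_add (a x y : R) : 0 < a -> a `^ (x + y) = a `^ x * a `^ y.
Proof. by move=> a0; rewrite powRD // (gt_eqF a0) implybT. Qed.

Lemma polyO_le x y u : x <= y -> polyO x u -> polyO y u.
Proof.
move=> xy [C C0 H]; exists C => //; have N1 := near_ge 1.
near=> n; apply: le_trans (_ : _ <= C * N n `^ x) _; first by near: n.
by rewrite ler_wpM2l // ler_powR //; near: n.
Unshelve. all: by end_near. Qed.

Lemma polyO_bound x u v : polyO x v -> (\forall n \near \oo, `|u n| <= `|v n|) -> polyO x u.
Proof.
move=> [C C0 H] uv; exists C => //; near=> n.
by apply: le_trans (_ : _ <= `|v n|) _; near: n.
Unshelve. all: by end_near. Qed.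

Lemma polyO_cst c : polyO 0 (fun=> c).
Proof. by exists `|c| => //; near=> n; rewrite powRr0 mulr1.
Unshelve. all: by end_near. Qed.

Lemma polyO_pow x : polyO x (fun n => N n `^ x).
Proof. by exists 1 => //; near=> n; rewrite mul1r ger0_norm // powR_ge0.
Unshelve. all: by end_near. Qed.

Lemma polyO_id : polyO 1 N.
Proof.
exists 1 => //; have N0 := near_ge 0; near=> n.
by rewrite mul1r powRr1 ?ger0_norm //; near: n.
Unshelve. all: by end_near. Qed.

Lemma polyOM x y u v : polyO x u -> polyO y v -> polyO (x + y) (fun n => u n * v n).
Proof.
move=> [C C0 Hu] [D D0 Hv]; exists (C * D); first exact: mulr_ge0.
have N1 := near_ge 1; near=> n.
have Nn : 0 < N n by apply: lt_le_trans (_ : 1 <= _) => //; near: n.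
rewrite normrM powR_add // mulrACA ler_pM //; by near: n.
Unshelve. all: by end_near. Qed.

Lemma polyOD x u v : polyO x u -> polyO x v -> polyO x (fun n => u n + v n).
Proof.
move=> [C C0 Hu] [D D0 Hv]; exists (C + D); first exact: addr_ge0.
near=> n; rewrite (le_trans (ler_normD _ _)) // mulrDl lerD //; by near: n.
Unshelve. all: by end_near. Qed.

Lemma polyOX x u (k : nat) : polyO x u -> polyO (x * k%:R) (fun n => u n ^+ k).
Proof.
move=> [C C0 Hu]; exists (C ^+ k); first exact: exprn_ge0.
near=> n; rewrite normrX -powRX -exprMn lerXn2r ?nnegrE ?mulr_ge0 ?powR_ge0 //; by near: n.
Unshelve. all: by end_near. Qed.

(** A constant is absorbed by an arbitrarily small increase of the exponent. *)
Lemma polyO_small x y u (del : R) : x < y -> 0 < del -> polyO x u ->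
  \forall n \near \oo, `|u n| <= del * N n `^ y.
Proof.
move=> xy del0 [C C0 H]; have yx : 0 < y - x by rewrite subr_gt0.
pose A := Num.max 1 ((C / del) `^ (y - x)^-1).
have NA := near_ge A; near=> n.
have An : A <= N n by near: n.
have A1 : 1 <= A by rewrite le_max lexx.
have Nn : 0 < N n by rewrite (lt_le_trans _ An) // (lt_le_trans _ A1).
apply: le_trans (_ : _ <= C * N n `^ x) _; first by near: n.
have -> : y = (y - x) + x by rewrite subrK.
rewrite powR_add // mulrA ler_wpM2r ?powR_ge0 // mulrC -ler_pdivrMr //.
have Cd : 0 <= C / del by rewrite divr_ge0 // ltW.
have -> : C / del = ((C / del) `^ (y - x)^-1) `^ (y - x).
  by rewrite -powRrM mulVf ?gt_eqF // powRr1.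
apply: ge0_ler_powR; rewrite ?nnegrE ?powR_ge0 ?(ltW yx) ?(ltW Nn) //.
by rewrite (le_trans _ An) // le_max lexx orbT.
Unshelve. all: by end_near. Qed.

End PowerBounds.

(** * Events of probability tending to one *)

Section HighProbability.
Context {R : realType} {d : measure_display} {T : measurableType d} (P : probability T R).
Implicit Types Q : nat -> T -> Prop.

(** The exceptional event is covered by a measurable set, so that Q itself, for
    instance a statement about all vectors, need not define a measurable event. *)
Definition whp Q := forall del : R, 0 < del -> \forall n \near \oo,
  exists B : set T, [/\ measurable B, (P B <= del%:E)%E & forall w, ~ B w -> Q n w].

Lemma whp_and Q1 Q2 : whp Q1 -> whp Q2 -> whp (fun n w => Q1 n w /\ Q2 n w).
Proof.
move=> H1 H2 del del0; have del2 : 0 < del / 2 by rewrite divr_gt0.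
have H1' := H1 _ del2; have H2' := H2 _ del2.
near=> n.
have [B1 [mB1 PB1 h1]] : exists B : set T, [/\ measurable B, (P B <= (del / 2)%:E)%E & forall w, ~ B w -> Q1 n w].
  by near: n.
have [B2 [mB2 PB2 h2]] : exists B : set T, [/\ measurable B, (P B <= (del / 2)%:E)%E & forall w, ~ B w -> Q2 n w].
  by near: n.
exists (B1 `|` B2); split.
- exact: measurableU.
- apply: le_trans (measureU2 _ _ _) _ => //.
  by rewrite [del]splitr EFinD leeD.
by move=> w nB; split; [apply: h1|apply: h2] => Bw; apply: nB; [left|right].
Unshelve. all: by end_near. Qed.

Lemma whp_mono Q1 Q2 : (\forall n \near \oo, forall w, Q1 n w -> Q2 n w) -> whp Q1 -> whp Q2.
Proof.
move=> H12 H1 del del0; have H1' := H1 _ del0; near=> n.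
have [B1 [mB1 PB1 h1]] : exists B : set T, [/\ measurable B, (P B <= del%:E)%E & forall w, ~ B w -> Q1 n w].
  by near: n.
have h12 : forall w, Q1 n w -> Q2 n w by near: n.
by exists B1; split => // w nB; apply/h12/h1.
Unshelve. all: by end_near. Qed.

Lemma whp_markov (X : nat -> T -> R) (th : nat -> R) :
  (forall n, bounded_rv (X n)) -> (forall n w, 0 <= X n w) ->
  (forall del, 0 < del -> \forall n \near \oo, 0 < th n /\ Ex P (X n) <= del * th n) ->
  whp (fun n w => X n w < th n).
Proof.
move=> bX X0 H del del0; have Hd := H _ del0; near=> n.
have [t0 Et] : 0 < th n /\ Ex P (X n) <= del * th n by near: n.
exists [set w | (th n <= X n w)%R]; split.
- rewrite (_ : [set w | _] = X n @^-1` `[th n, +oo[).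
    by rewrite -[S in measurable S]setTI; exact: (bX n).1.
  by apply/seteqP; split => w /=; rewrite in_itv /= andbT.
- apply: (le_trans (markov_bounded P (bX n) (X0 n) t0)).
  by rewrite lee_fin ler_pdivrMr.
- by move=> w /= /negP; rewrite -ltNge.
Unshelve. all: by end_near. Qed.

Lemma whp_cvg0 (X : nat -> T -> R) :
  (forall n, measurable_fun setT (X n)) ->
  (forall eps, 0 < eps -> whp (fun n w => `|X n w| <= eps)) -> cvg_in_probability P X 0.
Proof.
move=> mX H eps eps0.
have mE n : measurable [set w | eps < `|X n w - 0|].
  rewrite (_ : [set w | _] = (fun w => `|X n w|) @^-1` `]eps, +oo[).
    rewrite -[S in measurable S]setTI; apply: (measurableT_comp (@normr_measurable R setT) (mX n)) => //.
  by apply/seteqP; split => w /=; rewrite in_itv /= andbT subr0.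
apply/fine_cvgP; split; first by near=> n; rewrite fin_num_measure.
apply/cvgrPdist_le => del del0; have H1 := H _ eps0 _ del0; near=> n.
have [B [mB PB hB]] : exists B : set T,
    [/\ measurable B, (P B <= del%:E)%E & forall w, ~ B w -> `|X n w| <= eps] by near: n.
rewrite sub0r normrN ger0_norm ?fine_ge0 //= -lee_fin fineK ?fin_num_measure //.
apply: le_trans PB; apply: le_measure; rewrite ?inE // => w /=.
by rewrite subr0 => Xw; apply: contrapT => /hB; rewrite leNgt Xw.
Unshelve. all: by end_near. Qed.
End HighProbability.

(** * The off-diagonal part under moment bounds *)

Section OffDiagonal.
Context {R : realType} {d : measure_display} {T : measurableType d} (P : probability T R).
Variables (r c : nat -> nat) (V : forall n, 'I_(r n) * 'I_(c n) -> T -> R) (V0 : T -> R).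
Hypotheses (mV : forall n e, measurable_fun setT (@V n e)) (mV0 : measurable_fun setT V0).
Hypothesis iidV : forall n, iid_family P (@V n) V0.
Local Notation Ex := (Ex P).
Local Notation E0 h := (Ex (fun w => h (V0 w))).
Local Notation N := (fun n => (r n * c n)%:R : R).
Hypothesis Noo : N n @[n --> \oo] --> +oo.
Local Notation "u ~O x" := (polyO N x u) (at level 70).

Lemma pow_gt0 (y : R) : \forall n \near \oo, 0 < N n `^ y.
Proof.
have N1 := near_ge Noo 1; near=> n; rewrite powR_gt0 // (@lt_le_trans _ _ 1) //; by near: n.
Unshelve. all: by end_near. Qed.

(** For cross terms the Hilbert-Schmidt norm is a sufficient bound of the operator
    norm; its mean is computed in [Ex_hs2_offdiag_le]. *)
Lemma whp_frobenius (f g : nat -> R -> R) (z y : R) :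
  (forall n, bounded_rv (f n)) -> (forall n, bounded_rv (g n)) -> z < y * 2 ->
  (fun n => (r n)%:R ^+ 2 * ((c n)%:R * (E0 (fun x => f n x ^+ 2) * E0 (fun x => g n x ^+ 2)) +
    (c n)%:R ^+ 2 * (E0 (f n) ^+ 2 * E0 (g n) ^+ 2))) ~O z ->
  whp P (fun n w => hs2 (offdiag (map_entries (@V n) (f n) w *m (map_entries (@V n) (g n) w)^T))
     < (N n `^ y) ^+ 2).
Proof.
move=> bf bg zy Oz; apply: whp_markov.
- move=> n; under eq_fun do rewrite hs2E; apply: bounded_rv_sum => i; apply: bounded_rv_sum => j.
  apply: bounded_rvX; under eq_fun do rewrite mxE.
  case: eqP => _; first exact: bounded_rv_cst.
  under eq_fun do rewrite mxE; apply: bounded_rv_sum => t.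
  by under eq_fun do rewrite !mxE; apply: bounded_rvM; exact: bounded_rv_comp.
- by move=> n w; exact: hs2_ge0.
move=> del del0; have H := polyO_small Noo zy del0 Oz; have p0 := pow_gt0 y.
near=> n; split; first by rewrite exprn_gt0 //; near: n.
apply: le_trans (Ex_hs2_offdiag_le (@mV n) mV0 (@iidV n) (bf n) (bg n)) _.
by rewrite powRX; apply: le_trans (ler_norm _) _; near: n.
Unshelve. all: by end_near. Qed.

Variables (fX : nat -> R -> R) (B : nat -> R).
Hypotheses (bX : forall n, bounded_rv (fX n)) (X_mean0 : forall n, E0 (fX n) = 0).
Hypothesis X_bound : forall n x, `|fX n x| <= B n.

Lemma sum_in_cols (r' c' : nat) (t : 'I_c') (F : 'I_r' * 'I_c' -> R) :
  \sum_(e in in_cols r' [set t]%SET) F e = \sum_i F (i, t).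
Proof.
rewrite big_mkcond /= (eq_bigr (fun e => if e.2 == t then F (e.1, e.2) else 0)); last first.
  by move=> [i s] _; rewrite !inE.
rewrite -(pair_bigA _ (fun i s => if s == t then F (i, s) else 0)) /=.
by apply: eq_bigr => i _; rewrite -big_mkcond big_pred1_eq.
Qed.

Lemma card_in_cols (r' c' : nat) (t : 'I_c') : #|in_cols r' [set t]%SET|%:R = r'%:R :> R.
Proof.
rewrite -sum1_card natr_sum (sum_in_cols t (fun=> 1)) sumr_const card_ord.
by [].
Qed.

(** The squared length of a column is a sum of independent bounded nonnegative
    variables. *)
Lemma col_len_moment n t k :
  Ex (fun w => col_len (@V n) (fX n) t w ^+ k) <=
  2 ^+ k * ((moment_cst k)%:R * ((r n)%:R * E0 (fun x => fX n x ^+ 2) + B n ^+ 2) ^+ k).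
Proof.
have bX2 : bounded_rv (fun x => fX n x ^+ 2) by exact: bounded_rvX.
have -> : (fun w => col_len (@V n) (fX n) t w ^+ k) = (fun w => 2 ^+ k *
   (\sum_(e in in_cols (r n) [set t]%SET) (fun x => fX n x ^+ 2) (@V n e w)) ^+ k).
  apply/funext => w; rewrite -exprMn; congr (_ ^+ k); rewrite /col_len; congr (_ * _).
  by rewrite (sum_in_cols t (fun e => fX n (@V n e w) ^+ 2)).
rewrite ExZ; last by apply: bounded_rvX; apply: bounded_rv_sum => e; exact: (bounded_rv_comp (@mV n e) bX2).
rewrite ler_wpM2l ?exprn_ge0 //.
rewrite -(card_in_cols (r n) t).
apply: (sum_moment_le (@mV n) mV0 (@iidV n) k _ bX2) => // x.
rewrite sqr_ge0 /= -real_normK ?num_real // lerXn2r ?nnegrE ?normr_ge0 //.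
by rewrite (le_trans _ (X_bound n x)).
Qed.

(** Markov's inequality for the trace of the power 2q.  The factor r between trace
    and operator norm is harmless for q large, since the conditions on y are
    strict; the length scale L of a column is a power of N slightly larger than
    its typical squared length. *)
Lemma whp_rosenthal (rho e xi y : R) : 0 <= rho -> 0 <= e -> 0 <= xi ->
  rho + e < y -> xi * 2 < y -> 1 + e * 2 < y * 2 ->
  (fun n => (r n)%:R) ~O rho -> (fun n => E0 (fun x => fX n x ^+ 2)) ~O e -> B ~O xi ->
  exists2 q, (0 < q)%N &
  whp P (fun n w => \tr (col_sum (@V n) (fX n) [set: 'I_(c n)]%SET w ^+ q.*2) < (N n `^ y) ^+ q.*2).
Proof.
move=> rho0 e0 xi0 h1 h2 h3 Or Oe OB.
pose lam0 := Num.max (rho + e) (xi * 2).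
(* The column length is of order N^lam0; lam leaves room above it for the high
   moments in col_len_moment, above the exponent 1/2 + e of the second order
   part, and below y for the factor r of the trace. *)
pose lam := (Num.max lam0 (1 / 2 + e) + y) / 2.
have lam0y : lam0 < y by rewrite gt_max h1 h2.
have lam0lam : lam0 < lam.
  by rewrite /lam; have : lam0 <= Num.max lam0 (1 / 2 + e); [rewrite le_max lexx|lra].
have elam : 1 + e * 2 < lam * 2.
  rewrite /lam; have : 1 / 2 + e <= Num.max lam0 (1 / 2 + e); [rewrite le_max lexx orbT //|lra].
have lamy : lam < y.
  by rewrite /lam; have : Num.max lam0 (1 / 2 + e) < y; [rewrite gt_max lam0y /=|]; lra.
have lam00 : 0 <= lam0 by rewrite le_max addr_ge0.
pose q := (Num.bound (rho / ((y - lam) * 2))).+1.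
pose m := (Num.bound (2 * lam0 / (lam - lam0))).
have mb : 2 * lam0 < (lam - lam0) * m%:R.
  rewrite [X in _ < X]mulrC -ltr_pdivrMr ?subr_gt0 //; apply: archi_boundP.
  by rewrite divr_ge0 ?mulr_ge0 // subr_ge0 ltW.
have qb : rho < (y - lam) * 2 * q%:R.
  have yl : 0 < (y - lam) * 2 by rewrite mulr_gt0 // subr_gt0.
  rewrite mulrC -ltr_pdivrMr //; apply: lt_le_trans (archi_boundP _) _.
    by rewrite divr_ge0 // ltW.
  by rewrite /q ler_nat.
exists q => //.
pose D n := (r n)%:R * E0 (fun x => fX n x ^+ 2) + B n ^+ 2.
have OD : D ~O lam0.
  apply: polyOD; first by apply: polyO_le (polyOM Noo Or Oe) => //; rewrite le_max lexx.
  by apply: polyO_le (polyOX 2 OB) => //; rewrite le_max lexx orbT.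
have mom : \forall n \near \oo, forall j, (j < q)%N -> forall t,
    Ex (fun w => col_len (@V n) (fX n) t w ^+ (j.*2 + m + 2)) <= (N n `^ lam) ^+ (j.*2 + m) * 1.
  apply: near_all_lt => j jq; set k := (j.*2 + m + 2)%N.
  have Ok : (fun n => 2 ^+ k * ((moment_cst k)%:R * D n ^+ k)) ~O (0 + (0 + lam0 * k%:R)).
    apply: (polyOM Noo); first exact: polyO_cst.
    by apply: (polyOM Noo); [exact: polyO_cst|exact: polyOX].
  have klam : 0 + (0 + lam0 * k%:R) < lam * (j.*2 + m)%:R.
    rewrite !add0r /k natrD natrD mulrDr [lam * _]mulrDr.
    have : lam0 * j.*2%:R <= lam * j.*2%:R by rewrite ler_wpM2r // ltW.
    by rewrite mulrBl in mb; lra.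
  have H := polyO_small Noo klam ltr01 Ok.
  near=> n => t; apply: le_trans (col_len_moment t k) _.
  by rewrite mulr1 powRX -[X in _ <= X]mul1r; apply: le_trans (ler_norm _) _; near: n.
apply: whp_markov.
- move=> n; have ms : mspan (@V n) [set: 'I_(c n)]%SET (col_sum (@V n) (fX n) [set: 'I_(c n)]%SET).
    by apply: mspan_sum.
  exact: (pspan_bounded (@mV n) (mspan_tr (mspanX _ ms))).
- move=> n w; rewrite -addnn exprD -[X in _ * X]trmx_exp; last exact: col_sum_sym.
  exact: hs2_ge0.
move=> del del0; have p0 := pow_gt0 y; have pl0 := pow_gt0 lam.
have Olam : (fun n => (c n)%:R * ((r n)%:R * E0 (fun x => fX n x ^+ 2) ^+ 2 + 1)) ~O (1 + e * 2).
  have -> : (fun n => (c n)%:R * ((r n)%:R * E0 (fun x => fX n x ^+ 2) ^+ 2 + 1)) =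
     (fun n => N n * E0 (fun x => fX n x ^+ 2) ^+ 2 + (c n)%:R * 1).
    by apply/funext => n; rewrite natrM; ring.
  apply: polyOD; first by apply: (polyOM Noo); [exact: polyO_id|exact: polyOX].
  apply: (polyO_le Noo (_ : 1 <= _)); first by rewrite lerDl mulr_ge0.
  have N1 := near_ge Noo 1; apply: polyO_bound (polyO_id Noo) _; near=> n.
  have : 1 <= N n by near: n.
  rewrite mulr1 !ger0_norm // ler_nat ler1n muln_gt0 => /andP[r0 c0].
  by rewrite leq_pmull.
have Hl := polyO_small Noo elam ltr01 Olam.
have OC : (fun n => (rosenthal_cst q)%:R * (r n)%:R * (N n `^ (lam * 2)) ^+ q) ~O (0 + rho + lam * 2 * q%:R).
  apply: (polyOM Noo); last by apply: polyOX; exact: polyO_pow.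
  by apply: (polyOM Noo) => //; exact: polyO_cst.
have Cy : 0 + rho + lam * 2 * q%:R < y * q.*2%:R.
  by rewrite add0r -muln2 natrM; move: qb; lra.
have HC := polyO_small Noo Cy del0 OC.
near=> n; split; first by rewrite exprn_gt0 //; near: n.
have L0 : 0 < N n `^ lam by near: n.
have hmom : forall j, (j < q)%N -> forall t,
    Ex (fun w => col_len (@V n) (fX n) t w ^+ (j.*2 + m + 2)) <= (N n `^ lam) ^+ (j.*2 + m) * 1.
  by near: n.
have hl : (c n)%:R * ((r n)%:R * E0 (fun x => fX n x ^+ 2) ^+ 2 + 1) <= N n `^ (lam * 2).
  by rewrite -[X in _ <= X]mul1r; apply: le_trans (ler_norm _) _; near: n.
have LL : (N n `^ lam) ^+ 2 <= N n `^ (lam * 2) by rewrite powRX.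
apply: le_trans (matrix_rosenthal (@mV n) mV0 (@iidV n) (bX n) (X_mean0 n) L0 ler01
   (fun t j jq => hmom j jq t) LL hl _ (leqnn q)) _.
by rewrite (powRX _ y); apply: le_trans (ler_norm _) _; near: n.
Unshelve. all: by end_near. Qed.

End OffDiagonal.

Section OffDiagonalNorm.
Context {R : realType} {d : measure_display} {T : measurableType d} (P : probability T R).
Variables (r c : nat -> nat) (V : forall n, 'I_(r n) * 'I_(c n) -> T -> R) (V0 : T -> R).
Hypotheses (mV : forall n e, measurable_fun setT (@V n e)) (mV0 : measurable_fun setT V0).
Hypothesis iidV : forall n, iid_family P (@V n) V0.
Local Notation Ex := (Ex P).
Local Notation E0 h := (Ex (fun w => h (V0 w))).
Local Notation N := (fun n => (r n * c n)%:R : R).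
Hypothesis Noo : N n @[n --> \oo] --> +oo.
Local Notation "u ~O x" := (polyO N x u) (at level 70).

Lemma offdiagD (n : nat) (A B : 'M[R]_n) : offdiag (A + B) = offdiag A + offdiag B.
Proof. by apply/matrixP => i j; rewrite !mxE; case: eqP => _ //; rewrite addr0. Qed.

Lemma offdiag_gram (n k : nat) (U : 'I_n * 'I_k -> T -> R) (f : R -> R) w :
  offdiag (map_entries U f w *m (map_entries U f w)^T) = col_sum U f [set: 'I_k]%SET w.
Proof.
apply/matrixP => i j; rewrite /col_sum summxE.
rewrite (eq_bigl xpredT) => [|t]; last by rewrite inE.
rewrite !mxE; case: eqP => [->|/eqP ij].
  by rewrite big1 // => t _; rewrite col_mx_offE eqxx.
by apply: eq_bigr => t _; rewrite col_mx_offE (negbTE ij) !mxE.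
Qed.

Lemma qformD (n : nat) (A B : 'M[R]_n) (a b : R) (x : 'rV[R]_n) :
  `|(x *m A *m x^T) 0 0| <= a * (x *m x^T) 0 0 ->
  `|(x *m B *m x^T) 0 0| <= b * (x *m x^T) 0 0 ->
  `|(x *m (A + B) *m x^T) 0 0| <= (a + b) * (x *m x^T) 0 0.
Proof.
move=> hA hB; rewrite mulmxDr mulmxDl [X in `|X|]mxE mulrDl.
by rewrite (le_trans (ler_normD _ _)) // lerD.
Qed.

(** The entries are split as V = X + W with X centered and bounded, W rare or small.
    The off-diagonal part of X X' is a sum of independent centered matrices and
    is treated by [whp_rosenthal]; the three products that involve W are treated
    by their Hilbert-Schmidt norm.  The exponents are kept symbolic, because two
    different splittings are used later. *)
Theorem whp_offdiag (fX fW : nat -> R -> R) (B : nat -> R) (rho e xi o1 o2 y : R) :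
  (forall n, bounded_rv (fX n)) -> (forall n, E0 (fX n) = 0) ->
  (forall n x, `|fX n x| <= B n) -> (forall n, bounded_rv (fW n)) ->
  whp P (fun n w => forall it, @V n it w = fX n (@V n it w) + fW n (@V n it w)) ->
  (fun n => (r n)%:R) ~O rho -> (fun n => E0 (fun x => fX n x ^+ 2)) ~O e -> B ~O xi ->
  (fun n => E0 (fun x => fW n x ^+ 2)) ~O o2 -> (fun n => E0 (fW n)) ~O o1 ->
  0 <= rho -> 0 <= e -> 0 <= xi ->
  rho + e < y -> xi * 2 < y -> 1 + e * 2 < y * 2 ->
  rho + 1 + (e + o2) < y * 2 -> rho + 1 + o2 * 2 < y * 2 -> 2 + o1 * 4 < y * 2 ->
  whp P (fun n w => forall x : 'rV[R]_(r n),
    `|(x *m offdiag (sample_cov (\matrix_(i, t) @V n (i, t) w)) *m x^T) 0 0| <=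
      4 * N n `^ y * (x *m x^T) 0 0).
Proof.
move=> bX X0 XB bW dec Or Oe OB O2 O1 rho0 e0 xi0 h1 h2 h3 h4 h5 h6.
have [q q0 Hq] := whp_rosenthal mV mV0 iidV Noo bX X0 XB rho0 e0 xi0 h1 h2 h3 Or Oe OB.
have frob (f g : nat -> R -> R) (of2 og2 z1 z2 : R) : (fun n => E0 (fun x => f n x ^+ 2)) ~O of2 ->
    (fun n => E0 (fun x => g n x ^+ 2)) ~O og2 ->
    (fun n => N n ^+ 2 * (E0 (f n) ^+ 2 * E0 (g n) ^+ 2)) ~O z2 ->
    rho + 1 + (of2 + og2) <= z1 -> z2 <= z1 ->
  (fun n => (r n)%:R ^+ 2 * ((c n)%:R * (E0 (fun x => f n x ^+ 2) * E0 (fun x => g n x ^+ 2)) +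
    (c n)%:R ^+ 2 * (E0 (f n) ^+ 2 * E0 (g n) ^+ 2))) ~O z1.
  move=> Of Og Oz z1le z21.
  have -> : (fun n => (r n)%:R ^+ 2 * ((c n)%:R * (E0 (fun x => f n x ^+ 2) * E0 (fun x => g n x ^+ 2)) +
    (c n)%:R ^+ 2 * (E0 (f n) ^+ 2 * E0 (g n) ^+ 2))) =
    (fun n => (r n)%:R * N n * (E0 (fun x => f n x ^+ 2) * E0 (fun x => g n x ^+ 2)) +
       N n ^+ 2 * (E0 (f n) ^+ 2 * E0 (g n) ^+ 2)).
    by apply/funext => n; rewrite natrM; ring.
  apply: polyOD; last exact: polyO_le Oz.
  apply: polyO_le z1le _ => //; apply: (polyOM Noo); last exact: polyOM.
  by apply: (polyOM Noo) => //; exact: polyO_id.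
have zero (f g : nat -> R -> R) (z : R) : (forall n, E0 (f n) ^+ 2 * E0 (g n) ^+ 2 = 0) ->
    (fun n => N n ^+ 2 * (E0 (f n) ^+ 2 * E0 (g n) ^+ 2)) ~O z.
  move=> fg0; exists 0 => //; near=> n.
  by rewrite fg0 mulr0 normr0 mul0r.
have XW0 n : E0 (fX n) ^+ 2 * E0 (fW n) ^+ 2 = 0 by rewrite X0 expr0n mul0r.
have WX0 n : E0 (fW n) ^+ 2 * E0 (fX n) ^+ 2 = 0 by rewrite mulrC XW0.
have o2e : rho + 1 + (o2 + e) <= rho + 1 + (e + o2) by rewrite (addrC o2 e).
have XW := whp_frobenius mV mV0 iidV Noo bX bW h4
  (frob fX fW e o2 _ (rho + 1 + (e + o2)) Oe O2 (zero _ _ _ XW0) (lexx _) (lexx _)).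
have WX := whp_frobenius mV mV0 iidV Noo bW bX h4
  (frob fW fX o2 e (rho + 1 + (e + o2)) (rho + 1 + (e + o2)) O2 Oe (zero _ _ _ WX0) o2e (lexx _)).
pose z := Num.max (rho + 1 + (o2 + o2)) (2 + o1 * 4).
have zy : z < y * 2 by rewrite gt_max h6 andbT; lra.
have zl : rho + 1 + (o2 + o2) <= z by rewrite le_max lexx.
have zr : 2 + o1 * 4 <= z by rewrite le_max lexx orbT.
have O14 : (fun n => N n ^+ 2 * (E0 (fW n) ^+ 2 * E0 (fW n) ^+ 2)) ~O (2 + o1 * 4).
  have -> : 2 + o1 * 4 = 1 * 2%:R + (o1 * 2%:R + o1 * 2%:R) by rewrite mul1r -mulrDr -natrD.
  apply: (polyOM Noo); first by apply: polyOX; exact: polyO_id.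
  by apply: (polyOM Noo); exact: polyOX.
have WW := whp_frobenius mV mV0 iidV Noo bW bW zy
  (frob fW fW o2 o2 z (2 + o1 * 4) O2 O2 O14 zl zr).
apply: whp_mono (whp_and (whp_and dec Hq) (whp_and XW (whp_and WX WW))).
near=> n => w [[wdec wtr] [wXW [wWX wWW]]] x.
set b := N n `^ y; have b0 : 0 <= b by exact: powR_ge0.
set X := map_entries (@V n) (fX n) w in wXW wWX *; set W := map_entries (@V n) (fW n) w in wXW wWX wWW *.
have -> : offdiag (sample_cov (\matrix_(i, t) @V n (i, t) w)) =
  col_sum (@V n) (fX n) [set: 'I_(c n)]%SET w + offdiag (X *m W^T) +
  (offdiag (W *m X^T) + offdiag (W *m W^T)).
  rewrite -offdiag_gram -!offdiagD; congr offdiag.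
  have -> : \matrix_(i, t) @V n (i, t) w = X + W.
    by apply/matrixP => i t; rewrite !mxE -wdec.
  by rewrite /sample_cov raddfD /= mulmxDl !mulmxDr.
have -> : 4 * b = b + b + (b + b) by ring.
have fr F : hs2 F < b ^+ 2 -> `|(x *m F *m x^T) 0 0| <= b * (x *m x^T) 0 0.
  by move=> /ltW hF; exact: qform_le_hs2.
apply: qformD; apply: qformD; try exact: fr.
by apply: (qform_le_trace (q := q)) => //; [exact: col_sum_sym | exact: ltW].
Unshelve. all: by end_near. Qed.

End OffDiagonalNorm.

(** * Regularly varying tails *)

Lemma cvg_pinfty_eq {R : realType} (f g : R -> R) (l : R) :
  (\forall x \near +oo, f x = g x) -> f x @[x --> +oo] --> l -> g x @[x --> +oo] --> l.
Proof.
move=> fg; have FF : Filter (pinfty_nbhs R) by exact: _.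
exact: cvg_trans (@near_eq_cvg _ _ _ FF _ _ fg).
Qed.

Section Tail.
Context {R : realType} {d : measure_display} {T : measurableType d} (P : probability T R).
Variables (Z : T -> R).
Hypothesis mZ : measurable_fun setT Z.
Local Notation Ex := (Ex P).

Definition tailP (x : R) : R := fine (P [set w | x < `|Z w|]).

Lemma measurable_gt (X : T -> R) (x : R) : measurable_fun setT X -> measurable [set w | x < X w].
Proof.
move=> mX; rewrite (_ : [set w | _] = X @^-1` `]x, +oo[).
  by rewrite -[S in measurable S]setTI; exact: mX.
by apply/seteqP; split => w /=; rewrite in_itv /= andbT.
Qed.

Lemma measurable_normZ : measurable_fun setT (fun w => `|Z w|).
Proof. exact: measurableT_comp (@normr_measurable R setT) mZ. Qed.

Lemma tailP_ge0 x : 0 <= tailP x. Proof. by rewrite /tailP fine_ge0. Qed.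

Lemma tailP_le1 x : tailP x <= 1.
Proof.
rewrite /tailP -lee_fin fineK ?fin_num_measure ?probability_le1 //.
  by apply: measurable_gt; exact: measurable_normZ.
by apply: measurable_gt; exact: measurable_normZ.
Qed.

Lemma tailP_anti x y : x <= y -> tailP y <= tailP x.
Proof.
move=> xy; have m z : measurable [set w | z < `|Z w|] by apply: measurable_gt; exact: measurable_normZ.
rewrite /tailP fine_le ?fin_num_measure // le_measure ?inE // => w /=.
exact: le_lt_trans.
Qed.

Variables (alpha pplus pminus : R) (L : R -> R).
Hypotheses (pp : pplus + pminus = 1) (L_sv : slowly_varying L)
    (right_tail : fine (P [set w | x < Z w]) / (L x * x `^ (- alpha)) @[x --> +oo] --> pplus)
    (left_tail : fine (P [set w | Z w < - x]) / (L x * x `^ (- alpha)) @[x --> +oo] --> pminus).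

Lemma tailP_split x : 0 <= x ->
  tailP x = fine (P [set w | x < Z w]) + fine (P [set w | Z w < - x]).
Proof.
move=> x0; have m1 := measurable_gt x mZ.
have m2 : measurable [set w | Z w < - x].
  rewrite (_ : [set w | _] = [set w | x < - Z w]).
    by apply: measurable_gt; exact: measurable_funN.
  by apply/seteqP; split => w /=; rewrite ltrNr.
rewrite -fineD ?fin_num_measure // -measureU //.
  congr (fine (P _)); apply/seteqP; split => w /=.
    rewrite ltr_normr => /orP[h|h]; [by left|by right; rewrite ltrNr].
  by rewrite ltr_normr; case=> [->//|h]; rewrite ltrNr h orbT.
apply/seteqP; split => w //= [h1 h2].
have : - x <= x by rewrite (le_trans _ x0) // oppr_le0.
by rewrite leNgt (lt_trans h1 h2).
Qed.

Lemma tailP_equiv : tailP x / (L x * x `^ (- alpha)) @[x --> +oo] --> (1 : R).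
Proof.
have FF : Filter (pinfty_nbhs R) by exact: _.
have := @cvgD _ _ _ _ FF _ _ _ _ right_tail left_tail; rewrite pp; apply: cvg_pinfty_eq.
near=> x; have x0 : 0 <= x by near: x; apply: nbhs_pinfty_ge; exact: num_real.
by rewrite -mulrDl -tailP_split.
Unshelve. all: by end_near. Qed.

Lemma cvg_mul2_pinfty : (fun x : R => 2 * x) x @[x --> +oo] --> +oo.
Proof.
apply/cvgryPge => A; near=> x; have : A / 2 <= x by near: x; apply: nbhs_pinfty_ge; exact: num_real.
by rewrite ler_pdivrMr // mulrC.
Unshelve. all: by end_near. Qed.

Lemma near_normalizer_gt0 : \forall x \near +oo, 0 < L x * x `^ (- alpha).
Proof.
have [[x0 [_ L0]] _] := L_sv; near=> x.
have xx0 : x0 <= x by near: x; apply: nbhs_pinfty_ge; exact: num_real.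
have x_gt0 : 0 < x by near: x; apply: nbhs_pinfty_gt; exact: num_real.
by rewrite mulr_gt0 ?powR_gt0 ?L0.
Unshelve. all: by end_near. Qed.

Lemma near_tailP_gt0 : \forall x \near +oo, 0 < tailP x.
Proof.
have h : \forall x \near +oo, 1 / 2 < tailP x / (L x * x `^ (- alpha)).
  have /cvgrPdist_lt/(_ (1 / 2)) := tailP_equiv; rewrite divr_gt0 // => /(_ isT) H.
  near=> x; have : `|1 - tailP x / (L x * x `^ (- alpha))| < 1 / 2 by near: x.
  by rewrite ltr_distlC => /andP[h _]; apply: le_lt_trans h; lra.
have u0 := near_normalizer_gt0; near=> x.
have hx : 1 / 2 < tailP x / (L x * x `^ (- alpha)) by near: x.
have ux : 0 < L x * x `^ (- alpha) by near: x.
move: hx; rewrite ltr_pdivlMr //; apply: lt_trans; rewrite mulr_gt0 //.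
Unshelve. all: by end_near. Qed.

Lemma tailP_gt0 x : 0 < tailP x.
Proof.
have [A [_ hA]] := near_tailP_gt0.
have [y [xy Ay]] : exists y, x <= y /\ A < y.
  by exists (Num.max x (A + 1)); rewrite le_max lexx; split => //; rewrite lt_max ltrDl ltr01 orbT.
exact: lt_le_trans (hA y Ay) (tailP_anti xy).
Qed.

(** Divided by L(x) x^(-alpha), the one-sided tails converge and the limits add up
    to 1.  Of regular variation only the ratio along x, 2x is used from here on: the tail is monotone, and dyadic points suffice. *)
Lemma tailP_ratio : tailP (2 * x) / tailP x @[x --> +oo] --> 2 `^ (- alpha).
Proof.
pose u x := L x * x `^ (- alpha).
have h1 : tailP (2 * x) / u (2 * x) @[x --> +oo] --> (1 : R).
  by apply: (cvg_comp _ _ cvg_mul2_pinfty tailP_equiv).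
have h2 : L (2 * x) / L x * 2 `^ (- alpha) @[x --> +oo] --> 1 * 2 `^ (- alpha).
  by apply: cvgMl; exact: L_sv.2.
have h3 : (tailP x / u x)^-1 @[x --> +oo] --> (1 : R)^-1.
  by apply: cvgV => //; exact: tailP_equiv.
have FF : Filter (pinfty_nbhs R) by exact: _.
have := @cvgM _ _ _ FF _ _ _ _ (@cvgM _ _ _ FF _ _ _ _ h1 h2) h3.
rewrite invr1 mulr1 !mul1r; apply: cvg_pinfty_eq.
have u0 := near_normalizer_gt0; have [[x0 [_ L0]] _] := L_sv; near=> x.
have x1 : 0 < x by near: x; apply: nbhs_pinfty_gt; exact: num_real.
have xx0 : x0 <= x by near: x; apply: nbhs_pinfty_ge; exact: num_real.
have ux : 0 < u x by near: x.
have Lx : 0 < L x by apply: L0.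
have L2x : 0 < L (2 * x) by apply: L0; rewrite (le_trans xx0) // ler_peMl ?ler1n // ltW.
have tx := tailP_gt0 x.
rewrite /= /u powRM ?(ltW x1) //.
have p2 : 0 < 2 `^ (- alpha) by rewrite powR_gt0.
have px : 0 < x `^ (- alpha) by rewrite powR_gt0.
by field; rewrite !gt_eqF.
Unshelve. all: by end_near. Qed.

End Tail.

Section TailBounds.
Context {R : realType} {d : measure_display} {T : measurableType d} (P : probability T R).
Variables (Z : T -> R) (alpha : R).
Hypotheses (mZ : measurable_fun setT Z) (alpha0 : 0 < alpha).
Hypothesis G_gt0 : forall x, 0 < tailP P Z x.
Hypothesis G_ratio : tailP P Z (2 * x) / tailP P Z x @[x --> +oo] --> 2 `^ (- alpha).
Local Notation Ex := (Ex P).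
Local Notation G := (tailP P Z).

Lemma pow2_lt (x y : R) : x < y -> 2 `^ x < 2 `^ y :> R.
Proof. by move=> xy; rewrite /powR (gt_eqF (ltr0Sn _ 1)) ltr_expR ltr_pM2r // ln_gt0 // ltr1n. Qed.

(** Slightly smaller and larger exponents absorb the error of the limit. *)
Lemma ratio_bounds s t : s < alpha -> alpha < t -> exists2 x0, 0 < x0 &
  forall x, x0 <= x -> 2 `^ (- t) * G x <= G (2 * x) <= 2 `^ (- s) * G x.
Proof.
move=> sa at_.
have e1 : 0 < 2 `^ (- s) - 2 `^ (- alpha) :> R by rewrite subr_gt0 pow2_lt // ltrN2.
have e2 : 0 < 2 `^ (- alpha) - 2 `^ (- t) :> R by rewrite subr_gt0 pow2_lt // ltrN2.
have e0 : 0 < Num.min (2 `^ (- s) - 2 `^ (- alpha)) (2 `^ (- alpha) - 2 `^ (- t)) :> R.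
  by rewrite lt_min e1.
have /cvgrPdist_lt/(_ _ e0) := G_ratio => -[A [_ hA]].
exists (Num.max 1 (A + 1)); first by rewrite lt_max ltr01.
move=> x; rewrite ge_max => /andP[x1 Ax]; have Ax' : A < x by rewrite (lt_le_trans _ Ax) // ltrDl.
have /= := hA x Ax'; rewrite lt_min !ltr_distlC => /andP[/andP[_ h1] /andP[h2 _]].
apply/andP; split; [rewrite -ler_pdivlMr //|rewrite -ler_pdivrMr //]; apply: ltW; lra.
Qed.

(** Iterating the ratio bound along x0, 2 x0, 4 x0, and so on loses no factor when the
    exponent s is below alpha. *)
Lemma tail_le s : 0 < s < alpha -> exists2 M, 0 <= M & forall x, 0 < x -> G x <= M * x `^ (- s).
Proof.
move=> /andP[s0 sa]; have at_ : alpha < alpha + 1 by rewrite ltrDl.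
have [x0 x00 H] := ratio_bounds sa at_.
exists ((2 * x0) `^ s); first exact: powR_ge0.
have xx0 : 0 < 2 * x0 by rewrite mulr_gt0.
have base x : 0 < x -> x <= 2 * x0 -> G x <= (2 * x0) `^ s * x `^ (- s).
  move=> xp xle; apply: le_trans (tailP_le1 P mZ x) _.
  rewrite powRN ler_pdivlMr ?powR_gt0 // mul1r; apply: ge0_ler_powR => //; rewrite ?nnegrE ?ltW //.
suff main (k : nat) x : 0 < x -> x <= 2 ^+ k * (2 * x0) -> G x <= (2 * x0) `^ s * x `^ (- s).
  move=> x xp; apply: (main (Num.bound (x / (2 * x0)))) => //.
  rewrite -ler_pdivrMr //; apply: ltW; apply: lt_le_trans (archi_boundP _) _.
    by rewrite divr_ge0 ?ltW.
  by rewrite -natrX ler_nat ltnW // ltn_expl.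
elim: k x => [|k IH] x xp; first by rewrite expr0 mul1r; exact: base.
have [xle _|xgt xk] := leP x (2 * x0); first exact: base.
have x2 : 0 < x / 2 by rewrite divr_gt0.
have xE : x = 2 * (x / 2) by rewrite mulrC divfK.
have xx2 : x0 <= x / 2 by rewrite ler_pdivlMr // mulrC ltW.
have /andP[_ h] := H _ xx2; rewrite {1}xE (le_trans h) //.
apply: (le_trans (y := 2 `^ (- s) * ((2 * x0) `^ s * (x / 2) `^ (- s)))).
  rewrite ler_wpM2l ?powR_ge0 //; apply: IH => //.
  by move: xk; rewrite exprS; lra.
by rewrite mulrCA ler_wpM2l ?powR_ge0 // -powRM ?(ltW x2) // -xE.
Qed.

Definition trunc_pow (s K x : R) : R := `|x| `^ s * \1_[set x : R | `|x| <= K] x.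

Lemma trunc_powE s K x : trunc_pow s K x = if `|x| <= K then `|x| `^ s else 0.
Proof.
rewrite /trunc_pow indicE; case: ifP => h; first by rewrite mem_set // mulr1.
by rewrite memNset ?mulr0 //= h.
Qed.

Lemma measurable_normle (K : R) : measurable [set x : R | `|x| <= K].
Proof.
rewrite (_ : [set x : R | `|x| <= K] = `[- K, K]) //.
by apply/seteqP; split => x /=; rewrite in_itv /= ler_norml.
Qed.

Lemma bounded_trunc_pow s K : 0 <= s -> bounded_rv (trunc_pow s K).
Proof.
move=> s0; split.
  apply: measurable_funM; last exact: measurable_indic (measurable_normle K).
  by apply: (measurableT_comp (measurable_powR s)); exact: normr_measurable.
exists (`|K| `^ s) => x; rewrite trunc_powE; case: ifP => h; last by rewrite normr0 powR_ge0.
rewrite ger0_norm ?powR_ge0 //; apply: ge0_ler_powR => //; rewrite ?nnegrE //.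
by rewrite (le_trans h) // ler_norm.
Qed.

Lemma Ex_tail (x : R) : Ex (fun w => \1_[set w | x < `|Z w|] w) = G x.
Proof.
rewrite /tailP -Ex_indic //.
exact: (measurable_gt _ (measurable_normZ mZ)).
Qed.

(** Sum the tail bound over dyadic shells, a geometric series of ratio 2^(s - s')
    with s < s' < alpha.  Uniformity in K replaces integrability. *)
Lemma moment_le s : 0 < s < alpha -> exists2 M, 0 <= M &
  forall K, Ex (fun w => trunc_pow s K (Z w)) <= M.
Proof.
move=> /andP[s0 sa]; pose s' := (s + alpha) / 2.
have ss' : s < s' by rewrite /s'; lra.
have s'a : s' < alpha by rewrite /s'; lra.
have [M M0 HM] := tail_le (introT andP (conj (lt_trans s0 ss') s'a)).
(* The contribution of the shell 2^m < |Z| <= 2^(m + 1) is of order rho^m. *)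
pose rho : R := 2 `^ (s - s').
have rho0 : 0 < rho by rewrite powR_gt0.
have rho1 : rho < 1 by rewrite -(powRr0 2); apply: pow2_lt; rewrite subr_lt0.
have b K := bounded_rv_comp mZ (bounded_trunc_pow K (ltW s0)).
pose C := 2 `^ s * M / (1 - rho).
have C0 : 0 <= C by rewrite divr_ge0 ?mulr_ge0 ?powR_ge0 // subr_ge0 ltW.
have step m : Ex (fun w => trunc_pow s (2 ^+ m) (Z w)) <= 1 + C * (1 - rho ^+ m).
  elim: m => [|m IH].
    rewrite !expr0 subrr mulr0 addr0; apply: (le_trans (y := Ex (fun=> 1))); last by rewrite Ex_cst.
    apply: Ex_le => //; first exact: bounded_rv_cst.
    move=> w; rewrite trunc_powE; case: ifP => // h.
    have p1 : 1 `^ s = 1 :> R by rewrite powR1.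
    by rewrite -[X in _ <= X]p1; apply: ge0_ler_powR => //; rewrite ?nnegrE // ltW.
  have bi : bounded_rv (fun w => (2 ^+ m.+1) `^ s * \1_[set w | 2 ^+ m < `|Z w|] w : R).
    apply: bounded_rvZ; apply: bounded_rv_indic.
    exact: (measurable_gt _ (measurable_normZ mZ)).
  apply: (le_trans (y := Ex (fun w => trunc_pow s (2 ^+ m) (Z w) +
      (2 ^+ m.+1) `^ s * \1_[set w | 2 ^+ m < `|Z w|] w))).
    apply: Ex_le => //; first exact: bounded_rvD.
    move=> w; rewrite !trunc_powE indicE.
    have [h1|h1] := leP `|Z w| (2 ^+ m).
      have h0 : 0 <= (2 ^+ m.+1) `^ s * (w \in [set w0 | 2 ^+ m < `|Z w0|])%:R.
        by rewrite mulr_ge0 ?powR_ge0.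
      by case: ifP => _; rewrite ?lerDl // addr_ge0 // powR_ge0.
    rewrite add0r mem_set //= mulr1; case: ifP => [h2|]; last by rewrite powR_ge0.
    by apply: ge0_ler_powR => //; rewrite ?nnegrE ?exprn_ge0 // ltW.
  rewrite ExD // ExZ; last first.
    apply: bounded_rv_indic.
    exact: (measurable_gt _ (measurable_normZ mZ)).
  rewrite Ex_tail.
  have gm : 0 < 2 ^+ m :> R by rewrite exprn_gt0.
  have h : (2 ^+ m.+1) `^ s * G (2 ^+ m) <= 2 `^ s * M * rho ^+ m.
    apply: (le_trans (y := (2 ^+ m.+1) `^ s * (M * (2 ^+ m) `^ (- s')))).
      by rewrite ler_wpM2l ?powR_ge0 // HM.
    have E x : (2 ^+ m) `^ x = (2 `^ x) ^+ m :> R by rewrite powRX -powR_mulrn // -powRrM mulrC.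
    rewrite exprS powRM ?exprn_ge0 // !E /rho powR_add // exprMn.
    rewrite le_eqVlt; apply/orP; left; apply/eqP; ring.
  apply: (le_trans (lerD IH h)).
  rewrite -addrA lerD2l exprS.
  have -> : 2 `^ s * M = C * (1 - rho) by rewrite /C divfK // subr_eq0 eq_sym lt_eqF.
  rewrite le_eqVlt; apply/orP; left; apply/eqP; ring.
exists (1 + C); first by rewrite addr_ge0.
move=> K; have [m Km] : exists m : nat, K <= 2 ^+ m.
  exists (Num.bound `|K|); apply: (le_trans (ler_norm _)); apply: ltW.
  apply: lt_le_trans (archi_boundP _) _ => //; by rewrite -natrX ler_nat ltnW // ltn_expl.
apply: (le_trans (y := Ex (fun w => trunc_pow s (2 ^+ m) (Z w)))).
  apply: Ex_le => // w; rewrite !trunc_powE; case: ifP => h.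
    by rewrite (le_trans h Km).
  by case: ifP => //; rewrite powR_ge0.
apply: le_trans (step m) _; rewrite lerD2l ler_piMr // gerBl exprn_ge0 //; exact: ltW.
Qed.

(** The tail is at least of order x^(-t) for t > alpha, whereas it is at most 2 / k
    at a_k. *)
Lemma norming_lower (a : nat -> R) (theta : R) : 0 < theta -> theta < alpha^-1 ->
  G (a k) / k%:R^-1 @[k --> \oo] --> (1 : R) ->
  \forall k \near \oo, (k%:R : R) `^ theta <= a k.
Proof.
move=> th0 tha Ha; pose t := (alpha + theta^-1) / 2.
have at0 : alpha < theta^-1 by rewrite -[alpha]invrK ltf_pV2 ?posrE ?invr_gt0.
have at1 : alpha < t by rewrite /t; lra.
have t0 : 0 < t by rewrite (lt_trans alpha0).
have tth : t * theta < 1.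
  have : t < theta^-1 by rewrite /t; lra.
  by move=> h; rewrite -ltr_pdivlMr // div1r.
have sa : alpha / 2 < alpha by rewrite ltr_pdivrMr // ltr_pMr // ltr1n.
have [x0 x00 H] := ratio_bounds sa at1.
pose c := G (2 * x0) * x0 `^ t.
have c0 : 0 < c by rewrite mulr_gt0 ?powR_gt0.
have base x : x0 <= x -> x <= 2 * x0 -> c * x `^ (- t) <= G x.
  move=> xx0 xle; have xp : 0 < x by rewrite (lt_le_trans x00).
  apply: le_trans (tailP_anti P mZ xle); rewrite /c powRN -mulrA.
  apply: ler_piMr; first exact: ltW.
  rewrite ler_pdivrMr ?powR_gt0 // mul1r.
  by apply: ge0_ler_powR => //; rewrite ?nnegrE ltW.
have main (m : nat) x : x0 <= x -> x <= 2 ^+ m * (2 * x0) -> c * x `^ (- t) <= G x.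
  elim: m x => [|m IH] x xx0; first by rewrite expr0 mul1r; exact: base.
  have [xle _|xgt xm] := leP x (2 * x0); first exact: base.
  have xE : x = 2 * (x / 2) by rewrite mulrC divfK.
  have xx2 : x0 <= x / 2 by rewrite ler_pdivlMr // mulrC ltW.
  have x20 : 0 <= x / 2 by rewrite (le_trans (ltW x00)).
  have /andP[h _] := H _ xx2; rewrite [X in _ <= G X]xE (le_trans _ h) //.
  rewrite {1}xE powRM // mulrCA ler_wpM2l ?powR_ge0 //; apply: IH => //.
  by move: xm; rewrite exprS; lra.
have low x : x0 <= x -> c * x `^ (- t) <= G x.
  move=> xx0; apply: (main (Num.bound (x / (2 * x0)))) => //.
  rewrite -ler_pdivrMr ?mulr_gt0 //; apply: ltW; apply: lt_le_trans (archi_boundP _) _.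
    by rewrite divr_ge0 ?mulr_ge0 ?ltW // (lt_le_trans x00).
  by rewrite -natrX ler_nat ltnW // ltn_expl.
have Ga : \forall k \near \oo, G (a k) <= 2 * k%:R^-1.
  have /cvgrPdist_lt/(_ 1 ltr01) := Ha => h; near=> k.
  have k0 : (0 < k)%N by near: k; exists 1%N.
  have : `|1 - G (a k) / k%:R^-1| < 1 by near: k.
  rewrite ltr_distlC => /andP[_ /ltW]; rewrite ler_pdivrMr ?invr_gt0 ?ltr0n //.
have k_oo (A : R) : \forall k \near \oo, A <= k%:R.
  by have /cvgryPge := @cvgr_idn R; apply.
have k1 := k_oo (2 / G x0 + 1).
have k2 := polyO_small (@cvgr_idn R) tth (_ : 0 < c / 2) (polyO_pow (fun k : nat => k%:R : R) (t * theta)).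
have {}k2 := k2 (divr_gt0 c0 (ltr0Sn _ 1)).
near=> k.
have Gak : G (a k) <= 2 * k%:R^-1 by near: k.
have kk1 : 2 / G x0 + 1 <= k%:R by near: k.
have kk2 : `|k%:R `^ (t * theta)| <= c / 2 * (k%:R : R) `^ 1 by near: k.
have kp : 0 < (k%:R : R).
  by rewrite (lt_le_trans _ kk1) // addr_gt0 // divr_gt0.
have ax0 : x0 <= a k.
  rewrite leNgt; apply/negP => /ltW /(tailP_anti P mZ) h.
  have := le_trans h Gak; rewrite ler_pdivlMr // mulrC -ler_pdivlMr // => h2.
  by have := le_trans kk1 h2; rewrite gerDl ler10.
have ap : 0 < a k by rewrite (lt_le_trans x00).
have := le_trans (low _ ax0) Gak; rewrite powRN ler_pdivlMr // => h.
have {}h : c / 2 * k%:R <= a k `^ t.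
  rewrite mulrAC ler_pdivrMr //; rewrite mulrAC ler_pdivrMr ?powR_gt0 // in h.
  by rewrite [X in _ <= X]mulrC.
rewrite powRr1 ?(ltW kp) // ger0_norm ?powR_ge0 // in kk2.
have := le_trans kk2 h; rewrite mulrC powRrM => h3.
have ht : 0 <= t^-1 by rewrite invr_ge0 ltW.
have := ge0_ler_powR ht (powR_ge0 _ _ : _ \in Num.nneg) (powR_ge0 _ _ : _ \in Num.nneg) h3.
by rewrite -!powRrM mulfV ?gt_eqF // !mulr1 // [X in _ <= X]powRr1 // ltW.
Unshelve. all: by end_near. Qed.

End TailBounds.

(** * Truncated moments *)

Section Truncation.
Context {R : realType} {d : measure_display} {T : measurableType d} (P : probability T R).
Variables (Z : T -> R) (alpha : R).
Hypotheses (mZ : measurable_fun setT Z) (alpha0 : 0 < alpha).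
Hypothesis G_gt0 : forall x, 0 < tailP P Z x.
Hypothesis G_ratio : tailP P Z (2 * x) / tailP P Z x @[x --> +oo] --> 2 `^ (- alpha).
Local Notation Ex := (Ex P).
Local Notation G := (tailP P Z).

Definition trunc_in (K x : R) : R := x * \1_[set x : R | `|x| <= K] x.
Definition trunc_out (t K x : R) : R := x * \1_[set x : R | t < `|x| <= K] x.

Lemma trunc_inE K x : trunc_in K x = if `|x| <= K then x else 0.
Proof.
rewrite /trunc_in indicE; case: ifP => h; first by rewrite mem_set // mulr1.
by rewrite memNset ?mulr0 //= h.
Qed.

Lemma trunc_outE t K x : trunc_out t K x = if t < `|x| <= K then x else 0.
Proof.
rewrite /trunc_out indicE; case: ifP => h; first by rewrite mem_set // mulr1.
by rewrite memNset ?mulr0 //= h.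
Qed.

Lemma trunc_in_split t K x : t <= K -> trunc_in K x = trunc_in t x + trunc_out t K x.
Proof.
move=> tK; rewrite !trunc_inE trunc_outE; have [h|h] := leP `|x| t.
  by rewrite (le_trans h tK) addr0.
by case: ifP; rewrite add0r.
Qed.

Lemma trunc_in_le K x : 0 <= K -> `|trunc_in K x| <= K.
Proof. by move=> K0; rewrite trunc_inE; case: ifP => //; rewrite normr0. Qed.

Lemma trunc_out_le t K x : 0 <= K -> `|trunc_out t K x| <= K.
Proof. by move=> K0; rewrite trunc_outE; case: ifP => [/andP[]//|]; rewrite normr0. Qed.

Lemma bounded_trunc_in K : 0 <= K -> bounded_rv (trunc_in K).
Proof.
move=> K0; split; last by exists K => x; exact: trunc_in_le.
apply: measurable_funM; last exact: measurable_indic (measurable_normle K).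
exact: measurable_id.
Qed.

Lemma bounded_trunc_out t K : 0 <= K -> bounded_rv (trunc_out t K).
Proof.
move=> K0; split; last by exists K => x; exact: trunc_out_le.
apply: measurable_funM; first exact: measurable_id.
apply: measurable_indic.
rewrite (_ : [set x : R | t < `|x| <= K] = [set x | `|x| <= K] `\` [set x | `|x| <= t]).
  by apply: measurableD; exact: measurable_normle.
apply/seteqP; split => x /=; first by move=> /andP[h1 h2]; split => //; rewrite leNgt h1.
by move=> [h1 /negP]; rewrite -ltNge h1 => ->.
Qed.

Let bin K (K0 : 0 <= K) := bounded_rv_comp mZ (bounded_trunc_in K0).
Let bout t K (K0 : 0 <= K) := bounded_rv_comp mZ (@bounded_trunc_out t K K0).

Lemma powR_split (x s t : R) : 0 <= x -> 0 < s -> s <= t -> x `^ t = x `^ (t - s) * x `^ s.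
Proof.
move=> x0 s0 st; have [->|xN] := eqVneq x 0.
  by rewrite [LHS]powR0 ?gt_eqF ?(lt_le_trans s0) // [X in _ * X]powR0 ?gt_eqF // mulr0.
by rewrite -powR_add ?subrK // lt_def xN.
Qed.

Lemma trunc_in_second s : 0 < s < alpha -> s <= 2 -> exists2 M, 0 <= M &
  forall K, 0 < K -> Ex (fun w => trunc_in K (Z w) ^+ 2) <= M * K `^ (2 - s).
Proof.
move=> sa s2; have /andP[s0 _] := sa; have [M M0 HM] := moment_le mZ G_gt0 G_ratio sa.
exists M => // K K0; have b := bounded_rv_comp mZ (bounded_trunc_pow K (ltW s0)).
apply: (le_trans (y := Ex (fun w => K `^ (2 - s) * trunc_pow s K (Z w)))).
  apply: Ex_le; [by apply: bounded_rvX; apply: bin; exact: ltW|exact: bounded_rvZ|].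
  move=> w; rewrite trunc_inE trunc_powE; case: ifP => h; last by rewrite expr0n mulr0.
  rewrite -real_normK ?num_real // -powR_mulrn // (@powR_split _ s) //.
  rewrite ler_wpM2r ?powR_ge0 //; apply: ge0_ler_powR; rewrite ?nnegrE ?subr_ge0 ?(ltW K0) //.
by rewrite ExZ // mulrC ler_wpM2r ?powR_ge0.
Qed.

Lemma trunc_in_first s : 0 < s < alpha -> s <= 1 -> exists2 M, 0 <= M &
  forall K, 0 < K -> `|Ex (fun w => trunc_in K (Z w))| <= M * K `^ (1 - s).
Proof.
move=> sa s1; have /andP[s0 _] := sa; have [M M0 HM] := moment_le mZ G_gt0 G_ratio sa.
exists M => // K K0; have b := bounded_rv_comp mZ (bounded_trunc_pow K (ltW s0)).
have bn : bounded_rv (fun w => `|trunc_in K (Z w)|).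
  have [m [B hB]] := bin (ltW K0); split; last by exists B => w; rewrite normr_id.
  exact: (measurableT_comp (@normr_measurable R setT) m).
apply: le_trans (Ex_norm P (bin (ltW K0))) _.
apply: (le_trans (y := Ex (fun w => K `^ (1 - s) * trunc_pow s K (Z w)))).
  apply: Ex_le => //; first exact: bounded_rvZ.
  move=> w; rewrite trunc_inE trunc_powE; case: ifP => h; last by rewrite normr0 mulr0.
  rewrite -[X in X <= _]powRr1 // (@powR_split _ s) //.
  rewrite ler_wpM2r ?powR_ge0 //; apply: ge0_ler_powR; rewrite ?nnegrE ?subr_ge0 ?(ltW K0) //.
by rewrite ExZ // mulrC ler_wpM2r ?powR_ge0.
Qed.

Lemma Ex_indic_out t (c : R) : Ex (fun w => c * \1_[set w | t < `|Z w|] w) = c * G t.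
Proof.
rewrite ExZ ?(Ex_tail P mZ) //; apply: bounded_rv_indic; exact: (measurable_gt _ (measurable_normZ mZ)).
Qed.

Lemma bounded_indic_out t (c : R) : bounded_rv (fun w => c * \1_[set w | t < `|Z w|] w).
Proof. by apply: bounded_rvZ; apply: bounded_rv_indic; exact: (measurable_gt _ (measurable_normZ mZ)). Qed.

Lemma trunc_out_second t K : 0 <= K -> Ex (fun w => trunc_out t K (Z w) ^+ 2) <= K ^+ 2 * G t.
Proof.
move=> K0; rewrite -Ex_indic_out; apply: Ex_le.
- by apply: bounded_rvX; exact: bout.
- exact: bounded_indic_out.
move=> w; rewrite trunc_outE indicE; case: ifP => [/andP[h1 h2]|_]; last first.
  by rewrite expr0n /= mulr_ge0 ?exprn_ge0.
by rewrite mem_set //= mulr1 -real_normK ?num_real // lerXn2r ?nnegrE.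
Qed.

Lemma trunc_out_first t K : 0 <= K -> `|Ex (fun w => trunc_out t K (Z w))| <= K * G t.
Proof.
move=> K0; apply: le_trans (Ex_norm P (bout t K0)) _; rewrite -Ex_indic_out; apply: Ex_le.
- have [m [B hB]] := bout t K0; split; last by exists B => w; rewrite normr_id.
  exact: (measurableT_comp (@normr_measurable R setT) m).
- exact: bounded_indic_out.
move=> w; rewrite trunc_outE indicE; case: ifP => [/andP[h1 h2]|_]; last first.
  by rewrite normr0 mulr_ge0.
by rewrite mem_set //= mulr1.
Qed.

Lemma near_trunc_in w : \forall n \near \oo, trunc_in n%:R (Z w) = Z w.
Proof.
have /cvgryPge/(_ `|Z w|) H := @cvgr_idn R; near=> n; rewrite trunc_inE ifT //.
by near: n.
Unshelve. all: by end_near. Qed.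

(** Monotone convergence from the uniform bound on truncated first moments. *)
Lemma integrable_Z : 1 < alpha -> P.-integrable setT (EFin \o Z).
Proof.
move=> a1; have [M M0 HM] := moment_le mZ G_gt0 G_ratio (introT andP (conj ltr01 a1)).
apply/integrableP; split; first exact/measurable_EFinP.
pose g n w := `|trunc_in n%:R (Z w)|%:E.
have mg n : measurable_fun setT (g n).
  apply/measurable_EFinP.
  exact: (measurableT_comp (@normr_measurable R setT) (bin (ler0n R n)).1).
have gmono w m n : (m <= n)%N -> (g m w <= g n w)%E.
  move=> mn; rewrite lee_fin !trunc_inE; case: ifP => h; last by rewrite normr0.
  by rewrite (le_trans h) // ler_nat.
have -> : (\int[P]_x `|(EFin \o Z) x| = \int[P]_x (limn (g ^~ x)))%E.
  apply: eq_integral => w _; apply/esym/cvg_lim => //=.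
  apply: cvg_near_cst; have H := near_trunc_in w; near=> n.
  by rewrite /g (_ : trunc_in n%:R (Z w) = Z w) //; near: n.
rewrite (monotone_convergence _ _ mg) //; first last.
- by move=> w _ m n mn; exact: gmono.
- by move=> n w _; rewrite lee_fin.
apply: (@le_lt_trans _ _ M%:E); last exact: ltry.
apply: lime_le.
  apply: ereal_nondecreasing_is_cvgn => m n mn; apply: ge0_le_integral => // w _;
    [by rewrite lee_fin|exact: gmono].
apply: nearW => n; have b := bounded_rv_comp mZ (bounded_trunc_pow n%:R (@ler01 R)).
have -> : (\int[P]_x g n x = \int[P]_x (EFin \o (fun w => trunc_pow 1 n%:R (Z w))) x)%E.
  apply: eq_integral => w _; rewrite /g /= trunc_inE trunc_powE; congr (_%:E).
  by case: ifP => _; rewrite ?normr0 ?powRr1.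
rewrite -[X in (X <= _)%E]fineK ?lee_fin; first exact: HM.
by apply: integrable_fin_num => //; exact: bounded_rv_integrable.
Unshelve. all: by end_near. Qed.

(** The mean of the part below t is minus the mean of the part above t, and above t
    the first moment is at most t^(1 - s) times the moment of order s. *)
Lemma trunc_in_centered s : 1 < alpha -> (\int[P]_w (Z w)%:E = 0)%E ->
  1 <= s < alpha -> exists2 M, 0 <= M &
  forall t, 0 < t -> `|Ex (fun w => trunc_in t (Z w))| <= M * t `^ (1 - s).
Proof.
move=> a1 EZ0 /andP[s1 sa]; have s0 : 0 < s by rewrite (lt_le_trans ltr01).
have [M M0 HM] := moment_le mZ G_gt0 G_ratio (introT andP (conj s0 sa)).
exists M => // t t0; apply/ler_addgt0Pr => e e0.
have iZ := integrable_Z a1.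
have f_f w : (trunc_in n%:R (Z w))%:E @[n --> \oo] --> (Z w)%:E.
  apply: cvg_near_cst; have H := near_trunc_in w; near=> n.
  by rewrite (_ : trunc_in n%:R (Z w) = Z w) //; near: n.
have mf_ n : measurable_fun setT (fun w => (trunc_in n%:R (Z w))%:E).
  by apply/measurable_EFinP; exact: (bin (ler0n R n)).1.
have domi n w : (`|(trunc_in n%:R (Z w))%:E| <= (`|Z w|%R)%:E)%E.
  by rewrite lee_fin trunc_inE; case: ifP => //; rewrite normr0.
have [_ _ H] := dominated_convergence measurableT mf_ (measurable_int _ iZ)
  (aeW _ (fun w _ => f_f w)) (integrable_norm iZ) (aeW _ (fun w n _ => domi n w)).
rewrite /= EZ0 in H; have /fine_cvgP[_ /cvgrPdist_le/(_ _ e0) He] := H.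
have /cvgryPge/(_ t) Ht := @cvgr_idn R.
suff [n [Hn tn]] : exists n : nat, `|Ex (fun w => trunc_in n%:R (Z w))| <= e /\ t <= n%:R.
  have n0 : 0 <= n%:R :> R by rewrite ler0n.
  have bo := bout t n0; have bn := bin n0; have bt := bin (ltW t0).
  have -> : Ex (fun w => trunc_in t (Z w)) =
     Ex (fun w => trunc_in n%:R (Z w)) - Ex (fun w => trunc_out t n%:R (Z w)).
    rewrite -ExB //; congr (Ex _); apply/funext => w.
    by rewrite (trunc_in_split _ tn) addrK.
  rewrite (le_trans (ler_normB _ _)) // addrC lerD //.
  apply: le_trans (Ex_norm P bo) _.
  have b := bounded_rv_comp mZ (bounded_trunc_pow n%:R (ltW s0)).
  apply: (le_trans (y := Ex (fun w => t `^ (1 - s) * trunc_pow s n%:R (Z w)))).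
    apply: Ex_le; [|exact: bounded_rvZ|].
      have [m [B hB]] := bo; split; last by exists B => w; rewrite normr_id.
      exact: (measurableT_comp (@normr_measurable R setT) m).
    move=> w; rewrite trunc_outE trunc_powE; case: ifP => [/andP[h1 h2]|_]; last first.
      by rewrite normr0; case: ifP; rewrite ?mulr0 // mulr_ge0 ?powR_ge0.
    rewrite h2; have z0 : 0 < `|Z w| by rewrite (lt_trans t0).
    have zE : `|Z w| = `|Z w| `^ (1 - s) * `|Z w| `^ s by rewrite -powR_add // subrK powRr1 // ltW.
    rewrite [X in X <= _]zE ler_wpM2r ?powR_ge0 //.
    have sE : 1 - s = - (s - 1) by rewrite opprB.
    rewrite sE !powRN lef_pV2 ?posrE ?powR_gt0 //.
    by apply: ge0_ler_powR; rewrite ?nnegrE ?subr_ge0 ?(ltW t0) ?(ltW z0) // ltW.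
  by rewrite ExZ // mulrC ler_wpM2r ?powR_ge0.
near \oo => n; exists n; split; last by near: n.
rewrite -normrN -sub0r; have := near He n; apply => //; near: n.
Unshelve. all: by end_near. Qed.

End Truncation.

(** * Growth of slowly varying functions *)

Section SlowVariation.
Context {R : realType}.
Local Notation mu := (@lebesgue_measure R).

(** Both sides agree on half-open intervals. *)
Lemma lebesgue_measure_shift (u : R) (A : set R) : measurable A ->
  mu ((fun x => x - u) @^-1` A) = mu A.
Proof.
move=> mA; have mf : measurable_fun [set: measurableTypeR R] ((fun x => x - u) : measurableTypeR R -> measurableTypeR R).
  exact: measurable_funB.
pose f : {mfun measurableTypeR R >-> measurableTypeR R} :=
  @mfun_Sub _ _ (measurableTypeR R) (measurableTypeR R) _ (mem_set mf).
have -> : mu ((fun x => x - u) @^-1` A) = pushforward mu f A by [].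
apply/esym/lebesgue_measure_unique => //= _ [[x y]] _ <-.
rewrite /pushforward (_ : f @^-1` _ = `]x + u, y + u]%classic).
  by rewrite !lebesgue_measure_itv /= !lte_fin ltrD2r; case: ifP => // _; rewrite -!EFinB; congr _%:E; ring.
by apply/seteqP; split => z /=; rewrite !in_itv /= ltrBrDr lerBlDr.
Qed.

Variable h : R -> R.
Hypotheses (mh : measurable_fun setT h)
  (h_shift : forall u, h (x + u) - h x @[x --> +oo] --> (0 : R)).

Let slow_set (z : nat -> R) (m : nat) : set R :=
  [set v | 0 <= v <= 2 /\ forall n, (m <= n)%N -> `|h (z n + v) - h (z n)| <= 1].

Let slow_set_measurable z m : measurable (slow_set z m).
Proof.
rewrite (_ : slow_set z m = `[0, 2] `&` \bigcap_(n in [set n | (m <= n)%N])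
   ((fun v => `|h (z n + v) - h (z n)|) @^-1` `]-oo, 1])).
  apply: measurableI => //; apply: bigcap_measurable; first by exists m => /=.
  move=> k _; rewrite -[S in measurable S]setTI.
  have : measurable_fun setT (fun v => `|h (z k + v) - h (z k)|).
    apply: measurableT_comp (@normr_measurable R setT) _.
    apply: measurable_funB => //; apply: measurableT_comp => //.
    exact: measurable_funD.
  by apply.
by apply/seteqP; split => v /= [v2 hv]; split; rewrite ?in_itv // => n mn; have := hv n mn; rewrite /= ?in_itv.
Qed.

Let slow_set_large z : (z n @[n --> \oo] --> +oo) ->
  \forall m \near \oo, ((3 / 2)%:E < mu (slow_set z m))%E.
Proof.
move=> zoo.
have U : \bigcup_m slow_set z m = `[0, 2].
  apply/seteqP; split => [v [m _ []]|v]; rewrite /= in_itv //= => v2.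
  have := cvg_comp _ _ zoo (h_shift v) => /cvgrPdist_le/(_ 1 ltr01) [m _ hm].
  by exists m => //; split => // n mn; have := hm n mn; rewrite /= sub0r normrN.
have := @nondecreasing_cvg_mu _ _ _ mu (slow_set z) (slow_set_measurable z).
rewrite U => /(_ (measurable_itv _)) H.
have {}H : mu (slow_set z m) @[m --> \oo] --> 2%:E.
  have -> : 2%:E = mu `[0, 2].
    by rewrite lebesgue_measure_itv /= lte_fin ltr0n /= -EFinB subr0.
  apply: H => m k mk; apply/subsetPset => v [v2 hv]; split => // n kn.
  by apply: hv; exact: leq_trans kn.
have /fine_cvgP [fin] := H.
move=> /cvgrPdist_lt/(_ (1 / 2)); rewrite divr_gt0 // => /(_ isT) H2.
near=> m; have : `|2 - fine (mu (slow_set z m))| < 1 / 2 by near: m.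
have mfin : mu (slow_set z m) \is a fin_num by near: m.
by rewrite ltr_distlC -[X in (_ < X)%E](fineK mfin) lte_fin => /andP[h1 _]; apply: le_lt_trans h1; lra.
Unshelve. all: by end_near. Qed.

(** A Steinhaus-type argument, as in the uniform convergence theorem of slow
    variation.  If h oscillated by more than 2 between x_n and y_n = x_n + u_n for
    points tending to infinity, then for large n the sets where h(x_n + v) is near
    h(x_n), and where h(y_n + v) is near h(y_n), would both fill more than 3/2 of
    the interval [0, 2]; the second one, translated by u_n, is disjoint from the
    first, and both lie in [0, 3]. *)
Lemma slow_oscillation : exists X, forall x u, X <= x -> 0 <= u <= 1 -> `|h (x + u) - h x| <= 2.
Proof.
apply: contrapT => /forallNP H.
have {}H n : exists xu : R * R, [/\ n%:R <= xu.1, 0 <= xu.2 <= 1 & 2 < `|h (xu.1 + xu.2) - h xu.1|].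
  move: (H n%:R) => /existsNP [x] /existsNP [u] /not_implyP [nx] /not_implyP [u1] /negP.
  by rewrite -ltNge; exists (x, u).
have [f hf] := choice H.
pose x n := (f n).1; pose y n := (f n).1 + (f n).2.
have xoo : x n @[n --> \oo] --> +oo.
  apply/cvgryPge => A; near=> n; have [nx _ _] := hf n; apply: le_trans nx.
  by near: n; exact: nbhs_infty_ger.
have yoo : y n @[n --> \oo] --> +oo.
  apply/cvgryPge => A; near=> n; have [nx /andP[u0 _] _] := hf n.
  rewrite /y -[A]addr0 lerD //; apply: le_trans nx.
  by near: n; exact: nbhs_infty_ger.
have [k [kx ky]] : exists k, ((3 / 2)%:E < mu (slow_set x k))%E /\ ((3 / 2)%:E < mu (slow_set y k))%E.
  have hx := slow_set_large xoo; have hy := slow_set_large yoo.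
  near \oo => k; exists k; split; by near: k.
have [nx /andP[u0 u1] big] := hf k.
pose S := (fun v => v - (f k).2) @^-1` slow_set y k.
have mS : measurable S.
  rewrite -[S]setTI; have : measurable_fun [set: R] (fun v => v - (f k).2) by exact: measurable_funB.
  by apply.
have muS : mu S = mu (slow_set y k) by exact: lebesgue_measure_shift.
have sub : slow_set x k `|` S `<=` `[0, 3].
  move=> v; rewrite /S /= !in_itv /=.
  by case=> -[] /andP[v0 v2] _; apply/andP; split; lra.
have dis : slow_set x k `&` S = set0.
  apply/seteqP; split => v //= [[_ h1] [_ h2]].
  have /ler_normlP[a1 a2] := h1 k (leqnn k); have := h2 k (leqnn k).
  have -> : y k + (v - (f k).2) = x k + v by rewrite /y /x; ring.
  move=> /ler_normlP[b1 b2]; move: big; rewrite ltNge => /negP; apply.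
  by apply/ler_normlP; rewrite -/(y k) -/(x k); split; lra.
have mU : measurable (slow_set x k `|` S) by apply: measurableU.
have m03 : measurable (`[0%R, 3%R]%classic : set R) by exact: measurable_itv.
have : (mu (slow_set x k `|` S) <= mu `[0%R, 3%R])%E.
  exact: (le_measure mu (mem_set mU) (mem_set m03) sub).
rewrite (_ : mu (slow_set x k `|` S) = (mu (slow_set x k) + mu S)%E); last first.
  exact: (@measureU _ _ _ mu _ _ (slow_set_measurable x k) mS dis).
apply/negP; rewrite -ltNge.
have -> : mu `[0%R, 3%R] = ((3 / 2)%:E + (3 / 2)%:E)%E.
  rewrite lebesgue_measure_itv /= lte_fin ltr0n /= -EFinB -EFinD; congr _%:E; lra.
by rewrite muS; exact: lteD.
Unshelve. all: by end_near. Qed.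

(** Unit steps change h by o(1), and the fractional part costs at most 2 by
    [slow_oscillation]. *)
Lemma shift_invariant_sublinear eta : 0 < eta -> \forall x \near +oo, `|h x| <= eta * x.
Proof.
move=> eta0; have [X0 hX0] := slow_oscillation.
have [X1 [_ hX1]] : \forall x \near +oo, `|h (x + 1) - h x| <= eta / 2.
  have /cvgrPdist_le/(_ (eta / 2)) := h_shift 1; rewrite divr_gt0 // => /(_ isT).
  by under eq_near do rewrite sub0r normrN.
pose X := Num.max 0 (Num.max X0 (X1 + 1)).
have X_0 : 0 <= X by rewrite le_max lexx.
have X_X0 : X0 <= X by rewrite !le_max lexx orbT.
have X_X1 : X1 < X by rewrite !lt_max ltrDl ltr01 !orbT.
have step k u : 0 <= u <= 1 -> `|h (X + u + k%:R)| <= `|h X| + 2 + k%:R * (eta / 2).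
  move=> u1; elim: k => [|k IH].
    rewrite addr0 mul0r addr0 -[h (X + u)](subrK (h X)) [leRHS]addrC.
    by rewrite (le_trans (ler_normD _ _)) // lerD // hX0.
  rewrite -natr1 addrA -[h (_ + 1)](subrK (h (X + u + k%:R))).
  rewrite (le_trans (ler_normD _ _)) // mulrDl mul1r addrA [leLHS]addrC lerD //.
  by apply: hX1; rewrite (lt_le_trans X_X1) // -addrA lerDl addr_ge0 //; case/andP: u1.
near=> x; have xX : X <= x by near: x; apply: nbhs_pinfty_ge; exact: num_real.
have xC : (`|h X| + 2) / (eta / 2) <= x by near: x; apply: nbhs_pinfty_ge; exact: num_real.
have xX0 : 0 <= x - X by rewrite subr_ge0.
have /andP[k1 k2] := truncn_itv xX0; set k := Num.truncn _ in k1 k2.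
have := step k (x - X - k%:R); have -> : X + (x - X - k%:R) + k%:R = x by ring.
rewrite subr_ge0 k1 /= lerBlDr nat1r (ltW k2) => /(_ isT) /le_trans -> //.
move: xC; rewrite ler_pdivrMr ?divr_gt0 // => xC.
have : k%:R * (eta / 2) <= x * (eta / 2).
  by apply: ler_wpM2r; [rewrite ltW // divr_gt0 | rewrite (le_trans k1) // lerBlDr lerDl].
by lra.
Unshelve. all: by end_near. Qed.

End SlowVariation.

Lemma cvg_expR_pinfty {R : realType} : @expR R x @[x --> +oo] --> +oo.
Proof.
apply/cvgryPge => A; near=> x; apply: le_trans (expR_ge1Dx x).
by rewrite -lerBlDl; near: x; apply: nbhs_pinfty_ge; exact: num_real.
Unshelve. all: by end_near. Qed.

(** In logarithmic coordinates h = ln o ell o exp a slowly varying function has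
    vanishing increments, so h(ln n) = o(ln n). *)
Lemma slowly_varying_pow {R : realType} (ell : R -> R) (eta : R) : slowly_varying ell -> 0 < eta ->
  \forall n \near \oo, n%:R `^ (- eta) <= ell n%:R <= n%:R `^ eta.
Proof.
move=> [[x0 [m_ell ell_gt0]] ell_sv] eta0.
(* Make ell positive and measurable on the whole line. *)
pose g x := if x0 <= x then ell x else 1.
have mg : measurable_fun setT g.
  apply: measurable_fun_if => //; first exact: measurable_fun_ler.
  rewrite (_ : _ `&` _ = `[x0, +oo[) //.
  by apply/seteqP; split => x /=; rewrite in_itv /= andbT; [case|].
have g_gt0 x : 0 < g x by rewrite /g; case: ifP => // /ell_gt0.
pose h x := ln (g (expR x)).
have mh : measurable_fun setT h.
  apply: measurableT_comp (@measurable_ln R) _.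
  exact: measurableT_comp mg (@measurable_expR R).
have h_shift u : h (x + u) - h x @[x --> +oo] --> (0 : R).
  have := ell_sv _ (expR_gt0 u) => /(cvg_comp _ _ (@cvg_expR_pinfty R)).
  move=> /(cvg_comp _ _) /(_ (continuous_ln ltr01)); rewrite ln1.
  apply: cvg_pinfty_eq; near=> x; rewrite /h /=.
  have xx : x0 <= expR x.
    near: x; have /cvgryPge := @cvg_expR_pinfty R; exact.
  have xx' : x0 <= expR (x + u).
    near: x; have [A [_ hA]] : \forall x \near +oo, x0 <= expR x :> R.
      by have /cvgryPge := @cvg_expR_pinfty R; exact.
    exists (A - u); split; [exact: num_real|move=> x xA /=; apply: hA; lra].
  by rewrite /g xx xx' -expRD [u + x]addrC ln_div ?posrE ?ell_gt0.
have [A [_ hA]] := shift_invariant_sublinear mh h_shift eta0.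
near=> n.
have n_gt0 : 0 < n%:R :> R by rewrite ltr0n; near: n; exact: nbhs_infty_gt.
have nx0 : x0 <= n%:R by near: n; exact: nbhs_infty_ger.
have : expR (A + 1) <= n%:R :> R by near: n; exact: nbhs_infty_ger.
rewrite -[X in _ <= X](lnK n_gt0) ler_expR => nA.
have := hA (ln n%:R); rewrite /h lnK // /g nx0 => /(_ _).
have -> : A < ln n%:R by lra.
move=> /(_ isT) /ler_normlP[h1 h2].
have l0 := ell_gt0 _ nx0.
rewrite /powR gt_eqF // -[X in _ <= X <= _](lnK l0) !ler_expR; apply/andP; split; lra.
Unshelve. all: by end_near. Qed.

(** * Measurability of eigenvalues and order statistics *)

Section Measurability.
Context {R : realType}.

(** Stated for families over any finite type, so that it serves for matrices and for
    the arguments of order statistics alike. *)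
Definition finite_continuous (E : finType) (f : (E -> R) -> R) :=
  forall x, forall eps, 0 < eps -> exists2 del, 0 < del &
    forall y, (forall e, `|y e - x e| < del) -> `|f y - f x| < eps.

(** The superlevel set of f is a countable union of boxes with rational centers. *)
Lemma measurable_finite_continuous (E : finType) (f : (E -> R) -> R)
    d (T : measurableType d) (X : E -> T -> R) :
  finite_continuous f -> (forall e, measurable_fun setT (X e)) ->
  measurable_fun setT (fun w => f (X ^~ w)).
Proof.
move=> fc mX; apply: (measurability _ (@RGenOInfty.measurableE R)) => _ [_ [s ->]] <-.
rewrite setTI.
(* Boxes of radius rad k around rational points, kept when f > s on the whole box. *)
pose rad (k : nat) : R := k.+1%:R^-1.
pose near_box (k : nat) (q : {ffun E -> rat}) (y : E -> R) := forall e, `|y e - ratr (q e)| < rad k.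
have rad_gt0 k : 0 < rad k by rewrite /rad invr_gt0 ltr0Sn.
pose good (kq : nat * {ffun E -> rat}) := forall y, near_box kq.1 kq.2 y -> s < f y.
pose F (kq : nat * {ffun E -> rat}) :=
  if `[< good kq >] then \bigcap_(e in [set: E]) [set w | `|X e w - ratr (kq.2 e)| < rad kq.1] else set0.
rewrite (_ : _ @^-1` _ = \bigcup_kq F kq); last first.
  apply/seteqP; split => w /=.
    rewrite in_itv /= andbT => sf.
    have [del del0 hdel] := fc (X ^~ w) (f (X ^~ w) - s) ltac:(by rewrite subr_gt0).
    have [k kdel] : exists k, rad k + rad k <= del.
      have del2 : 0 < del / 2 by rewrite divr_gt0.
      have [k _ /(_ k (leqnn k)) /= h] := near_infty_natSinv_lt (PosNum del2).
      by exists k; have : rad k < del / 2 := h; move: (rad k) => z; lra.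
    have hq e : exists q : rat, `|X e w - ratr q| < rad k.
      have : X e w - rad k < X e w + rad k by have := rad_gt0 k; lra.
      move=> /rat_in_itvoo [q]; rewrite in_itv /= => /andP[h1 h2]; exists q.
      by rewrite ltr_distlC; apply/andP; split; lra.
    have [q qP] := choice hq; exists (k, finfun q) => //; rewrite /F asboolT /=.
      by move=> e _ /=; rewrite ffunE.
    move=> y yq.
    have : `|f y - f (X ^~ w)| < f (X ^~ w) - s.
      apply: hdel => e; apply: lt_le_trans kdel.
      rewrite (_ : _ - _ = (y e - ratr (q e)) - (X e w - ratr (q e))); last by ring.
      rewrite (le_lt_trans (ler_normB _ _)) // ltrD //.
      by have := yq e; rewrite ffunE.
    by rewrite ltr_distl => /andP[h _]; apply: le_lt_trans h; rewrite subKr.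
  by move=> [kq _]; rewrite /F; case: asboolP => // g h; rewrite in_itv /= andbT; apply: g => e; exact: h.
apply: countable_bigcupT_measurable; first exact: countableP.
move=> kq; rewrite /F; case: ifP => // _.
apply: fin_bigcap_measurable => // e _.
rewrite (_ : [set w | _] = (fun w => `|X e w - ratr (kq.2 e)|) @^-1` `]-oo, rad kq.1[).
  rewrite -[S in measurable S]setTI.
  have : measurable_fun setT (fun w => `|X e w - ratr (kq.2 e)|).
    by apply: measurableT_comp (@normr_measurable R setT) _; exact: measurable_funB.
  by apply.
by apply/seteqP; split => w /=; rewrite in_itv.
Qed.

Lemma order_stat_lipschitz (I : finType) (f g : I -> R) e :
  0 <= e -> (forall i, 0 <= f i) -> (forall i, 0 <= g i) -> (forall i, `|f i - g i| <= e) ->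
  forall k, `|order_stat f k - order_stat g k| <= e.
Proof.
move=> e0 f0 g0 fg k.
have aux (f' g' : I -> R) : (forall i, 0 <= g' i) -> (forall i, `|f' i - g' i| <= e) ->
    order_stat f' k <= order_stat g' k + e.
  move=> g'0 fg'; apply: order_stat_le => // v v0; apply: subset_leq_card.
  apply/fintype.subsetP => i; rewrite !inE => h; have := fg' i => /ler_normlP[_]; lra.
rewrite ler_distl; apply/andP; split; last exact: aux.
by rewrite lerBlDr; apply: aux => // i; rewrite distrC.
Qed.

(** Absolute values extend the map to all families, so that it is continuous
    everywhere. *)
Lemma measurable_order_stat (I : finType) d (T : measurableType d) (X : I -> T -> R) k :
  (forall i, measurable_fun setT (X i)) -> (forall i w, 0 <= X i w) ->
  measurable_fun setT (fun w => order_stat (X ^~ w) k).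
Proof.
move=> mX X0.
have fc : finite_continuous (fun x : I -> R => order_stat (fun i => `|x i|) k).
  move=> x eps eps0; exists (eps / 2); first by rewrite divr_gt0.
  move=> y xy; apply: (@le_lt_trans _ _ (eps / 2)); last by lra.
  apply: order_stat_lipschitz => //; first by rewrite divr_ge0 // ltW.
  by move=> i; rewrite (le_trans (ler_dist_dist _ _)) // ltW.
have := measurable_finite_continuous fc mX; congr (measurable_fun _ _).
by apply/funext => w; congr (order_stat _ k); apply/funext => i; rewrite ger0_norm.
Qed.

(** By Weyl's inequality it suffices that the sample covariance matrix is
    continuous in the Hilbert-Schmidt norm. *)
Lemma ordered_eigenvalue_continuous p n k :
  finite_continuous (fun x : 'I_p * 'I_n -> R => ordered_eigenvalue (\matrix_(i, t) x (i, t)) k).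
Proof.
move=> x eps eps0.
pose B := 1 + \sum_it `|x it|.
have B0 : 0 < B by rewrite ltr_pwDl // sumr_ge0.
have xB it : `|x it| + 1 <= B.
  by rewrite /B addrC lerD2l (bigD1 it) //= lerDl sumr_ge0.
have BB0 : 0 <= B + B by rewrite addr_ge0 // ltW.
pose C := 1 + p%:R * (n%:R * (B + B)).
have C0 : 0 < C by rewrite ltr_pwDl // !mulr_ge0.
pose e := eps / 2; have e0 : 0 < e by rewrite divr_gt0.
pose del := Num.min 1 (e / C).
have del1 : del <= 1 by rewrite ge_min lexx.
have delC : p%:R * (n%:R * (del * (B + B))) <= e.
  have : del <= e / C by rewrite ge_min lexx orbT.
  rewrite ler_pdivlMr // /C mulrDr mulr1 => h.
  apply: le_trans h; rewrite -[leLHS]add0r lerD //; first by rewrite le_min ler01 divr_ge0 ?ltW.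
  by rewrite le_eqVlt; apply/orP; left; apply/eqP; ring.
have del0 : 0 < del by rewrite lt_min ltr01 divr_gt0.
exists del => // y xy.
pose M z : 'M[R]_(p, n) := \matrix_(i, t) z (i, t).
have ent i j : `|(sample_cov (M y) - sample_cov (M x)) i j| <= n%:R * (del * (B + B)).
  rewrite /sample_cov !mxE -sumrB -[n in n%:R]card_ord -sum1_card natr_sum mulr_suml.
  rewrite (le_trans (ler_norm_sum _ _ _)) // ler_sum // => t _; rewrite !mxE mul1r.
  have := xB (i, t); have := xB (j, t); have := xy (i, t); have := xy (j, t).
  move: (x (i, t)) (y (i, t)) (x (j, t)) (y (j, t)) => a a' b b' hb ha Bb Ba.
  rewrite (_ : _ - _ = (a' - a) * b + a' * (b' - b)); last by ring.
  rewrite (le_trans (ler_normD _ _)) // !normrM mulrDr lerD //.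
    by rewrite ler_pM // ?ltW //; lra.
  rewrite mulrC ler_pM // ?ltW //.
  have : `|a'| <= `|a' - a| + `|a| by rewrite -[X in `|X| <= _](subrK a) ler_normD.
  by lra.
have hs : hs2 (sample_cov (M y) - sample_cov (M x)) <= e ^+ 2.
  rewrite hs2E (@le_trans _ _ (\sum_(i < p) \sum_(j < p) (n%:R * (del * (B + B))) ^+ 2)) //.
    apply: ler_sum => i _; apply: ler_sum => j _.
    rewrite -[leLHS](real_normK (num_real _)) lerXn2r ?nnegrE // ?ent //.
    by rewrite mulr_ge0 // mulr_ge0 // ltW.
  rewrite !sumr_const card_ord -mulrnA -[leLHS]mulr_natl natrM -expr2 -exprMn lerXn2r ?nnegrE // ?(ltW e0) //.
  by rewrite !mulr_ge0 // ltW.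
have q v := qform_le_hs2 (ltW e0) hs v.
have qE v : (v *m (sample_cov (M y) - sample_cov (M x)) *m v^T) 0 0 =
    (v *m sample_cov (M y) *m v^T) 0 0 - (v *m sample_cov (M x) *m v^T) 0 0.
  by rewrite mulmxBr mulmxBl mxE [X in _ + X]mxE.
apply: (@le_lt_trans _ _ e); last by rewrite /e; lra.
rewrite ler_distl; apply/andP; split.
  rewrite lerBlDr; apply: weyl (ltW e0) _ k => v.
  by have := q v; rewrite qE => /ler_normlP[h _]; lra.
by apply: weyl (ltW e0) _ k => v; have := q v; rewrite qE => /ler_normlP[_ h]; lra.
Qed.

Lemma measurable_max_dist d (T : measurableType d) m (u v : nat -> T -> R) :
  (forall k, measurable_fun setT (u k)) -> (forall k, measurable_fun setT (v k)) ->
  measurable_fun setT (fun w => max_dist m (u ^~ w) (v ^~ w)).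
Proof.
move=> mu mv; rewrite /max_dist.
have ms (s : seq 'I_m) : measurable_fun setT (fun w => \big[Num.max/0]_(k <- s) `|u k w - v k w|).
  elim: s => [|k s IH]; first by under eq_fun do rewrite big_nil; exact: measurable_cst.
  under eq_fun do rewrite big_cons; apply: measurable_maxr => //.
  by apply: measurableT_comp (@normr_measurable R setT) _; exact: measurable_funB.
exact: ms.
Qed.

Lemma max_dist_le m (u v : nat -> R) e : 0 <= e ->
  (forall k, `|u k - v k| <= e) -> 0 <= max_dist m u v <= e.
Proof.
move=> e0 uv; rewrite /max_dist; elim/big_ind: _ => [|x y /andP[x0 xe] /andP[y0 ye]|k _].
- by rewrite lexx.
- by rewrite le_max x0 ge_max xe.
- by rewrite normr_ge0 uv.
Qed.

End Measurability.

(** * The off-diagonal part of a heavy-tailed matrix *)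

Section HeavyTailedMatrix.
Context {R : realType} {d : measure_display} {T : measurableType d} (P : probability T R).
Variables (r c : nat -> nat) (V : forall n, 'I_(r n) * 'I_(c n) -> T -> R) (V0 : T -> R).
Hypotheses (mV : forall n e, measurable_fun setT (@V n e)) (mV0 : measurable_fun setT V0).
Hypothesis iidV : forall n, iid_family P (@V n) V0.
Local Notation Ex := (Ex P).
Local Notation E0 h := (Ex (fun w => h (V0 w))).
Local Notation N := (fun n => (r n * c n)%:R : R).
Hypothesis Noo : N n @[n --> \oo] --> +oo.
Local Notation "u ~O x" := (polyO N x u) (at level 70).
Variable alpha : R.
Hypothesis alpha0 : 0 < alpha.
Hypothesis G_gt0 : forall x, 0 < tailP P V0 x.
Hypothesis G_ratio : tailP P V0 (2 * x) / tailP P V0 x @[x --> +oo] --> 2 `^ (- alpha).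
Local Notation G := (tailP P V0).
Local Notation u := alpha^-1.

Lemma near_N_gt0 : \forall n \near \oo, 0 < N n.
Proof.
have N1 := near_ge Noo 1; near=> n; apply: (@lt_le_trans _ _ 1) => //; by near: n.
Unshelve. all: by end_near. Qed.

(** Bounds at a truncation level K become orders of magnitude for K = N^x. *)
Lemma polyO_level (f : R -> R) (M x z : R) : 0 <= M ->
  (forall K, 0 < K -> `|f K| <= M * K `^ z) -> (fun n => f (N n `^ x)) ~O (x * z).
Proof.
move=> M0 H; exists M => //; have N0 := near_N_gt0; near=> n.
by rewrite powRrM; apply: H; rewrite powR_gt0 //; near: n.
Unshelve. all: by end_near. Qed.

(** Since the tail at x is about x^(-alpha), at level N^x it is about N^(-alpha x). *)
Lemma tail_level_exponent (x th : R) : 0 < x -> th < 1 -> 1 - th < alpha * x ->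
  (fun n => G (N n `^ x)) ~O (th - 1).
Proof.
move=> x0 th1 ax.
pose s := (1 - th) / x.
have s0 : 0 < s by rewrite divr_gt0 // subr_gt0.
have sa : s < alpha by rewrite ltr_pdivrMr.
have [M M0 HM] := tail_le mV0 G_gt0 G_ratio (introT andP (conj s0 sa)).
have -> : th - 1 = x * - s by rewrite /s mulrN mulrC divfK ?gt_eqF // opprB.
apply: (polyO_level _ M0) => K K0; rewrite ger0_norm ?HM //.
by rewrite tailP_ge0.
Qed.

(** As a function of the entry, so that counting exceedances is a sum of bounded
    variables. *)
Definition exceed (K : R) : R -> R := \1_[set x : R | K < `|x|].

Lemma exceedE K x : exceed K x = if K < `|x| then 1 else 0.
Proof. by rewrite /exceed indicE; case: ifP => h; [rewrite mem_set | rewrite memNset //= h]. Qed.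

Lemma bounded_exceed K : bounded_rv (exceed K).
Proof.
apply: bounded_rv_indic; rewrite (_ : [set x : R | _] = ~` [set x | `|x| <= K]).
  by apply: measurableC; exact: measurable_normle.
by apply/seteqP; split => x /=; rewrite ltNge => /negP.
Qed.

Lemma Ex_exceed K : E0 (exceed K) = G K.
Proof.
by rewrite -(Ex_tail P mV0).
Qed.

(** The expected number of entries above N^b is about N^(1 - alpha b), which tends to 0. *)
Lemma whp_entries_le (b : R) : u < b ->
  whp P (fun n w => forall it, `|@V n it w| <= N n `^ b).
Proof.
move=> ub; have b0 : 0 < b by rewrite (lt_trans _ ub) // invr_gt0.
have ab : 1 < alpha * b by rewrite mulrC -ltr_pdivrMr ?div1r.
pose th := (1 - alpha * b) / 2.
have th0 : th < 0 by rewrite /th; lra.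
have Gth : (fun n => G (N n `^ b)) ~O (th - 1).
  by apply: tail_level_exponent => //; rewrite /th; lra.
pose X n w := \sum_it exceed (N n `^ b) (@V n it w).
have H : whp P (fun n w => X n w < 1).
  apply: (whp_markov (th := fun=> 1)).
  - move=> n; apply: bounded_rv_sum => it; apply: bounded_rv_comp => //; exact: bounded_exceed.
  - by move=> n w; apply: sumr_ge0 => it _; rewrite exceedE; case: ifP.
  have NG : (fun n => N n * G (N n `^ b)) ~O th.
    have -> : th = 1 + (th - 1) by ring.
    by apply: (polyOM Noo) => //; exact: polyO_id.
  move=> del del0; have H := polyO_small Noo th0 del0 NG.
  near=> n; split => //.
  rewrite /X Ex_sum => [|it]; last by apply: bounded_rv_comp => //; exact: bounded_exceed.
  rewrite (eq_bigr (fun=> G (N n `^ b))) => [|it _]; last first.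
    by rewrite (Ex_coord (@mV n) mV0 (@iidV n)) ?Ex_exceed //; exact: bounded_exceed.
  rewrite sumr_const card_prod !card_ord -[leLHS]mulr_natl.
  apply: le_trans (ler_norm _) _; have : `|N n * G (N n `^ b)| <= del * N n `^ 0 by near: n.
  by rewrite powRr0.
apply: whp_mono H; near=> n => w Xw it; rewrite leNgt; apply/negP => h.
move: Xw; rewrite ltNge => /negP; apply.
rewrite /X (bigD1 it) //= exceedE h lerDl; apply: sumr_ge0 => j _.
by rewrite exceedE; case: ifP.
Unshelve. all: by end_near. Qed.

Hypothesis alpha4 : alpha < 4.
Hypothesis r_growth : forall eta, 0 < eta -> (fun n => (r n)%:R) ~O (1 / 2 + eta).

Let u14 : 1 / 4 < u.
Proof. by rewrite div1r ltf_pV2 ?posrE. Qed.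
Let au : alpha * u = 1. Proof. by rewrite mulfV ?gt_eqF. Qed.

(** No centering is necessary: all entries are below N^b with b slightly above
    1/alpha, and the second moment of the entries so truncated is of order
    N^(2 / alpha - 1) up to a small power.  If alpha <= 1 the truncated mean is of
    order N^(1 / alpha - 1), otherwise it is bounded. *)
Theorem whp_offdiag_infinite_variance : alpha < 2 -> exists2 y, y < 2 * u &
  whp P (fun n w => forall x : 'rV[R]_(r n),
    `|(x *m offdiag (sample_cov (\matrix_(i, t) @V n (i, t) w)) *m x^T) 0 0| <=
      4 * N n `^ y * (x *m x^T) 0 0).
Proof.
move=> a2; have u12 : 1 / 2 < u by rewrite div1r ltf_pV2 ?posrE.
(* The small parameter; all conditions on exponents hold strictly at th = 0, and
   32 is ample for the coefficients of th in them. *)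
pose th := Num.min 1 (2 * u - 1) / 32.
have [th0 th1 th2] : [/\ 0 < th, th <= 1 / 32 & th <= (2 * u - 1) / 32].
  rewrite /th; split; first by rewrite divr_gt0 // lt_min ltr01; lra.
    by rewrite ler_pM2r ?invr_gt0 // ge_min lexx.
  by rewrite ler_pM2r ?invr_gt0 // ge_min lexx orbT.
pose b := u + th; have b0 : 0 < b by rewrite /b; lra.
(* Chosen so that b s = 1 - th, which keeps the exponents linear in th. *)
pose s := (1 - th) / b.
have bs : b * s = 1 - th by rewrite /s mulrC divfK // gt_eqF.
have s0 : 0 < s by rewrite divr_gt0 // subr_gt0; lra.
have sa : s < alpha.
  rewrite ltr_pdivrMr // /b mulrDr au.
  have := mulr_gt0 alpha0 th0; lra.
have K0 n : 0 <= N n `^ b by exact: powR_ge0.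
exists (2 * u - th); first by lra.
have O1 : exists2 o1, 2 + o1 * 4 < (2 * u - th) * 2 & (fun n => E0 (trunc_in (N n `^ b))) ~O o1.
  have [a1|a1] := leP alpha 1.
    have [M M0 HM] := trunc_in_first mV0 G_gt0 G_ratio (introT andP (conj s0 sa)) (le_trans (ltW sa) a1).
    exists (b * (1 - s)); first by rewrite mulrBr bs /b; lra.
    exact: (polyO_level (f := fun K => E0 (trunc_in K)) _ M0).
  have [M M0 HM] := trunc_in_first mV0 G_gt0 G_ratio (introT andP (conj ltr01 a1)) (lexx _).
  exists (b * (1 - 1)); first by lra.
  exact: (polyO_level (f := fun K => E0 (trunc_in K)) _ M0).
have [k1 k1y O1'] := O1.
have [M M0 HM] := trunc_in_second mV0 G_gt0 G_ratio (introT andP (conj s0 sa)) (ltW (lt_trans sa a2)).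
apply: (whp_offdiag mV mV0 iidV Noo (fX := fun=> fun=> 0) (fW := fun n => trunc_in (N n `^ b))
  (B := fun=> 0) (rho := 1 / 2 + th) (e := 0) (xi := 0) (o1 := k1) (o2 := b * (2 - s))).
- by move=> n; exact: bounded_rv_cst.
- by move=> n; rewrite Ex_cst.
- by move=> n x; rewrite normr0.
- by move=> n; exact: bounded_trunc_in.
- apply: whp_mono (whp_entries_le (_ : u < b)); last by rewrite /b; lra.
  by near=> n => w H it; rewrite add0r trunc_inE H.
- exact: r_growth.
- exact: polyO_cst.
- exact: polyO_cst.
- apply: (polyO_level (f := fun K => E0 (fun x => trunc_in K x ^+ 2)) _ M0) => K K1.
  rewrite ger0_norm ?HM //; by apply: Ex_ge0 => w; exact: sqr_ge0.
- exact: O1'.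
all: rewrite ?mulrBr ?bs /b; lra.
Unshelve. all: by end_near. Qed.

(** Truncate at N^t with t slightly below 1/alpha and center: that part has nearly
    bounded variance, and its entries are too small to matter individually.  The
    part between N^t and N^b is rare, with second moment about N^(2 / alpha - 1),
    and because Z is centered the centering constant is at most about
    N^(1 / alpha - 1).
    The condition alpha < 4 is what makes the fluctuations of order N^(1/2) of the
    off-diagonal part negligible. *)
Theorem whp_offdiag_centered : 2 <= alpha -> (\int[P]_w (V0 w)%:E = 0)%E -> exists2 y, y < 2 * u &
  whp P (fun n w => forall x : 'rV[R]_(r n),
    `|(x *m offdiag (sample_cov (\matrix_(i, t) @V n (i, t) w)) *m x^T) 0 0| <=
      4 * N n `^ y * (x *m x^T) 0 0).
Proof.
move=> a2 EV0; have u12 : u <= 1 / 2 by rewrite div1r lef_pV2 ?posrE.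
have h14 := u14; have hau := au; have wle := whp_entries_le.
move: h14 hau u12 wle; move: u => v v14 av v12 wle.
(* The gap 2 v - 1/2 is positive because alpha < 4. *)
pose th := (2 * v - 1 / 2) / 32.
have th0 : 0 < th by rewrite /th; lra.
have th1 : th <= 1 / 64 by rewrite /th; lra.
have thv : 32 * th = 2 * v - 1 / 2 by rewrite /th; lra.
have th_lo : th < 1 by lra.
clearbody th.
pose b := v + th; have b0 : 0 < b by rewrite /b; lra.
pose t := v - th; have t0 : 0 < t by rewrite /t; lra.
have ath : alpha * th < 4 * th by rewrite ltr_pM2r.
pose s := (1 - 4 * th) / t.
have ts : t * s = 1 - 4 * th by rewrite /s mulrC divfK // gt_eqF.
have s1 : 1 <= s by rewrite ler_pdivlMr // /t; lra.
have sa : s < alpha by rewrite ltr_pdivrMr // /t mulrBr av; lra.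
have s0 : 0 < s by lra.
have a1 : 1 < alpha by lra.
have K0 n : 0 <= N n `^ b by exact: powR_ge0.
have J0 n : 0 <= N n `^ t by exact: powR_ge0.
pose mu n := E0 (trunc_in (N n `^ t)).
have bin n := bounded_rv_comp mV0 (bounded_trunc_in (J0 n)).
have bout n := bounded_rv_comp mV0 (bounded_trunc_out (N n `^ t) (K0 n)).
pose fX n x := trunc_in (N n `^ t) x - mu n.
pose fW n x := trunc_out (N n `^ t) (N n `^ b) x + mu n.
have Gt : (fun n => G (N n `^ t)) ~O (4 * th - 1).
  by apply: tail_level_exponent => //; rewrite /t ?mulrBr ?av; lra.
have Omu : mu ~O (v - 1 + 3 * th).
  have [M M0 HM] := trunc_in_centered mV0 G_gt0 G_ratio a1 EV0 (introT andP (conj s1 sa)).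
  have -> : v - 1 + 3 * th = t * (1 - s) by rewrite mulrBr ts /t; ring.
  exact: (polyO_level (f := fun K => E0 (trunc_in K)) _ M0).
have mu_le n : `|mu n| <= N n `^ t.
  by apply: Ex_norm_le => // w; exact: trunc_in_le.
exists (2 * v - th); first by lra.
apply: (whp_offdiag mV mV0 iidV Noo (fX := fX) (fW := fW)
  (B := fun n => N n `^ t + N n `^ t) (rho := 1 / 2 + th) (e := th) (xi := t)
  (o1 := v - 1 + 5 * th) (o2 := 2 * v - 1 + 6 * th)).
- by move=> n; apply: bounded_rvB; [exact: bounded_trunc_in | exact: bounded_rv_cst].
- by move=> n; rewrite /fX ExB ?Ex_cst ?subrr //; exact: bounded_rv_cst.
- by move=> n x; rewrite /fX (le_trans (ler_normB _ _)) // lerD // trunc_in_le.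
- by move=> n; apply: bounded_rvD; [exact: bounded_trunc_out | exact: bounded_rv_cst].
- have N1 := near_ge Noo 1.
  apply: whp_mono (wle b _); last by rewrite /b; lra.
  near=> n => w H it; rewrite /fX /fW addrACA [- _ + _]addNr addr0 -trunc_in_split ?trunc_inE ?H //.
  by rewrite ler_powR /t /b //; [near: n | lra].
- exact: r_growth.
- have [M M0 HM] : exists2 M, 0 <= M & forall K, 0 < K -> E0 (fun x => trunc_in K x ^+ 2) <= M * K `^ (2 - (2 - th)).
    by apply: (trunc_in_second mV0 G_gt0 G_ratio); [apply/andP; split | ]; lra.
  apply: (@polyO_le _ _ Noo (t * (2 - (2 - th)))).
    have -> : 2 - (2 - th) = th by ring.
    by rewrite -[leRHS]mul1r ler_pM2r // /t; lra.
  apply: (@polyO_bound _ _ _ _ (fun n => E0 (fun x => trunc_in (N n `^ t) x ^+ 2))).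
    apply: (polyO_level (f := fun K => E0 (fun x => trunc_in K x ^+ 2)) _ M0) => K K1.
    by rewrite ger0_norm ?HM //; apply: Ex_ge0 => w; exact: sqr_ge0.
  near=> n; rewrite !ger0_norm ?Ex_ge0 //; try by move=> w; exact: sqr_ge0.
  have b2 : bounded_rv (fun w => trunc_in (N n `^ t) (V0 w) ^+ 2) by exact: bounded_rvX.
  have bm : bounded_rv (fun w => 2 * mu n * trunc_in (N n `^ t) (V0 w)) by exact: bounded_rvZ.
  have -> : E0 (fun x => fX n x ^+ 2) =
     Ex (fun w => trunc_in (N n `^ t) (V0 w) ^+ 2 - 2 * mu n * trunc_in (N n `^ t) (V0 w) + mu n ^+ 2).
    by congr (Ex _); apply/funext => w; rewrite /fX; ring.
  rewrite (ExD P (bounded_rvB b2 bm) (bounded_rv_cst _ _)) (ExB P b2 bm) Ex_cst ExZ //.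
  rewrite -/(mu n); have := sqr_ge0 (mu n); rewrite expr2 => h; lra.
- by apply: polyOD; exact: polyO_pow.
- apply: (@polyO_bound _ _ _ _ (fun n => 2 * (N n `^ b) ^+ 2 * G (N n `^ t) + 2 * mu n ^+ 2)).
    apply: polyOD.
      have -> : 2 * v - 1 + 6 * th = 0 + b * 2%:R + (4 * th - 1) by rewrite /b; ring.
      apply: (polyOM Noo) => //; apply: (polyOM Noo); first exact: polyO_cst.
      by apply: polyOX; exact: polyO_pow.
    apply: (@polyO_le _ _ Noo (0 + (v - 1 + 3 * th) * 2%:R)); first by lra.
    by apply: (polyOM Noo); [exact: polyO_cst | exact: polyOX].
  near=> n; rewrite ger0_norm; last by apply: Ex_ge0 => w; exact: sqr_ge0.
  apply: le_trans (ler_norm _).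
  have b2 : bounded_rv (fun w => trunc_out (N n `^ t) (N n `^ b) (V0 w) ^+ 2) by exact: bounded_rvX.
  apply: (@le_trans _ _ (Ex (fun w => 2 * trunc_out (N n `^ t) (N n `^ b) (V0 w) ^+ 2 + 2 * mu n ^+ 2))).
    apply: Ex_le.
    - by apply: bounded_rvX; apply: bounded_rvD => //; exact: bounded_rv_cst.
    - by apply: bounded_rvD; [exact: bounded_rvZ | exact: bounded_rv_cst].
    move=> w; rewrite /fW -subr_ge0.
    rewrite (_ : _ - _ = (trunc_out (N n `^ t) (N n `^ b) (V0 w) - mu n) ^+ 2); last by ring.
    exact: sqr_ge0.
  rewrite (ExD P (bounded_rvZ _ b2) (bounded_rv_cst _ _)) Ex_cst ExZ //.
  by rewrite lerD2r -mulrA ler_pM2l // trunc_out_second.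
- have -> : (fun n => E0 (fW n)) = (fun n => E0 (trunc_out (N n `^ t) (N n `^ b)) + mu n).
    by apply/funext => n; rewrite ExD ?Ex_cst //; exact: bounded_rv_cst.
  apply: polyOD; last by apply: (@polyO_le _ _ Noo (v - 1 + 3 * th)) => //; lra.
  apply: (@polyO_bound _ _ _ _ (fun n => N n `^ b * G (N n `^ t))).
    have -> : v - 1 + 5 * th = b + (4 * th - 1) by rewrite /b; ring.
    by apply: (polyOM Noo) => //; exact: polyO_pow.
  near=> n; apply: le_trans (ler_norm _); exact: trunc_out_first.
all: rewrite ?/t; lra.
Unshelve. all: by end_near. Qed.

Theorem whp_offdiag_heavy : (2 <= alpha -> (\int[P]_w (V0 w)%:E = 0)%E) -> exists2 y, y < 2 * u &
  whp P (fun n w => forall x : 'rV[R]_(r n),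
    `|(x *m offdiag (sample_cov (\matrix_(i, t) @V n (i, t) w)) *m x^T) 0 0| <=
      4 * N n `^ y * (x *m x^T) 0 0).
Proof.
move=> EV0; have [a2|a2] := leP 2 alpha; first by apply: whp_offdiag_centered => //; exact: EV0.
exact: whp_offdiag_infinite_variance.
Qed.

End HeavyTailedMatrix.

(** * One large entry per row *)

(** A row whose sum of squares is at least v + e contains an entry of square at
    least v, since its entries other than the large one contribute at most e;
    conversely entries of square at least v + e lie in different rows.  This gives
    injections between the two sets that are counted. *)
Lemma row_sumsq_single_entry (R : realType) (p q : nat) (M : 'M[R]_(p, q)) (tau e : R) :
  0 <= tau -> tau ^+ 2 <= e ->
  (forall i t t', tau < `|M i t| -> tau < `|M i t'| -> t = t') ->
  (forall i, \sum_t trunc_in tau (M i t) ^+ 2 <= e) ->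
  forall k, `|order_stat (row_sumsq M) k - order_stat (entry_sq M) k| <= e.
Proof.
move=> tau0 tau_e single small k.
have e0 : 0 <= e by rewrite (le_trans _ tau_e) // sqr_ge0.
have row0 i : 0 <= row_sumsq M i by apply: sumr_ge0 => t _; exact: sqr_ge0.
have ent0 it : 0 <= entry_sq M it by exact: sqr_ge0.
have big_row i v : 0 < v -> v + e <= row_sumsq M i -> exists t, v <= M i t ^+ 2.
  move=> v0 hv.
  have [[t ht]|none] := pselect (exists t, tau < `|M i t|).
    exists t; rewrite -(lerD2r e) (le_trans hv) // /row_sumsq (bigD1 t) //= lerD2l.
    apply: le_trans (small i); rewrite [leRHS](bigD1 t) //= ler_wpDl ?sqr_ge0 //.
    apply: ler_sum => t' t't; rewrite trunc_inE ifT // leNgt; apply/negP => ht'.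
    by rewrite (single i t' t ht' ht) eqxx in t't.
  have : row_sumsq M i <= e.
    apply: le_trans (small i); apply: ler_sum => t _; rewrite trunc_inE ifT // leNgt.
    by apply/negP => ht; apply: none; exists t.
  by move=> h; move: (le_trans hv h); rewrite gerDr leNgt v0.
rewrite ler_distl; apply/andP; split.
  rewrite lerBlDr; apply: order_stat_le => // v v0.
  set A := [pred it | _]; have inj : {in A &, injective (fst : 'I_p * 'I_q -> 'I_p)}.
    move=> [i t] [i' t']; rewrite !inE /entry_sq /= => h h' ii'; subst i'.
    have big s : v + e <= M i s ^+ 2 -> tau < `|M i s|.
      rewrite -[M i s ^+ 2]real_normK ?num_real // => hs; rewrite ltNge; apply/negP => hh.
      have : `|M i s| ^+ 2 <= tau ^+ 2 by rewrite lerXn2r ?nnegrE.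
      by move=> /(le_trans hs) /le_trans /(_ tau_e); rewrite gerDr leNgt v0.
    by rewrite (single i t t' (big _ h) (big _ h')).
  rewrite -(card_in_image inj); apply: subset_leq_card; apply/fintype.subsetP => i.
  move=> /fintype.imageP [[i' t]]; rewrite !inE /entry_sq /= => h -> /=.
  rewrite (le_trans _ (_ : M i' t ^+ 2 <= _)) ?(le_trans _ h) ?lerDl //.
  by rewrite /row_sumsq (bigD1 t) //= lerDl; apply: sumr_ge0 => s _; exact: sqr_ge0.
apply: order_stat_le => // v v0.
set A := [pred i | _].
have [q0|q0] := posnP q.
  rewrite (_ : #|A| = 0%N) //; apply: eq_card0 => i; rewrite !inE; apply/negP => /(big_row _ _ v0) [t _].
  by move: t; rewrite q0 => -[].
pose t0 : 'I_q := Ordinal q0.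
pose f (i : 'I_p) : 'I_p * 'I_q := (i, odflt t0 [pick t | v <= M i t ^+ 2]).
have inj : {in A &, injective f} by move=> i j _ _ [].
rewrite -(card_in_image inj); apply: subset_leq_card; apply/fintype.subsetP => it.
move=> H; case: (elimT (@mapP _ _ f (enum A) it) H) => i; rewrite mem_enum !inE => hi -> /=; rewrite /entry_sq /=.
case: pickP => //= none; have [t ht] := big_row _ _ v0 hi.
by rewrite none in ht.
Qed.

Section SingleBigEntry.
Context {R : realType} {d : measure_display} {T : measurableType d} (P : probability T R).
Variables (r c : nat -> nat) (V : forall n, 'I_(r n) * 'I_(c n) -> T -> R) (V0 : T -> R).
Hypotheses (mV : forall n e, measurable_fun setT (@V n e)) (mV0 : measurable_fun setT V0).
Hypothesis iidV : forall n, iid_family P (@V n) V0.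
Local Notation Ex := (Ex P).
Local Notation E0 h := (Ex (fun w => h (V0 w))).
Local Notation N := (fun n => (r n * c n)%:R : R).
Hypothesis Noo : N n @[n --> \oo] --> +oo.
Local Notation "u ~O x" := (polyO N x u) (at level 70).
Variable alpha : R.
Hypotheses (alpha0 : 0 < alpha) (alpha4 : alpha < 4).
Hypothesis G_gt0 : forall x, 0 < tailP P V0 x.
Hypothesis G_ratio : tailP P V0 (2 * x) / tailP P V0 x @[x --> +oo] --> 2 `^ (- alpha).
Local Notation G := (tailP P V0).

(** The expected number of pairs of large entries in a common row is at most
    r c^2 G^2 = N c G^2. *)
Lemma whp_single_big (t th kap : R) : 0 < t -> th < 1 -> 1 - th < alpha * t ->
  (fun n => (c n)%:R) ~O kap -> kap + th * 2 < 1 ->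
  whp P (fun n w => forall i t1 t2,
    N n `^ t < `|@V n (i, t1) w| -> N n `^ t < `|@V n (i, t2) w| -> t1 = t2).
Proof.
move=> t0 th1 hth Oc hk; have Gt := tail_level_exponent mV0 Noo G_gt0 G_ratio t0 th1 hth.
pose K n := N n `^ t.
pose X n w := \sum_i \sum_t1 \sum_(t2 | t2 != t1)
   exceed (K n) (@V n (i, t1) w) * exceed (K n) (@V n (i, t2) w).
have be n e : bounded_rv (fun w => exceed (K n) (@V n e w)).
  by apply: bounded_rv_comp => //; exact: bounded_exceed.
have bterm n e1 e2 := bounded_rvM (be n e1) (be n e2).
have ex0 n e w : 0 <= exceed (K n) (@V n e w) by rewrite exceedE; case: ifP.
have H : whp P (fun n w => X n w < 1).
  apply: (whp_markov (th := fun=> 1)).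
  - by move=> n; do 3! (apply: bounded_rv_sum => ?); exact: bterm.
  - by move=> n w; do 3! (apply: sumr_ge0 => ? _); exact: mulr_ge0.
  have NG : (fun n => N n * (c n)%:R * G (K n) ^+ 2) ~O (kap + th * 2 - 1).
    have -> : kap + th * 2 - 1 = 1 + kap + (th - 1) * 2%:R by ring.
    apply: (polyOM Noo); last exact: polyOX.
    by apply: (polyOM Noo) => //; exact: polyO_id.
  move=> del del0; have k0 : kap + th * 2 - 1 < 0 by lra.
  have H := polyO_small Noo k0 del0 NG.
  near=> n; split => //.
  have pair i t1 t2 : t2 != t1 ->
      Ex (fun w => exceed (K n) (@V n (i, t1) w) * exceed (K n) (@V n (i, t2) w)) = G (K n) ^+ 2.
    move=> t21; rewrite (Ex_indep (@mV n) mV0 (@iidV n) (J := [set (i, t1)]%SET) (K := [set (i, t2)]%SET)).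
    - by rewrite !(Ex_coord (@mV n) mV0 (@iidV n)) ?Ex_exceed //; exact: bounded_exceed.
    - move=> e; rewrite !inE => /eqP ->; rewrite xpair_eqE eqxx /=; by rewrite eq_sym.
    - by apply: pspan_coord => //; [rewrite inE | exact: bounded_exceed].
    - by apply: pspan_coord => //; [rewrite inE | exact: bounded_exceed].
  rewrite /X Ex_sum; last by move=> i; do 2! (apply: bounded_rv_sum => ?); exact: bterm.
  apply: (@le_trans _ _ (\sum_(i < r n) \sum_(t1 < c n) \sum_(t2 < c n) G (K n) ^+ 2)).
    apply: ler_sum => i _; rewrite Ex_sum; last by move=> t1; apply: bounded_rv_sum => ?; exact: bterm.
    apply: ler_sum => t1 _; rewrite Ex_sum //.
    rewrite (eq_bigr _ (pair i t1)) [leRHS](bigID (fun t2 => t2 != t1)) /= lerDl.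
    by apply: sumr_ge0 => t2 _; exact: sqr_ge0.
  rewrite !sumr_const !card_ord -!mulrnA -[leLHS]mulr_natl.
  rewrite (_ : (c n * (c n * r n))%:R = N n * (c n)%:R); last by rewrite !natrM; ring.
  apply: le_trans (ler_norm _) _.
  have : `|N n * (c n)%:R * G (K n) ^+ 2| <= del * N n `^ 0 by near: n.
  by rewrite powRr0.
apply: whp_mono H; near=> n => w Xw i t1 t2 h1 h2; apply/eqP; rewrite -[_ == _]negbK; apply/negP => t12.
move: Xw; rewrite ltNge => /negP; apply.
rewrite /X (bigD1 i) //= (bigD1 t1) //= (bigD1 t2) /=; last by rewrite eq_sym.
rewrite !exceedE h1 h2 mulr1 -!addrA lerDl addr_ge0 ?addr_ge0 //.
- by apply: sumr_ge0 => ? _; exact: mulr_ge0.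
- by do 2! (apply: sumr_ge0 => ? _); exact: mulr_ge0.
by do 3! (apply: sumr_ge0 => ? _); exact: mulr_ge0.
Unshelve. all: by end_near. Qed.

(** The union bound over the rows costs a factor N at most, which a high enough
    moment of the row sums absorbs. *)
Lemma whp_small_rows (t x z : R) : (fun n => (r n)%:R) ~O 1 ->
  (fun n => (c n)%:R * E0 (fun y => trunc_in (N n `^ t) y ^+ 2)) ~O x -> t * 2 <= x -> x < z ->
  whp P (fun n w => forall i, \sum_s trunc_in (N n `^ t) (@V n (i, s) w) ^+ 2 <= N n `^ z).
Proof.
move=> Or Ox tx xz; pose K n := N n `^ t.
have K0 n : 0 <= K n by exact: powR_ge0.
(* The order of the moment: the factor N of the union bound is beaten once
   m (z - x) > 1. *)
pose m := (Num.truncn (z - x)^-1).+1.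
have zx : 0 < z - x by rewrite subr_gt0.
have hm : 1 < m%:R * (z - x).
  have zxi : 0 <= (z - x)^-1 by rewrite invr_ge0 ltW.
  by rewrite -ltr_pdivrMr // div1r; have /andP[] := truncn_itv zxi.
pose g n y := trunc_in (K n) y ^+ 2.
have bg n : bounded_rv (g n) by apply: bounded_rvX; exact: bounded_trunc_in.
have gK n y : 0 <= g n y <= K n ^+ 2.
  rewrite /g sqr_ge0 -[leLHS](real_normK (num_real _)) lerXn2r ?nnegrE //.
  exact: trunc_in_le.
have bgV n e : bounded_rv (fun w => g n (@V n e w)) by exact: bounded_rv_comp.
pose S n i w := \sum_(s < c n) g n (@V n (i, s) w).
have S0 n i w : 0 <= S n i w by apply: sumr_ge0 => s _; exact: sqr_ge0.
have H : whp P (fun n w => \sum_i S n i w ^+ m < (N n `^ z) ^+ m).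
  apply: whp_markov.
  - by move=> n; apply: bounded_rv_sum => i; apply: bounded_rvX; exact: bounded_rv_sum.
  - by move=> n w; apply: sumr_ge0 => i _; exact: exprn_ge0.
  have O : (fun n => (r n)%:R * ((moment_cst m)%:R * ((c n)%:R * E0 (g n) + K n ^+ 2) ^+ m)) ~O
      (1 + (0 + x * m%:R)).
    apply: (polyOM Noo) => //; apply: (polyOM Noo); first exact: polyO_cst.
    apply: polyOX; apply: polyOD => //; apply: (polyO_le Noo tx).
    by apply: polyOX; exact: polyO_pow.
  have lt : 1 + (0 + x * m%:R) < z * m%:R by rewrite mulrC mulrBl in hm; lra.
  move=> del del0; have H := polyO_small Noo lt del0 O; have p0 := pow_gt0 Noo z.
  near=> n; split; first by rewrite exprn_gt0 //; near: n.
  rewrite Ex_sum => [|i]; last by apply: bounded_rvX; exact: bounded_rv_sum.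
  apply: (@le_trans _ _ (\sum_(i < r n) ((moment_cst m)%:R * ((c n)%:R * E0 (g n) + K n ^+ 2) ^+ m))).
    apply: ler_sum => i _.
    pose J : {set 'I_(r n) * 'I_(c n)} := [set (i, s) | s in 'I_(c n)]%SET.
    have inj : injective (fun s : 'I_(c n) => (i, s)) by move=> s s' [].
    have := sum_moment_le (@mV n) mV0 (@iidV n) m J (bg n) (gK n) (lexx _).
    rewrite card_imset // card_ord; apply: le_trans; rewrite le_eqVlt; apply/orP; left; apply/eqP.
    congr (Ex _); apply/funext => w; rewrite /J big_imset //=.
    by move=> s s' _ _; exact: inj.
  rewrite sumr_const card_ord -[leLHS]mulr_natl.
  by rewrite powRX; apply: le_trans (ler_norm _) _; near: n.
apply: whp_mono H; near=> n => w Hw i.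
have Nz : 0 <= N n `^ z by exact: powR_ge0.
rewrite -[leLHS]/(S n i w) leNgt; apply/negP => h.
move: Hw; rewrite ltNge => /negP; apply; rewrite (bigD1 i) //= ler_wpDr //.
  by apply: sumr_ge0 => j _; exact: exprn_ge0.
by rewrite lerXn2r ?nnegrE // ltW.
Unshelve. all: by end_near. Qed.

(** The columns must be few enough both for the uniqueness of the large entry
    (kap < 1) and for the mean of the small part of a row, which is c times a
    truncated second moment (kap < 2 / alpha). *)
Theorem whp_rows_entries (kap : R) : (fun n => (r n)%:R) ~O 1 ->
  0 <= kap -> kap < 1 -> kap < 2 * alpha^-1 -> (fun n => (c n)%:R) ~O kap ->
  exists2 z, z < 2 * alpha^-1 & whp P (fun n w => forall k,
    `|order_stat (row_sumsq (\matrix_(i, t) @V n (i, t) w)) k -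
      order_stat (entry_sq (\matrix_(i, t) @V n (i, t) w)) k| <= N n `^ z).
Proof.
move=> Or k0 k1 ku Oc.
have au : alpha * alpha^-1 = 1 by rewrite mulfV ?gt_eqF.
have u0 : 0 < alpha^-1 by rewrite invr_gt0.
have u2 : 2 <= alpha -> alpha^-1 <= 1 / 2 by move=> h; rewrite div1r lef_pV2 ?posrE.
move: au u0 u2 ku; move: (alpha^-1) => u au u0 u2 ku.
pose th := Num.min (1 - kap) (Num.min (2 * u - kap) u) / 16.
have [th0 tk tku tu] : [/\ 0 < th, th <= (1 - kap) / 16, th <= (2 * u - kap) / 16 & th <= u / 16].
  have i16 : (0 : R) < 16^-1 by rewrite invr_gt0.
  rewrite /th !ler_pM2r // !ge_min !lexx !orbT; split => //.
  by rewrite divr_gt0 // !lt_min u0 !subr_gt0 k1 ku.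
clearbody th.
pose t := u - th; have t0 : 0 < t by rewrite /t; lra.
have ath : alpha * th < 4 * th by rewrite ltr_pM2r.
have single := whp_single_big (t := t) (th := 4 * th) (kap := kap) t0 _ _ Oc _.
pose s := (1 - 4 * th) / t.
have ts : t * s = 1 - 4 * th by rewrite /s mulrC divfK // gt_eqF.
have s0 : 0 < s by rewrite divr_gt0 //; lra.
have sa : s < alpha by rewrite ltr_pdivrMr // /t mulrBr au; lra.
have [x [xu tx Ox]] : exists x, [/\ x < 2 * u, t * 2 <= x &
   (fun n => (c n)%:R * E0 (fun y => trunc_in (N n `^ t) y ^+ 2)) ~O x].
  have lev s' : 0 < s' < alpha -> s' <= 2 ->
      (fun n => (c n)%:R * E0 (fun y => trunc_in (N n `^ t) y ^+ 2)) ~O (kap + t * (2 - s')).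
    move=> h1 h2; apply: (polyOM Noo) => //.
    have [M M0 HM] := trunc_in_second mV0 G_gt0 G_ratio h1 h2.
    apply: (polyO_level Noo (f := fun K => E0 (fun x => trunc_in K x ^+ 2)) _ M0) => K K1.
    by rewrite ger0_norm ?HM //; apply: Ex_ge0 => w; exact: sqr_ge0.
  have [x xu Ox] : exists2 x, x < 2 * u &
      (fun n => (c n)%:R * E0 (fun y => trunc_in (N n `^ t) y ^+ 2)) ~O x.
    have [a2|a2] := leP 2 alpha.
      exists (kap + t * (2 - (2 - th))); last by apply: lev; [apply/andP; split|]; lra.
      have -> : 2 - (2 - th) = th by ring.
      have : t * th <= 1 * th by rewrite ler_pM2r // /t; have := u2 a2; lra.
      lra.
    exists (kap + t * (2 - s)); last by apply: lev; [rewrite s0 sa | rewrite ltW // (lt_trans sa)].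
    by rewrite mulrBr ts /t; lra.
  exists (Num.max x (t * 2)); split.
  - by rewrite gt_max xu /t; lra.
  - by rewrite le_max lexx orbT.
  - by apply: polyO_le Ox => //; rewrite le_max lexx.
pose z := (x + 2 * u) / 2.
have xz : x < z by rewrite /z; lra.
have small := whp_small_rows Or Ox tx xz.
exists z; first by rewrite /z; lra.
have N1 := near_ge Noo 1.
apply: whp_mono (whp_and (single _ _ _) small); [|lra|rewrite /t mulrBr au; lra|lra].
near=> n; have N1n : 1 <= N n by near: n.
move=> w [h1 h2] k.
apply: (@row_sumsq_single_entry _ _ _ _ (N n `^ t)).
- exact: powR_ge0.
- by rewrite powRX ler_powR //; lra.
- by move=> i s1 s2; rewrite !mxE; exact: h1.
- by move=> i; under eq_bigr do rewrite mxE; exact: h2.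
Unshelve. all: by end_near. Qed.

End SingleBigEntry.

(** * Comparison at the scale of the norming sequence *)

Section Comparison.
Context {R : realType} {d : measure_display} {T : measurableType d} (P : probability T R).
Variables (r c : nat -> nat) (V : forall n, 'I_(r n) * 'I_(c n) -> T -> R) (V0 : T -> R).
Hypotheses (mV : forall n e, measurable_fun setT (@V n e)) (mV0 : measurable_fun setT V0).
Hypothesis iidV : forall n, iid_family P (@V n) V0.
Local Notation N := (fun n => (r n * c n)%:R : R).
Hypothesis Noo : N n @[n --> \oo] --> +oo.
Local Notation "u ~O x" := (polyO N x u) (at level 70).
Variable alpha : R.
Hypotheses (alpha0 : 0 < alpha) (alpha4 : alpha < 4).
Hypothesis G_gt0 : forall x, 0 < tailP P V0 x.
Hypothesis G_ratio : tailP P V0 (2 * x) / tailP P V0 x @[x --> +oo] --> 2 `^ (- alpha).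
Hypothesis centered : 2 <= alpha -> (\int[P]_w (V0 w)%:E = 0)%E.
Hypothesis r_growth : forall eta, 0 < eta -> (fun n => (r n)%:R) ~O (1 / 2 + eta).
Variable a : nat -> R.
Hypothesis a_norm : tailP P V0 (a k) / k%:R^-1 @[k --> \oo] --> (1 : R).
Local Notation A n := (a (r n * c n)%N).
Local Notation M n w := (\matrix_(i, t) @V n (i, t) w).

(** Powers of N below 2 / alpha are negligible at the scale of the theorem. *)
Lemma norming_dominates (y eps : R) : y < 2 * alpha^-1 -> 0 < eps ->
  \forall n \near \oo, N n `^ y <= eps * A n ^+ 2.
Proof.
move=> yu eps0; have u0 : 0 < alpha^-1 by rewrite invr_gt0.
(* y may be negative, whereas norming_lower needs a positive exponent. *)
pose y' := Num.max y (alpha^-1).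
have y'u : y' < 2 * alpha^-1 by rewrite gt_max yu; lra.
have y'0 : 0 < y' by rewrite lt_max u0 orbT.
pose th := (y' / 2 + alpha^-1) / 2.
have th0 : 0 < th by rewrite /th; lra.
have thu : th < alpha^-1 by rewrite /th; lra.
have y'th : y' < th * 2%:R by rewrite /th; lra.
have [K _ HK] := norming_lower mV0 alpha0 G_gt0 G_ratio th0 thu a_norm.
have H := polyO_small Noo y'th eps0 (polyO_pow _ y').
have N1 := near_ge Noo 1; have NK := near_ge Noo K%:R.
near=> n; have N1n : 1 <= N n by near: n.
apply: (@le_trans _ _ (N n `^ y')); first by rewrite ler_powR // le_max lexx.
rewrite (le_trans (ler_norm _)) // (@le_trans _ _ (eps * N n `^ (th * 2%:R))) //; first by near: n.
rewrite ler_pM2l // -powRX lerXn2r ?nnegrE ?powR_ge0 //.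
  apply: le_trans (powR_ge0 _ _) (HK _ _) => /=; rewrite -(ler_nat R); by near: n.
apply: HK => /=; rewrite -(ler_nat R); by near: n.
Unshelve. all: by end_near. Qed.

Lemma norming_gt0 : \forall n \near \oo, 0 < A n ^+ 2.
Proof.
have u0 : 0 < alpha^-1 by rewrite invr_gt0.
have yu : alpha^-1 < 2 * alpha^-1 by lra.
have H := norming_dominates yu ltr01; have p0 := pow_gt0 Noo alpha^-1.
near=> n; rewrite -[ltRHS]mul1r; apply: (@lt_le_trans _ _ (N n `^ alpha^-1)); by near: n.
Unshelve. all: by end_near. Qed.

Theorem whp_eigenvalue_row_sumsq (eps : R) : 0 < eps -> whp P (fun n w => forall k,
  `|ordered_eigenvalue (M n w) k - order_stat (row_sumsq (M n w)) k| <= eps * A n ^+ 2).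
Proof.
move=> eps0.
have [y yu H] := whp_offdiag_heavy mV mV0 iidV Noo alpha0 G_gt0 G_ratio alpha4 r_growth centered.
have eps4 : 0 < eps / 4 by rewrite divr_gt0.
have D := norming_dominates yu eps4.
apply: whp_mono H; near=> n => w Hw k.
have hD : N n `^ y <= eps / 4 * A n ^+ 2 by near: n.
apply: le_trans (weyl_diag _ Hw k) _; first by rewrite mulr_ge0 // powR_ge0.
have -> : eps * A n ^+ 2 = 4 * (eps / 4 * A n ^+ 2) by field.
by rewrite ler_pM2l.
Unshelve. all: by end_near. Qed.

Theorem whp_eigenvalue_entry_sq (kap eps : R) :
  0 <= kap -> kap < 1 -> kap < 2 * alpha^-1 -> (fun n => (c n)%:R) ~O kap -> 0 < eps ->
  whp P (fun n w => forall k,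
  `|ordered_eigenvalue (M n w) k - order_stat (entry_sq (M n w)) k| <= eps * A n ^+ 2).
Proof.
move=> k0 k1 ku Oc eps0.
have Or : (fun n => (r n)%:R) ~O 1.
  have h2 : (0 : R) < 1 / 2 by rewrite divr_gt0.
  by have := r_growth h2; rewrite -splitr.
have [z zu H] := whp_rows_entries mV mV0 iidV Noo alpha0 alpha4 G_gt0 G_ratio Or k0 k1 ku Oc.
have eps2 : 0 < eps / 2 by rewrite divr_gt0.
have D := norming_dominates zu eps2.
apply: whp_mono (whp_and (whp_eigenvalue_row_sumsq eps2) H); near=> n => w [h1 h2] k.
have hD : N n `^ z <= eps / 2 * A n ^+ 2 by near: n.
rewrite (splitr eps) mulrDl; apply: le_trans (ler_distD (order_stat (row_sumsq (M n w)) k) _ _) _.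
by rewrite lerD // (le_trans (h2 k)).
Unshelve. all: by end_near. Qed.

End Comparison.

Lemma cvg_max_dist (R : realType) d (T : measurableType d) (P : probability T R)
    (m : nat -> nat) (f g : nat -> T -> nat -> R) (A : nat -> R) :
  (forall n k, measurable_fun setT (fun w => f n w k)) ->
  (forall n k, measurable_fun setT (fun w => g n w k)) ->
  (\forall n \near \oo, 0 < A n ^+ 2) ->
  (forall eps, 0 < eps -> whp P (fun n w => forall k, `|f n w k - g n w k| <= eps * A n ^+ 2)) ->
  cvg_in_probability P (fun n w => A n ^- 2 * max_dist (m n) (f n w) (g n w)) 0.
Proof.
move=> mf mg A0 H; apply: whp_cvg0 => [n|eps eps0].
  apply: measurable_funM; first exact: measurable_cst.
  exact: (@measurable_max_dist R _ _ (m n) (fun k w => f n w k) (fun k w => g n w k)).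
apply: whp_mono (H _ eps0); near=> n => w Hw.
have An : 0 < A n ^+ 2 by near: n.
have e0 : 0 <= eps * A n ^+ 2 by rewrite mulr_ge0 // ltW.
have /andP[h1 h2] := max_dist_le (m n) e0 Hw.
rewrite ger0_norm; last by rewrite mulr_ge0 // invr_ge0 ltW.
by rewrite mulrC ler_pdivrMr.
Unshelve. all: by end_near. Qed.

(** * Growth of the dimension *)

Section Growth.
Context {R : realType}.
Variables (beta : R) (ell : R -> R) (p : nat -> nat).
Hypotheses (beta_ge0 : 0 <= beta) (ell_sv : slowly_varying ell).
Hypothesis p_growth : forall n : nat, (1 <= n)%N -> (p n)%:R = n%:R `^ beta * ell n%:R.

Lemma dimension_bounds (eta : R) : 0 < eta ->
  \forall n \near \oo, (n%:R : R) `^ (beta - eta) <= (p n)%:R <= n%:R `^ (beta + eta).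
Proof.
move=> eta0; have H := slowly_varying_pow ell_sv eta0; near=> n.
have n0 : (0 < n)%N by near: n; exact: nbhs_infty_gt.
have n0R : 0 < n%:R :> R by rewrite ltr0n.
rewrite p_growth // !powR_add // !ler_pM2l ?powR_gt0 //; by near: n.
Unshelve. all: by end_near. Qed.

Lemma dimension_product_ge (N : nat -> R) : (forall n, N n = (n * p n)%:R) ->
  forall eta, 0 < eta -> \forall n \near \oo, (n%:R : R) `^ (1 + beta - eta) <= N n.
Proof.
move=> NE eta eta0; have H := dimension_bounds eta0; near=> n.
have n0R : 0 < n%:R :> R by rewrite ltr0n; near: n; exact: nbhs_infty_gt.
have /andP[h _] : (n%:R : R) `^ (beta - eta) <= (p n)%:R <= n%:R `^ (beta + eta) by near: n.
by rewrite NE natrM -addrA powR_add // powRr1 ?ler_pM2l // ltW.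
Unshelve. all: by end_near. Qed.

Lemma dimension_product_pinfty (N : nat -> R) : (forall n, N n = (n * p n)%:R) ->
  N n @[n --> \oo] --> +oo.
Proof.
move=> NE; have b2 : 1 / 2 <= 1 + beta - 1 / 2 by have := beta_ge0; lra.
apply/cvgryPge => A; have h2 : 0 < (1 : R) / 2 by rewrite divr_gt0.
have H := dimension_product_ge NE h2; near=> n.
have n1 : 1 <= n%:R :> R by near: n; exact: nbhs_infty_ger.
have h : (n%:R : R) `^ (1 + beta - 1 / 2) <= N n by near: n.
apply: le_trans h; apply: (@le_trans _ _ (n%:R `^ (1 / 2))); last by rewrite ler_powR.
have nA : (Num.max A 1) ^+ 2 <= n%:R :> R by near: n; exact: nbhs_infty_ger.
have M1 : 1 <= Num.max A 1 by rewrite le_max lexx orbT.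
apply: (@le_trans _ _ (Num.max A 1)); first by rewrite le_max lexx.
have -> : Num.max A 1 = (Num.max A 1 ^+ 2) `^ (1 / 2).
  rewrite -powR_mulrn; last by lra.
  by rewrite -powRrM mulrC divfK // powRr1 //; lra.
by rewrite ge0_ler_powR ?nnegrE ?sqr_ge0 // ltW.
Unshelve. all: by end_near. Qed.

(** The number of entries is n p_n = n^(1 + beta) up to a small power, so n^b is
    N^(b / (1 + beta)) up to a small power. *)
Lemma polyO_power_of_n (N : nat -> R) (v : nat -> R) (b x : R) : (forall n, N n = (n * p n)%:R) ->
  (forall n, 0 <= v n) ->
  (forall eta, 0 < eta -> \forall n \near \oo, v n <= n%:R `^ (b + eta)) ->
  0 <= x -> b < (1 + beta) * x -> polyO N x v.
Proof.
move=> NE v0 H x0 bx; pose eta := ((1 + beta) * x - b) / (1 + x).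
have x1 : 0 < 1 + x by lra.
have eta0 : 0 < eta by rewrite divr_gt0 // subr_gt0.
have etaE : b + eta = (1 + beta - eta) * x.
  have : eta * (1 + x) = (1 + beta) * x - b by rewrite /eta divfK // gt_eqF.
  by clearbody eta; lra.
have H1 := H _ eta0; have H2 := dimension_product_ge NE eta0.
exists 1 => //; near=> n; rewrite mul1r ger0_norm //.
apply: (@le_trans _ _ (n%:R `^ (b + eta))); first by near: n.
rewrite etaE powRrM ge0_ler_powR ?nnegrE ?powR_ge0 //; last by near: n.
by rewrite NE.
Unshelve. all: by end_near. Qed.

Lemma polyO_dimension (N : nat -> R) (x : R) : (forall n, N n = (n * p n)%:R) ->
  0 <= x -> beta < (1 + beta) * x -> polyO N x (fun n => (p n)%:R).
Proof.
move=> NE; apply: polyO_power_of_n NE _ _ => // eta eta0.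
have H := dimension_bounds eta0; near=> n.
have /andP[] // : (n%:R : R) `^ (beta - eta) <= (p n)%:R <= n%:R `^ (beta + eta) by near: n.
Unshelve. all: by end_near. Qed.

Lemma polyO_sample_size (N : nat -> R) (x : R) : (forall n, N n = (n * p n)%:R) ->
  0 <= x -> 1 < (1 + beta) * x -> polyO N x (fun n => n%:R).
Proof.
move=> NE; apply: polyO_power_of_n NE _ _ => // eta eta0; near=> n.
have n1 : 1 <= n%:R :> R by near: n; exact: nbhs_infty_ger.
by rewrite -[leLHS]powRr1 // ler_powR // lerDl ltW.
Unshelve. all: by end_near. Qed.

End Growth.

(** * Independence and transposition *)

Section IidFamily.
Context {R : realType} {d : measure_display} {T : measurableType d} (P : probability T R).

Lemma independent_iid_family (E : finType) (X : E -> {RV P >-> R}) (Z : {RV P >-> R}) :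
  mutually_independent X -> (forall e, identically_distributed (X e) Z) ->
  iid_family P (fun e => X e : T -> R) Z.
Proof.
move=> ind idd B mB; rewrite ind //.
rewrite (eq_bigr (fun e => (fine (P (Z @^-1` B e)))%:E)) ?prodEFin // => e _.
rewrite fineK; first exact: idd.
by apply: fin_num_measure; exact: measurable_preimage.
Qed.

Lemma iid_family_swap (p q : nat) (X : 'I_p * 'I_q -> T -> R) (Z : T -> R) :
  iid_family P X Z -> iid_family P (fun e => X (e.2, e.1)) Z.
Proof.
move=> H B mB; have HB := H (fun e => B (e.2, e.1)) (fun e => mB _).
rewrite [RHS](reindex (fun e : 'I_p * 'I_q => (e.2, e.1))) /=; last first.
  by exists (fun e => (e.2, e.1)) => -[].
rewrite -HB; congr (fine (P _)); apply/seteqP; split => w h [i t] _ /=.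
  exact: (h (t, i) I).
exact: (h (t, i) I).
Qed.

End IidFamily.

Lemma order_stat_reindex (R : realType) (I J : finType) (f : I -> R) (s : J -> I) k :
  bijective s -> order_stat (fun j => f (s j)) k = order_stat f k.
Proof.
move=> bs; rewrite /order_stat; congr nth; apply/perm_sortP.
- by move=> x y; exact: le_total.
- by move=> x y z /= xy yz; exact: le_trans yz xy.
- by move=> x y /andP[/= xy yx]; apply: le_anti; rewrite xy yx.
have -> : [seq f (s i) | i : J] = map f (map s (enum J)) by rewrite -map_comp.
apply: perm_map; apply: uniq_perm; rewrite ?enum_uniq //.
  by rewrite map_inj_uniq ?enum_uniq //; exact: bij_inj.
have [s' _ s'K] := bs; move=> i; rewrite mem_enum; apply/mapP.
by exists (s' i); rewrite ?mem_enum ?s'K.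
Qed.

Lemma order_stat_entry_sq_trmx (R : realType) (p q : nat) (M : 'M[R]_(p, q)) k :
  order_stat (entry_sq M^T) k = order_stat (entry_sq M) k.
Proof.
rewrite -(order_stat_reindex (entry_sq M) (s := fun e : 'I_q * 'I_p => (e.2, e.1))) //.
  by congr order_stat; apply/funext => -[i j]; rewrite /entry_sq mxE.
by exists (fun e => (e.2, e.1)) => -[].
Qed.

Lemma row_sumsq_trmx (R : realType) (p q : nat) (M : 'M[R]_(p, q)) :
  row_sumsq M^T = col_sumsq M.
Proof. by apply/funext => t; apply: eq_bigr => i _; rewrite mxE. Qed.

(** * The eigenvalues of the sample covariance matrix *)

Theorem theorem3p1 (R : realType) (d : measure_display)
    (Omega : measurableType d) (P : probability Omega R)
    (alpha beta pplus pminus : R) (L ell : R -> R)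
    (p : nat -> nat) (a : nat -> R)
    (Z : {RV P >-> R})
    (Zn : forall n : nat, 'I_(p n) -> 'I_n -> {RV P >-> R})
    (alpha_range : 0 < alpha < 4) (beta_ge0 : 0 <= beta)
    (Z_indep : forall n : nat,
       mutually_independent (fun it : 'I_(p n) * 'I_n => Zn n it.1 it.2))
    (Z_ident : forall (n : nat) (i : 'I_(p n)) (t : 'I_n),
       identically_distributed (Zn n i t) Z)
    (pplus_ge0 : 0 <= pplus) (pminus_ge0 : 0 <= pminus)
    (pplus_pminus : pplus + pminus = 1)
    (L_sv : slowly_varying L)
    (right_tail :
       fine (P [set w | x < Z w]) / (L x * x `^ (- alpha)) @[x --> +oo]
         --> pplus)
    (left_tail :
       fine (P [set w | Z w < - x]) / (L x * x `^ (- alpha)) @[x --> +oo]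
         --> pminus)
    (Z_centered : 2 <= alpha -> ('E_P[Z] = 0)%E)
    (ell_sv : slowly_varying ell)
    (p_growth : forall n : nat, (1 <= n)%N ->
       (p n)%:R = n%:R `^ beta * ell n%:R)
    (p_growth0 : beta = 0 -> ell n%:R @[n --> \oo] --> +oo)
    (a_norm :
       fine (P [set w | a k < `|Z w|]) / k%:R^-1 @[k --> \oo] --> (1 : R)) :
  let M := fun n : nat => random_matrix (Zn n) in
  let lambda := fun (n : nat) (w : Omega) => ordered_eigenvalue (M n w) in
  [/\ beta <= 1 ->
        cvg_in_probability P (fun n w =>
          a (n * p n)%N ^- 2 *
          max_dist (p n) (lambda n w) (order_stat (row_sumsq (M n w)))) 0,
      1 < beta ->
        cvg_in_probability P (fun n w =>
          a (n * p n)%N ^- 2 *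
          max_dist n (lambda n w) (order_stat (col_sumsq (M n w)))) 0
    & Num.max (alpha / 2 - 1) 0 < Num.min beta beta^-1 <= 1 ->
        cvg_in_probability P (fun n w =>
          a (n * p n)%N ^- 2 *
          max_dist (p n) (lambda n w) (order_stat (entry_sq (M n w)))) 0].
Proof.
move=> M lambda.
have /andP[alpha0 alpha4] := alpha_range.
have mZ : measurable_fun setT (Z : Omega -> R) by exact: measurable_funPT.
have G_gt0 := tailP_gt0 mZ pplus_pminus L_sv right_tail left_tail.
have G_ratio := tailP_ratio mZ pplus_pminus L_sv right_tail left_tail.
have centered : 2 <= alpha -> (\int[P]_w (Z w)%:E = 0)%E.
  by move=> /Z_centered; rewrite expectation_def.
have mV n (e : 'I_(p n) * 'I_n) : measurable_fun setT (Zn n e.1 e.2 : Omega -> R) by exact: measurable_funPT.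
have iid n := independent_iid_family (Z_indep n) (fun e : 'I_(p n) * 'I_n => Z_ident n e.1 e.2).
have m_eig n k : measurable_fun setT (fun w => lambda n w k).
  exact: (measurable_finite_continuous (@ordered_eigenvalue_continuous R (p n) n k) (mV n)).
have m_sq n i t : measurable_fun setT (fun w => M n w i t ^+ 2).
  by apply: measurable_funX; under eq_fun do rewrite mxE; exact: (mV n (i, t)).
have m_row n k : measurable_fun setT (fun w => order_stat (row_sumsq (M n w)) k).
  apply: (measurable_order_stat (X := fun i w => row_sumsq (M n w) i)) => [i|i w].
    by apply: measurable_sum => t.
  by apply: sumr_ge0 => t _; exact: sqr_ge0.
have m_col n k : measurable_fun setT (fun w => order_stat (col_sumsq (M n w)) k).
  apply: (measurable_order_stat (X := fun t w => col_sumsq (M n w) t)) => [t|t w].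
    by apply: measurable_sum => i.
  by apply: sumr_ge0 => i _; exact: sqr_ge0.
have m_ent n k : measurable_fun setT (fun w => order_stat (entry_sq (M n w)) k).
  apply: (measurable_order_stat (X := fun e w => entry_sq (M n w) e)) => [e|e w].
    exact: m_sq.
  exact: sqr_ge0.
have NE n : (p n * n)%:R = (n * p n)%:R :> R by rewrite mulnC.
have Noo := dimension_product_pinfty beta_ge0 ell_sv p_growth NE.
have Noo' := dimension_product_pinfty beta_ge0 ell_sv p_growth (fun n => erefl ((n * p n)%:R : R)).
(* for beta > 1 the shorter side must index the rows *)
pose V' n (e : 'I_n * 'I_(p n)) : Omega -> R := Zn n e.2 e.1.
have mV' n e : measurable_fun setT (V' n e) by exact: (mV n (e.2, e.1)).
have iid' n := iid_family_swap (iid n).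
have MT n w : (M n w)^T = \matrix_(t, i) V' n (t, i) w.
  by apply/matrixP => t i; rewrite !mxE.
have p_rows : beta <= 1 -> forall eta, 0 < eta ->
    polyO (fun n => (p n * n)%:R : R) (1 / 2 + eta) (fun n => (p n)%:R).
  move=> b1 eta eta0; apply: (polyO_dimension ell_sv p_growth (N := fun n => (p n * n)%:R) NE); first by lra.
  have := mulr_ge0 beta_ge0 (ltW eta0); rewrite mulrDl; lra.
have n_rows : 1 < beta -> forall eta, 0 < eta ->
    polyO (fun n => (n * p n)%:R : R) (1 / 2 + eta) (fun n => n%:R).
  move=> b1 eta eta0; apply: (polyO_sample_size ell_sv p_growth (N := fun n => (n * p n)%:R)) => //; first by lra.
  have := mulr_ge0 beta_ge0 (ltW eta0); rewrite mulrDl; lra.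
have A0 : \forall n \near \oo, 0 < a (n * p n)%N ^+ 2.
  exact: (norming_gt0 mZ Noo' alpha0 G_gt0 G_ratio a_norm).
split.
- move=> b1; apply: cvg_max_dist => // eps eps0.
  have := whp_eigenvalue_row_sumsq mV mZ iid Noo alpha0 alpha4 G_gt0 G_ratio centered (p_rows b1) a_norm eps0.
  by apply: whp_mono; near=> n => w H k; rewrite [(n * p n)%N]mulnC; exact: H.
- move=> b1; apply: cvg_max_dist => // eps eps0.
  have := whp_eigenvalue_row_sumsq mV' mZ iid' Noo' alpha0 alpha4 G_gt0 G_ratio centered (n_rows b1) a_norm eps0.
  apply: whp_mono; near=> n => w H k; have := H k.
  by rewrite -MT ordered_eigenvalue_trmx row_sumsq_trmx.
move=> /andP[]; rewrite lt_min !gt_max => /andP[/andP[ab b0] /andP[ab' _]] _.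
have b1 : 0 < 1 + beta by lra.
(* N^(q / (1 + beta)) is the length of the longer side up to a small power, with
   q = 1 or q = beta. *)
have pick_kap q : 0 <= q -> q < 1 + beta -> alpha / 2 * q < 1 + beta ->
    exists kap, [/\ 0 <= kap, kap < 1, kap < 2 * alpha^-1 & q < (1 + beta) * kap].
  move=> q0 q1 qa; pose m := Num.min 1 (2 * alpha^-1).
  have qm : q / (1 + beta) < m.
    rewrite lt_min !ltr_pdivrMr // mul1r q1 /=.
    rewrite -(ltr_pM2l alpha0) mulrA mulrCA mulfV ?gt_eqF // mulr1; lra.
  have m1 : m <= 1 by rewrite ge_min lexx.
  have mu : m <= 2 * alpha^-1 by rewrite ge_min lexx orbT.
  have q10 : 0 <= q / (1 + beta) by rewrite divr_ge0 // ltW.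
  exists ((q / (1 + beta) + m) / 2); split; try lra.
  by rewrite mulrC -ltr_pdivrMr //; lra.
apply: cvg_max_dist => // eps eps0.
have [le1|gt1] := leP beta 1.
  have [|||kap [k0 k1 ku kb]] := pick_kap 1; [by []|lra|lra|].
  have Oc := polyO_sample_size ell_sv p_growth NE k0 kb.
  have := whp_eigenvalue_entry_sq mV mZ iid Noo alpha0 alpha4 G_gt0 G_ratio centered (p_rows le1)
    a_norm k0 k1 ku Oc eps0.
  by apply: whp_mono; near=> n => w H k; rewrite [(n * p n)%N]mulnC; exact: H.
have aB : alpha / 2 * beta < 1 + beta.
  by move: ab'; rewrite -(ltr_pM2r b0) mulVf ?gt_eqF // mulrBl mul1r; lra.
have [|||kap [k0 k1 ku kb]] := pick_kap beta; [by []|lra|by []|].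
have Oc := polyO_dimension ell_sv p_growth (fun n => erefl ((n * p n)%:R : R)) k0 kb.
have := whp_eigenvalue_entry_sq mV' mZ iid' Noo' alpha0 alpha4 G_gt0 G_ratio centered (n_rows gt1)
  a_norm k0 k1 ku Oc eps0.
apply: whp_mono; near=> n => w H k; have := H k.
by rewrite -MT ordered_eigenvalue_trmx order_stat_entry_sq_trmx.
Unshelve. all: by end_near. Qed.
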